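(* Let $N\ge 3$, $1\le k\le N/2$, $\eta\in\{-1,+1\}$, let $r,s$ be coprime integers with $s\ge 1$, and let $\varpi\in\mathbb{R}$ with $X:=\varpi+2\pi\frac{r}{s}\neq 0$. Consider $N$ unit masses and the relative equilibrium of the regular $N$-gon $$\bar x(t)=e^{\mathbb{J}Xt}\,a\,C,\qquad C=(1,\zeta,\dots,\zeta^{N-1}),\quad \zeta=e^{2\pi i/N},\quad a=(\omega_1/|X|)^{2/3},$$ which in the frame rotating with frequency $\varpi$ becomes the $s$-periodic loop $\bar y(t)=e^{-\mathbb{J}\varpi t}\bar x(t)$ of frequency $2\pi\frac rs$. Set $$V=\inf_{p\ge 0}\frac{\omega_1}{\omega_{(1+2p)k\eta}}|(1+2p)2\pi| ,$$ $$H_+=\inf\left\{4\pi,\ {\inf_{p>0}}^{*}\left(\frac{4p\pi\omega_1}{\omega_1+\omega_{1-2pk\eta}},\ \frac{4p\pi\omega_1}{\omega_{1+2pk\eta}-\omega_1}\right)\right\},$$ $$H_-=\inf\left\{4\pi,\ {\inf_{p>0}}^{*}\left(\frac{4p\pi\omega_1}{\omega_1+\omega_{1+2pk\eta}},\ \frac{4p\pi\omega_1}{\omega_{1-2pk\eta}-\omega_1}\right)\right\},$$ with $p$ ranging over integers. If $$-\inf(V,H_-)\le \varpi+2\pi\tfrac{r}{s}\le \inf(V,H_+),$$ then this relative equilibrium is the sole absolute minimizer of the action among paths which in the frame rotating with frequency $\varpi$ are $s$-periodic loops with the $G_{r/s}(N,k,\eta)$-symmetry (the symmetry of a solution of the vertical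 variational equation); that is, $\bar y$ is the sole absolute minimizer of $\mathcal{A}_\varpi$ in $\Lambda^{G}$, $G=G_{r/s}(N,k,\eta)$.
   Context: Bodies are labelled by $j\in\mathbb{Z}/N\mathbb{Z}$; positions are in $\mathbb{R}^3=\mathbb{C}\times\mathbb{R}$ (horizontal plane $\times$ vertical axis), and configurations are taken with center of mass at the origin (i.e. modulo translations). $e^{\mathbb{J}\phi}$ acts on each body by $(h,z)\mapsto(e^{i\phi}h,z)$; $\mathbb{J}(h,z)=(ih,0)$. $C$ is placed in the horizontal plane. Frequencies: $\rho_j=|\zeta^j-1|$ and, for $l\in\mathbb{Z}$, $\omega_l=\left(\sum_{j=1}^{N-1}\frac{1-\zeta^{jl}}{\rho_j^3}\right)^{1/2}\ge 0$; it depends only on $l$ mod $N$, $\omega_{-l}=\omega_l$, and $\omega_l=0$ iff $l\equiv0$ mod $N$. These are the frequencies of the vertical variational equation along $e^{\mathbb{J}\omega_1t}C$, which is a solution of Newton's equations with unit masses and gravitational constant $1$. In $V,H_\pm$ the terms involving some $\omega_l$ with $l\equiv 0\pmod N$ are omitted (this is the meaning of $\inf^*$), and a term with zero denominator is read as $+\infty$. Symmetry: $\Lambda$ is the space of $s$-periodic $H^1$ loops $y=(y_j)_{j}$ of configurations. $\Lambda^G$ for $G=G_{r/s}(N,k,\eta)$ is the set of $y=(h_j,z_j)_j\in\Lambda$ such that for every $(\theta,\delta,\beta,\xi)\in\mathbb{R}/s\mathbb{Z}\times\mathbb{Z}/N\mathbb{Z}\times\mathbb{Z}/2\mathbb{Z}\times\{\pm1\}$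 with $\theta\equiv\frac{\beta}{2}+k\eta\frac{\delta}{N}\pmod 1$, and all $j,t$, $$h_j(t)=e^{2\pi i\alpha}\,\overline{h_{\xi(j+\delta)}(\xi(t-\theta))}^{\,\xi},\qquad z_j(t)=(-1)^{\beta}z_{\xi(j+\delta)}(\xi(t-\theta)),\qquad \alpha=\frac rs\theta-\frac{\delta}{N}\pmod 1,$$ where $\overline{h}^{\,\xi}=h$ if $\xi=1$ and $\bar h$ (complex conjugate) if $\xi=-1$. (This is the symmetry of the motion $x_j(t)=(\zeta^je^{2\pi i\frac rst},\mathrm{Re}(\zeta^{\eta kj}e^{2\pi it}))$.) Action: $\mathcal{A}_\varpi(y)=\int_0^{s}\left(\frac12|\dot y+\varpi\mathbb{J}y|^2+U(y)\right)dt$, $|\dot y|^2=\sum_j\|\dot y_j\|^2$, $U(y)=\sum_{i<j}\frac{1}{\|y_i-y_j\|}$ ($+\infty$ allowed); it is the Lagrangian action over $[0,s]$ of $x(t)=e^{\mathbb{J}\varpi t}y(t)$.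
   Formalization: Uniqueness holds only up to horizontal rotation by π, as −ȳ is also in Λ^G with equal action; and up to an isometry of R³ of the inertial motion when k=1 and X=2πη (tilted polygons), or k=1, N=4 and X=−2πη (mirror image). *)

(* Defs.v *)
From HB Require Import structures.
From mathcomp Require Import all_boot all_order all_algebra.
From mathcomp Require Import all_classical all_reals all_analysis.
From mathcomp Require Import complex.

Set Implicit Arguments.
Unset Strict Implicit.
Unset Printing Implicit Defensive.

Import Order.TTheory GRing.Theory Num.Theory.
Import numFieldNormedType.Exports.

Local Open Scope classical_set_scope.
Local Open Scope ring_scope.

Section Bodies.
Variable R : realType.

(* R^3 = C x R, horizontal plane times vertical axis.  The norm that the
   library attaches to a product is the sup norm; [enorm] is the Euclidean
   one. *)
Definition body : Type := (R[i] * R)%type.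

Definition enorm (u : body) : R :=
  Num.sqrt (complex.Re u.1 ^+ 2 + complex.Im u.1 ^+ 2 + u.2 ^+ 2).

Definition bscale (c : R) (u : body) : body := (c%:C%C * u.1, c * u.2).

Definition expi (x : R) : R[i] := (cos x +i* sin x)%C.

Definition Jgen (u : body) : body := ('i%C * u.1, 0).

Definition rotJ (phi : R) (u : body) : body := (expi phi * u.1, u.2).

(* Bodies are labelled by 'Z_N, which is Z/NZ only for N > 1. *)
Definition conf (N : nat) : Type := 'Z_N -> body.

Definition centered (N : nat) (y : conf N) : Prop := \sum_j y j = 0.

Definition norm2 (N : nat) (y : conf N) : R := \sum_j enorm (y j) ^+ 2.

(* In \bar R one has 0^-1 = +oo, so U = +oo on collisions. *)
Definition U (N : nat) (y : conf N) : \bar R :=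
  (\sum_(i : 'Z_N) \sum_(j : 'Z_N | (i < j)%N) ((enorm (y i - y j))%:E)^-1)%E.

End Bodies.

Section Sobolev.
Variable R : realType.
Local Notation mu := (@lebesgue_measure R).

(* g is a square integrable weak derivative of (the continuous
   representative) f on [0, s]. *)
Definition weak_derivative (s : R) (f g : R -> R) : Prop :=
  [/\ measurable_fun `[0, s] g,
      (\int[mu]_(t in `[0%R, s]) ((g t ^+ 2)%:E) < +oo)%E &
      forall t, 0 <= t <= s -> f t = f 0 + \int[mu]_(u in `[0, t]) g u].

Definition H1 (s : R) (f : R -> R) : Prop := exists g, weak_derivative s f g.

(* A representative of the weak derivative, which is unique up to a null set;
   it is only used under an integral. *)
Definition wderiv (s : R) (f : R -> R) : R -> R :=
  xget (fun=> 0) [set g | weak_derivative s f g].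

End Sobolev.

Section Loops.
Variables (R : realType) (N : nat).
Local Notation mu := (@lebesgue_measure R).
Implicit Types (y : R -> conf R N).

Definition coordx y (j : 'Z_N) (t : R) : R := complex.Re (y t j).1.
Definition coordy y (j : 'Z_N) (t : R) : R := complex.Im (y t j).1.
Definition coordz y (j : 'Z_N) (t : R) : R := (y t j).2.

Definition velocity (s : R) y (t : R) : conf R N := fun j =>
  ((wderiv s (coordx y j) t +i* wderiv s (coordy y j) t)%C,
   wderiv s (coordz y j) t).

Definition Lambda (s : R) y : Prop :=
  [/\ forall t, y (t + s) = y t,
      forall j, [/\ H1 s (coordx y j), H1 s (coordy y j) & H1 s (coordz y j)] &
      forall t, centered (y t)].

Definition action (s varpi : R) y : \bar R :=
  (\int[mu]_(t in `[0%R, s])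
     ((2^-1 * norm2 (fun j => velocity s y t j
                              + bscale varpi (Jgen (y t j)))%R)%:E
      + U (y t)))%E.

(* theta and delta run over representatives of R/sZ and Z/NZ; on s-periodic
   loops the conditions do not depend on these choices, since changing them
   changes alpha by integers only. *)
Definition G_symmetric (r s : int) (k eta : int) y : Prop :=
  forall (theta : R) (delta : 'Z_N) (beta : bool) (xi : int),
    xi = 1 \/ xi = -1 ->
    (exists m : int, theta = beta%:R / 2
       + (k * eta)%:~R * ((delta : nat)%:R / N%:R) + m%:~R) ->
    let alpha : R := r%:~R / s%:~R * theta - (delta : nat)%:R / N%:R in
    forall (j : 'Z_N) (t : R),
      let u := y (xi%:~R * (t - theta)) ((j + delta) *~ xi) in
      (y t j).1 = expi (2 * pi * alpha) * (if xi == 1 then u.1 else u.1^*%C)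
      /\ (y t j).2 = (-1) ^+ beta * u.2.

Definition LambdaG (r s : int) (k eta : int) y : Prop :=
  Lambda s%:~R y /\ G_symmetric r s k eta y.

(* Equality of motions up to an isometry of R^3, fixed in time, that preserves
   the center of mass.  Since the isometry need not commute with [rotJ], this
   is meant for motions in the inertial frame. *)
Definition congruent_motions (x x' : R -> conf R N) : Prop :=
  exists g : body R -> body R,
    [/\ forall u v, enorm (g u - g v) = enorm (u - v),
        g 0 = 0 &
        forall t j, x t j = g (x' t j)].

Definition inertial (varpi : R) y : R -> conf R N :=
  fun t j => rotJ (varpi * t) (y t j).

End Loops.

Section Frequencies.
Variables (R : realType) (N : nat).

Definition zeta : R[i] := expi (2 * pi / N%:R).

Definition rho (j : nat) : R := ComplexField.Normc.normc (zeta ^+ j - 1).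

(* The sum is real, its terms of indices j and N - j being conjugate. *)
Definition omega (l : int) : R :=
  Num.sqrt (complex.Re
    (\sum_(1 <= j < N) (1 - zeta ^ (j%:Z * l)) / ((rho j ^+ 3)%:C)%C)).

Definition regular_polygon : conf R N := fun j => (zeta ^+ j, 0).

Definition radius (X : R) : R := (omega 1 / `|X|) `^ (2 / 3).

Definition rel_eq (X : R) : R -> conf R N := fun t j =>
  rotJ (X * t) (bscale (radius X) (regular_polygon j)).

Definition rel_eq_rotating (varpi X : R) : R -> conf R N := fun t j =>
  rotJ (- (varpi * t)) (rel_eq X t j).

(* Modes with N | l are the ones that move the center of mass; they have
   omega l = 0 and are omitted from the infima. *)
Definition nonzero_mode (l : int) : bool := ~~ (N%:Z %| l)%Z.

(* In the next three definitions the divisions are those of \bar R, where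
   0^-1 = +oo. *)
Definition Vbound (k eta : int) : \bar R :=
  ereal_inf [set x | exists p : int,
    [/\ 0 <= p, nonzero_mode ((1 + 2 * p) * k * eta) &
        x = ((omega 1)%:E / (omega ((1 + 2 * p) * k * eta))%:E
             * (`|(1 + 2 * p)%:~R * (2 * pi)|%R)%:E)%E]].

Definition Hterm_sum (p l : int) : \bar R :=
  ((4 * p%:~R * pi * omega 1)%:E / (omega 1 + omega l)%:E)%E.

Definition Hterm_diff (p l : int) : \bar R :=
  ((4 * p%:~R * pi * omega 1)%:E / (omega l - omega 1)%:E)%E.

Definition Hbound (sgn k eta : int) : \bar R :=
  ereal_inf ([set (4 * pi)%:E] `|`
    [set x | exists p : int,
      [/\ 0 < p, nonzero_mode (1 - sgn * (2 * p * k * eta)) &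
          x = Hterm_sum p (1 - sgn * (2 * p * k * eta))]] `|`
    [set x | exists p : int,
      [/\ 0 < p, nonzero_mode (1 + sgn * (2 * p * k * eta)) &
          x = Hterm_diff p (1 + sgn * (2 * p * k * eta))]]).

Definition Hplus (k eta : int) : \bar R := Hbound 1 k eta.
Definition Hminus (k eta : int) : \bar R := Hbound (-1) k eta.

End Frequencies.

(* Main.v *)
Require Import Defs.
From mathcomp Require Import all_boot all_order all_algebra.
From mathcomp Require Import all_classical all_reals all_analysis measurable_realfun.
From mathcomp Require Import complex ring lra zify.

Set Implicit Arguments.
Unset Strict Implicit.
Unset Printing Implicit Defensive.

Import Order.TTheory GRing.Theory Num.Theory.
Import numFieldNormedType.Exports.

Local Open Scope classical_set_scope.
Local Open Scope ring_scope.

(** The proof combines a convexity inequality for the potential with Fourier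
   analysis over the labels of the bodies.

   Seen as a function of r^2, the potential 1/r is convex.  It is therefore at
   least its tangent line at the corresponding distance of the regular polygon of
   radius [a], and the excess dominates the squared difference of the two
   distances ([inv_tangent]).  Summed over the pairs of bodies, this bounds the
   action of a loop from below by a constant, plus half of a quadratic form, plus
   an integral [gap] of squared differences of distances ([action_ge]).  The
   constant is the action of the relative equilibrium ([ybar_action]).

   The quadratic form is invariant under the cyclic permutations of the labels,
   so the discrete Fourier transform makes it a sum over the modes [l].  A
   horizontal mode [f] contributes the integral of
   |f' + i varpi f|^2 - kappa_l |f|^2, and a vertical mode the same integral with
   [varpi] replaced by 0; here kappa_l = omega_l^2 / a^3 = X^2 omega_l^2 / omega_1^2.
   The symmetry group makes each mode quasi-periodic: certain translations of
   time, which are the multiples of T = gcd(N, 2 k) / (2 N), multiply it by a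
   phase ([hmode_rule], [vmode_rule]).  Its frequencies are then known up to
   multiples of 2 pi / T, and one of them, lam, satisfies |lam| T <= pi
   ([small_admissible]).  For such a lam the Wirtinger inequality
   ([periodic_wirtinger]) bounds the integral of |f' + i varpi f|^2 below by
   lam^2 times that of |f|^2; it is obtained on an interval of length T by
   subtracting a pure mode, which leaves a function vanishing at both ends, and
   by completing a square with a solution of a Riccati equation ([picone]).  The
   hypotheses on X, with the definitions of V and H, say that lam^2 is at least
   kappa_l for all the frequencies that the symmetry allows ([vertical_mode],
   [horizontal_mode]).  So the quadratic form is nonnegative and the relative
   equilibrium is a minimizer.

   In the case of equality the gap vanishes, and all the mutual distances are at
   every time those of the polygon.  As omega_1 is the smallest frequency,
   attained for the indices 1 and -1 only ([omega1_lt]), such a configuration has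
   no other modes ([rigid_modes]).  Each of them is zero or a pure mode,
   whose frequency in the inertial frame is X or -X.  The horizontal mode 1 turns like the polygon, and
   the other two vanish unless k = 1 and |X| = 2 pi.  If they vanish, the loop is
   the relative equilibrium up to a rotation, of angle 0 or pi because the
   symmetry makes the mode real at time 0.  If not, each body describes in the
   inertial frame an ellipse with a vertical oscillation of the same period; that
   it stays at distance [a] from the center, and for four bodies also one mutual
   distance, ties the amplitudes together in such a way that the motion is the
   image of the relative equilibrium under an isometry ([tilted_congruent]). *)

(** * Integrals and absolutely continuous functions on an interval *)

Section Integrals.
Variable R : realType.
Local Notation mu := (@lebesgue_measure R).
Implicit Types (a b c t : R) (f g : R -> R).

Definition Int a b f : R := \int[mu]_(t in `[a, b]) f t.
Definition L1 a b f := mu.-integrable `[a, b] (EFin \o f).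
Definition L2 a b f := measurable_fun `[a, b] f /\ L1 a b (fun t => f t ^+ 2).
Definition cont a b f := {within `[a, b], continuous f}.

Lemma L1_measurable a b f : L1 a b f -> measurable_fun `[a, b] f.
Proof. by move=> /measurable_int/measurable_EFinP. Qed.

Lemma L1D a b f g : L1 a b f -> L1 a b g -> L1 a b (fun t => f t + g t).
Proof. by move=> hf hg; have /(_ (measurable_itv _)) := integrableD _ hf hg. Qed.

Lemma L1Z a b k f : L1 a b f -> L1 a b (fun t => k * f t).
Proof. by move=> hf; have /(_ (measurable_itv _)) := integrableZl _ k hf. Qed.

Lemma L1B a b f g : L1 a b f -> L1 a b g -> L1 a b (fun t => f t - g t).
Proof. by move=> hf hg; have /(_ (measurable_itv _)) := integrableB _ hf hg. Qed.

Lemma L1_le a b f g : measurable_fun `[a, b] f ->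
  (forall t, t \in `[a, b] -> `|f t| <= g t) -> L1 a b g -> L1 a b f.
Proof.
move=> mf h hg; apply: (le_integrable _ _ _ hg) => //.
  exact/measurable_EFinP.
move=> t /= tab; rewrite lee_fin (le_trans (h t _))//; last exact: ler_norm.
Qed.

Lemma L1_abs a b f : L1 a b f -> L1 a b (fun t => `|f t|).
Proof. by move=> hf; exact: (integrable_abse hf). Qed.

Lemma L1_sub a b a' b' f : a <= a' -> b' <= b -> L1 a b f -> L1 a' b' f.
Proof.
move=> aa bb; apply: integrableS => //; apply: subset_itv; rewrite bnd_simp//.
Qed.

Lemma L1_ext a b f g : (forall t, t \in `[a, b] -> f t = g t) ->
  L1 a b f -> L1 a b g.
Proof.
move=> fg; apply: eq_integrable => // t; rewrite inE /= => /fg ->//.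
Qed.

Lemma cont_L1 a b f : cont a b f -> L1 a b f.
Proof.
by move=> cf; apply: continuous_compact_integrable => //; exact: segment_compact.
Qed.

Lemma L1_cst a b k : L1 a b (fun=> k).
Proof. by apply: cont_L1; apply: continuous_subspaceT => x; exact: cvg_cst. Qed.

Lemma L1_sum (I : Type) (r : seq I) (P : pred I) a b (F : I -> R -> R) :
  (forall i, P i -> L1 a b (F i)) -> L1 a b (fun t => \sum_(i <- r | P i) F i t).
Proof.
move=> h; elim: r => [|i r IH].
  apply: (@L1_ext _ _ (fun=> 0)) => [t _|]; first by rewrite big_nil.
  exact: L1_cst.
apply: (@L1_ext _ _ (fun t => (if P i then F i t else 0)
   + \sum_(j <- r | P j) F j t)) => [t _|].
  by rewrite big_cons; case: (P i); rewrite ?add0r.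
apply: L1D => //; case Pi: (P i); [exact: h|exact: L1_cst].
Qed.

Lemma cont_measurable a b f : cont a b f -> measurable_fun `[a, b] f.
Proof. by move/cont_L1/L1_measurable. Qed.

Lemma contD a b f g : cont a b f -> cont a b g -> cont a b (fun t => f t + g t).
Proof. by move=> cf cg t; apply: continuousD; [exact: cf|exact: cg]. Qed.

Lemma contM a b f g : cont a b f -> cont a b g -> cont a b (fun t => f t * g t).
Proof. by move=> cf cg t; apply: continuousM; [exact: cf|exact: cg]. Qed.

Lemma cont_cst a b k : cont a b (fun=> k).
Proof. by apply: continuous_subspaceT => x; exact: cvg_cst. Qed.

Lemma cont_sum (I : Type) (r : seq I) (P : pred I) a b (F : I -> R -> R) :
  (forall i, P i -> cont a b (F i)) ->
  cont a b (fun t => \sum_(i <- r | P i) F i t).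
Proof.
move=> h; elim: r => [|i r IH].
  rewrite (_ : (fun _ => _) = (fun=> 0)); first exact: cont_cst.
  by apply/funext => t; rewrite big_nil.
rewrite (_ : (fun _ => _) = (fun t => (if P i then F i t else 0)
   + \sum_(j <- r | P j) F j t)); last first.
  by apply/funext => t; rewrite big_cons; case: (P i); rewrite ?add0r.
apply: contD => //; case Pi: (P i); [exact: h|exact: cont_cst].
Qed.

Lemma cont_sub a b a' b' f : a <= a' -> b' <= b -> cont a b f -> cont a' b' f.
Proof.
move=> aa bb; apply: continuous_subspaceW; apply: subset_itv; rewrite bnd_simp//.
Qed.

Lemma cont_bounded a b f : cont a b f ->
  exists M, forall t, t \in `[a, b] -> `|f t| <= M.
Proof.
move=> cf; case: (leP a b) => ab; last first.
  exists 0 => t; rewrite in_itv /= => /andP[h1 h2].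
  by have := le_trans h1 h2; rewrite leNgt ab.
have cn : cont a b (fun t => `|f t|).
  by move=> t; apply: (@cvg_norm _ R^o); exact: cf.
by have [c _ hc] := EVT_max ab cn; exists `|f c|.
Qed.

Lemma IntD a b f g : L1 a b f -> L1 a b g ->
  Int a b (fun t => f t + g t) = Int a b f + Int a b g.
Proof. by move=> hf hg; rewrite /Int RintegralD. Qed.

Lemma IntB a b f g : L1 a b f -> L1 a b g ->
  Int a b (fun t => f t - g t) = Int a b f - Int a b g.
Proof. by move=> hf hg; rewrite /Int RintegralB. Qed.

Lemma IntZ a b k f : L1 a b f -> Int a b (fun t => k * f t) = k * Int a b f.
Proof. by move=> hf; rewrite /Int RintegralZl. Qed.

Lemma Int_ext a b f g : (forall t, t \in `[a, b] -> f t = g t) ->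
  Int a b f = Int a b g.
Proof. by move=> h; apply: eq_Rintegral => t; rewrite inE => /h. Qed.

Lemma Int_sum (I : Type) (r : seq I) (P : pred I) a b (F : I -> R -> R) :
  (forall i, P i -> L1 a b (F i)) ->
  Int a b (fun t => \sum_(i <- r | P i) F i t) = \sum_(i <- r | P i) Int a b (F i).
Proof.
move=> h; elim: r => [|i r IH].
  rewrite big_nil (@Int_ext _ _ _ (fun=> 0 * 0)) => [|t _]; last by rewrite big_nil mul0r.
  by rewrite IntZ ?mul0r//; exact: L1_cst.
rewrite big_cons -IH; case: ifP => Pi.
  rewrite -IntD; last exact: L1_sum; last exact: h.
  by apply: Int_ext => t _; rewrite big_cons Pi.
by apply: Int_ext => t _; rewrite big_cons Pi.
Qed.

Lemma Int_ge0 a b f : (forall t, t \in `[a, b] -> 0 <= f t) -> 0 <= Int a b f.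
Proof. by move=> h; apply: Rintegral_ge0 => t; exact: h. Qed.

Lemma Int_le a b f g : L1 a b f -> L1 a b g ->
  (forall t, t \in `[a, b] -> f t <= g t) -> Int a b f <= Int a b g.
Proof. by move=> hf hg h; apply: le_Rintegral. Qed.

Lemma Int_abs a b f : L1 a b f -> `|Int a b f| <= Int a b (fun t => `|f t|).
Proof. by move=> hf; apply: le_normr_Rintegral. Qed.

Lemma Int_cst a b k : a <= b -> Int a b (fun=> k) = k * (b - a).
Proof.
move=> ab; rewrite /Int Rintegral_cst//= lebesgue_measure_itv/= lte_fin.
by case: ltgtP ab => // ->; rewrite ?subrr.
Qed.

Lemma Int_aa a f : Int a a f = 0.
Proof. by rewrite /Int set_itv1 Rintegral_set1. Qed.

Lemma Int_cat a c b f : a <= c -> c <= b -> L1 a b f ->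
  Int a b f = Int a c f + Int c b f.
Proof.
move=> ac cb hf.
have := @Rintegral_itvB R f (BLeft a) (BRight b) c hf.
rewrite !bnd_simp => /(_ ac cb).
rewrite Rintegral_itv_obnd_cbnd; last first.
  by apply: integrableS hf => //; apply: subset_itv; rewrite bnd_simp.
by rewrite /Int => /(canRL (subrK _)) ->; rewrite addrC.
Qed.

Lemma Int_cont a b f : a <= b -> L1 a b f -> cont a b (fun t => Int a t f).
Proof. by move=> ab hf; exact: parameterized_integral_continuous. Qed.

Lemma L2_L1M a b f g : L2 a b f -> L2 a b g -> L1 a b (fun t => f t * g t).
Proof.
move=> [mf hf] [mg hg].
apply: (@L1_le _ _ _ (fun t => f t ^+ 2 + g t ^+ 2)).
- exact: measurable_funM.
- move=> t _; rewrite normrM -(real_normK (num_real (f t))).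
  rewrite -[X in _ <= _ + X](real_normK (num_real (g t))).
  have := normr_ge0 (f t); have := normr_ge0 (g t).
  set x := `|f t|; set y := `|g t|; nra.
- exact: L1D.
Qed.

Lemma cont_L2 a b f : cont a b f -> L2 a b f.
Proof.
move=> cf; split; first exact: cont_measurable.
by apply: cont_L1; exact: contM.
Qed.

Lemma L2_L1 a b f : L2 a b f -> L1 a b f.
Proof.
move=> h; have := L2_L1M h (cont_L2 (@cont_cst a b 1)).
by apply: L1_ext => t _; rewrite mulr1.
Qed.

Lemma L2Mcont a b f g : cont a b f -> L2 a b g -> L2 a b (fun t => f t * g t).
Proof.
move=> cf [mg hg]; have mf := cont_measurable cf.
split; first exact: measurable_funM.
have [M hM] := cont_bounded cf.
apply: (@L1_le _ _ _ (fun t => M ^+ 2 * g t ^+ 2)); last exact: L1Z.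
  by apply: measurable_funX; exact: measurable_funM.
move=> t tab; rewrite ger0_norm ?sqr_ge0// exprMn ler_wpM2r ?sqr_ge0//.
by rewrite -(real_normK (num_real (f t))) lerXn2r ?nnegrE ?normr_ge0 ?hM//
  (le_trans _ (hM t tab)).
Qed.

Lemma L2D a b f g : L2 a b f -> L2 a b g -> L2 a b (fun t => f t + g t).
Proof.
move=> hf hg; split; first by apply: measurable_funD; [case: hf|case: hg].
apply: (@L1_ext _ _ (fun t => (f t ^+ 2 + g t ^+ 2) + 2 * (f t * g t))).
  by move=> t _; ring.
by apply: L1D; [apply: L1D; [case: hf|case: hg]|apply: L1Z; exact: L2_L1M].
Qed.

Lemma L2Z a b k f : L2 a b f -> L2 a b (fun t => k * f t).
Proof. by move=> hf; apply: L2Mcont => //; exact: cont_cst. Qed.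

Lemma L2_sub a b a' b' f : a <= a' -> b' <= b -> L2 a b f -> L2 a' b' f.
Proof.
move=> aa bb [mf hf]; split; last exact: L1_sub hf.
by apply: measurable_funS mf => //; apply: subset_itv; rewrite bnd_simp.
Qed.

Lemma L2_ext a b f g : (forall t, t \in `[a, b] -> f t = g t) ->
  L2 a b f -> L2 a b g.
Proof.
move=> fg [mf hf]; split; last by apply: L1_ext hf => t /fg ->.
by apply: eq_measurable_fun mf => t; rewrite inE => /fg.
Qed.

(** A function whose increments are dominated by squared increments of a
   continuous function is constant: bisecting the range of that function halves
   the bound at each step. *)
Lemma square_increments_cst a b (h Phi : R -> R) : cont a b Phi ->
  (forall x y, a <= x -> x <= y -> y <= b -> Phi x <= Phi y) ->
  (forall x y, a <= x -> x <= y -> y <= b ->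
     `|h y - h x| <= (Phi y - Phi x) ^+ 2) ->
  a <= b -> h b = h a.
Proof.
move=> cPhi mono hle ab.
have H k : forall x y, a <= x -> x <= y -> y <= b ->
    `|h y - h x| <= (Phi y - Phi x) ^+ 2 * 2^-1 ^+ k.
  elim: k => [|k IH] x y ax xy yb; first by rewrite mulr1 hle.
  have cxy : cont x y Phi by apply: cont_sub cPhi.
  have Pxy := mono _ _ ax xy yb.
  have [|c] := @IVT _ Phi x y ((Phi x + Phi y) / 2) xy cxy.
    rewrite min_l// max_r//; apply/andP; split; lra.
  rewrite in_itv /= => /andP[xc cy] hc.
  have h1 := IH _ _ ax xc (le_trans cy yb).
  have h2 := IH _ _ (le_trans ax xc) cy yb.
  have -> : h y - h x = (h y - h c) + (h c - h x) by ring.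
  rewrite (le_trans (ler_normD _ _))// (le_trans (lerD h2 h1))//.
  rewrite hc [2^-1 ^+ k.+1]exprS; set e := 2^-1 ^+ k; rewrite le_eqVlt; apply/orP; left; apply/eqP; by field.
apply/eqP; rewrite -subr_eq0; apply: contraT; rewrite -normr_gt0.
set d := `|_| => d0; set C := (Phi b - Phi a) ^+ 2.
have C0 : 0 <= C / d by rewrite divr_ge0 ?sqr_ge0// ltW.
have := archi_boundP C0; set k := Num.bound _ => hk.
have := H k a b (lexx _) ab (lexx _); rewrite -/d -/C exprVn leNgt => /negP; case.
rewrite ltr_pdivrMr ?exprn_gt0// mulrC -ltr_pdivrMr//; apply: lt_trans hk _.
by rewrite -natrX ltr_nat ltn_expl.
Qed.

(** The Sobolev space H^1 of the segment: [g] is a weak derivative of the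
   continuous function [f]. *)
Definition ac a b f g := L2 a b g /\ forall t, t \in `[a, b] -> f t = f a + Int a t g.

Lemma ac_L2 a b f g : ac a b f g -> L2 a b g. Proof. by case. Qed.

Lemma ac_incr a b f g x y : ac a b f g -> a <= x -> x <= y -> y <= b ->
  f y = f x + Int x y g.
Proof.
move=> [hg hf] ax xy yb.
have xb := le_trans xy yb; have ay := le_trans ax xy.
rewrite (hf y) ?(hf x) ?in_itv/= ?ax ?ay//.
rewrite (@Int_cat a x y g)//; first by rewrite addrA.
by apply: L1_sub (L2_L1 hg).
Qed.

Lemma ac_sub a b a' b' f g : a <= a' -> b' <= b -> ac a b f g -> ac a' b' f g.
Proof.
move=> aa bb h; split; first exact: L2_sub (ac_L2 h).
move=> t; rewrite in_itv /= => /andP[h1 h2].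
by apply: (ac_incr h) => //; exact: le_trans bb.
Qed.

Lemma ac_ext a b f g f' g' : (forall t, t \in `[a, b] -> f t = f' t) ->
  (forall t, t \in `[a, b] -> g t = g' t) -> ac a b f g -> ac a b f' g'.
Proof.
move=> ff gg [hg hf]; split; first exact: L2_ext hg.
move=> t tab; have := tab; rewrite in_itv /= => /andP[h1 h2].
rewrite -!ff//; last by rewrite in_itv /= lexx (le_trans h1).
rewrite hf//; congr (_ + _); apply: Int_ext => u.
rewrite in_itv /= => /andP[h3 h4]; apply: gg.
by rewrite in_itv /= h3 (le_trans h4).
Qed.

Lemma ac_cont a b f g : a <= b -> ac a b f g -> cont a b f.
Proof.
move=> ab [hg hf].
have : cont a b (fun t => f a + Int a t g).
  by apply: contD; [exact: cont_cst|exact: Int_cont (L2_L1 hg)].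
by apply: subspace_eq_continuous => t; rewrite inE => /hf /esym.
Qed.

Lemma acD a b f g f' g' : ac a b f g -> ac a b f' g' ->
  ac a b (fun t => f t + f' t) (fun t => g t + g' t).
Proof.
move=> [hg hf] [hg' hf']; split; first exact: L2D.
move=> t tab; have := tab; rewrite in_itv /= => /andP[h1 h2].
rewrite hf// hf'// IntD; first by ring.
  by apply: L1_sub (L2_L1 hg).
by apply: L1_sub (L2_L1 hg').
Qed.

Lemma acZ a b k f g : ac a b f g -> ac a b (fun t => k * f t) (fun t => k * g t).
Proof.
move=> [hg hf]; split; first exact: L2Z.
move=> t tab; have := tab; rewrite in_itv /= => /andP[h1 h2].
rewrite hf// IntZ; first by ring.
by apply: L1_sub (L2_L1 hg).
Qed.

Lemma acB a b f g f' g' : ac a b f g -> ac a b f' g' ->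
  ac a b (fun t => f t - f' t) (fun t => g t - g' t).
Proof.
move=> h /(acZ (-1)) h'; apply: ac_ext (acD h h') => t _; ring.
Qed.

Lemma ac_cst a b k : ac a b (fun=> k) (fun=> 0).
Proof.
split; first exact: cont_L2 (@cont_cst _ _ _).
move=> t; rewrite in_itv /= => /andP[h1 h2].
by rewrite Int_cst// mul0r addr0.
Qed.

Lemma ac_sum (I : Type) (r : seq I) (P : pred I) a b (F G : I -> R -> R) :
  (forall i, P i -> ac a b (F i) (G i)) ->
  ac a b (fun t => \sum_(i <- r | P i) F i t) (fun t => \sum_(i <- r | P i) G i t).
Proof.
move=> h; elim: r => [|i r IH].
  by apply: ac_ext (ac_cst a b 0) => t _; rewrite big_nil.
case Pi : (P i).
  by apply: ac_ext (acD (h i Pi) IH) => t _; rewrite big_cons Pi.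
by apply: ac_ext IH => t _; rewrite big_cons Pi.
Qed.

(** Leibniz rule.  The defect of the product formula over an interval is at most
   the square of the integral of the absolute values of the derivatives. *)
Lemma acM a b f g f' g' : ac a b f g -> ac a b f' g' ->
  ac a b (fun t => f t * f' t) (fun t => f t * g' t + f' t * g t).
Proof.
case: (leP a b) => [ab|ba]; last first.
  move=> [hg _] [hg' _]; split; last first.
    move=> t; rewrite in_itv /= => /andP[h1 h2].
    by have := le_trans h1 h2; rewrite leNgt ba.
  apply: L2_ext hg => t; rewrite in_itv /= => /andP[h1 h2].
  by have := le_trans h1 h2; rewrite leNgt ba.
move=> h h'.
have cf := ac_cont ab h; have cf' := ac_cont ab h'.
have hL2 : L2 a b (fun t => f t * g' t + f' t * g t).
  by apply: L2D; apply: L2Mcont => //; [case: h'|case: h].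
split=> // c; rewrite in_itv /= => /andP[lac cb].
pose H t := f t * f' t - Int a t (fun t => f t * g' t + f' t * g t).
pose K t := `|g t| + `|g' t|.
have LK : L1 a b K by apply: L1D; apply: L1_abs; apply: L2_L1; [case: h|case: h'].
suff : H c = H a by rewrite /H Int_aa subr0 => <-; rewrite subrK.
apply: (@square_increments_cst a c H (fun t => Int a t (fun u => 2 * K u))) => //.
- apply: Int_cont => //; apply: L1Z; exact: L1_sub LK.
- move=> x y ax xy yc.
  rewrite [in leRHS](@Int_cat a x y)//; last first.
    by apply: L1Z; apply: L1_sub LK => //; exact: le_trans cb.
  rewrite lerDl; apply: Int_ge0 => t _; rewrite /K mulr_ge0// addr_ge0//.
move=> x y ax xy yc.
have yb := le_trans yc cb.
have sub f0 : L1 a b f0 -> L1 x y f0 by exact: L1_sub.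
have subY f0 : L1 a b f0 -> L1 a y f0 by exact: L1_sub.
have LKxy := sub _ LK.
rewrite [in leRHS](@Int_cat a x y)//; last by apply: subY; exact: L1Z.
rewrite [in leRHS]addrC addKr IntZ//.
set J := Int x y K.
have J0 : 0 <= J by apply: Int_ge0 => t _; rewrite addr_ge0.
have bnd F G : ac a b F G -> (forall t, `|G t| <= K t) ->
    forall u, u \in `[x, y] -> `|F y - F u| <= J /\ `|F u - F x| <= J.
  move=> hFG GK u; rewrite in_itv /= => /andP[xu uy].
  have ub := le_trans uy yb; have au := le_trans ax xu.
  have LG := L2_L1 (ac_L2 hFG).
  have Jle p q : x <= p -> p <= q -> q <= y -> `|Int p q G| <= J.
    move=> xp pq qy.
    have LKpq : L1 p q K by apply: L1_sub LKxy.
    have LGpq : L1 p q G.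
      by apply: L1_sub LG; [exact: le_trans xp|exact: le_trans yb].
    apply: le_trans (Int_abs LGpq) _.
    apply: (@le_trans _ _ (Int p q K)).
      by apply: Int_le => //; exact: L1_abs.
    rewrite /J (@Int_cat x p y)//; last exact: le_trans qy.
    rewrite (@Int_cat p q y)//; last by apply: L1_sub LKxy.
    rewrite addrCA lerDl addr_ge0//; apply: Int_ge0 => t _; exact: addr_ge0.
  split.
    by rewrite (ac_incr hFG au uy)// addrC addKr; exact: Jle.
  by rewrite (ac_incr hFG ax xu)// addrC addKr; exact: Jle.
have bf := bnd _ _ h; have bf' := bnd _ _ h'.
have -> : H y - H x = Int x y (fun t => (f y - f t) * g' t - (f' t - f' x) * g t).
  rewrite /H (@Int_cat a x y)//; last by apply: subY; exact: L2_L1.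
  have L1g : L1 x y g by apply: sub; apply: L2_L1; case: h.
  have L1g' : L1 x y g' by apply: sub; apply: L2_L1; case: h'.
  have L1s : L1 x y (fun t => f t * g' t + f' t * g t).
    by apply: sub; exact: L2_L1.
  rewrite (@Int_ext _ _ (fun t => (f y - f t) * g' t - (f' t - f' x) * g t)
     (fun t => (f y * g' t + f' x * g t) - (f t * g' t + f' t * g t))); last first.
    by move=> t _; ring.
  rewrite IntB//; last by apply: L1D; exact: L1Z.
  rewrite [in RHS]IntD//; try exact: L1Z.
  rewrite !IntZ// (ac_incr h ax xy yb) (ac_incr h' ax xy yb); ring.
have Lm : L1 x y (fun t => (f y - f t) * g' t - (f' t - f' x) * g t).
  apply: sub; apply: L2_L1; apply: (@L2_ext _ _ (fun t =>
    (f y + -1 * f t) * g' t + (f' x + -1 * f' t) * g t)); first by move=> t _; ring.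
  apply: L2D; apply: L2Mcont; [|by case: h'| |by case: h].
    by apply: contD; [exact: cont_cst|apply: contM => //; exact: cont_cst].
  by apply: contD; [exact: cont_cst|apply: contM => //; exact: cont_cst].
apply: le_trans (Int_abs Lm) _.
apply: (@le_trans _ _ (Int x y (fun t => J * K t))).
  apply: Int_le; [exact: L1_abs|exact: L1Z|] => t txy.
  have [|b1 _] := bf _ t txy; first by move=> u; rewrite lerDl.
  have [|_ b2] := bf' _ t txy; first by move=> u; rewrite lerDr.
  rewrite (le_trans (ler_normB _ _))// !normrM /K mulrDr addrC.
  by apply: lerD; apply: ler_wpM2r.
rewrite IntZ// -/J; nra.
Qed.

Lemma ac_C1 a b f g : (forall t, t \in `[a, b] -> is_derive t 1 f (g t)) ->
  cont a b g -> ac a b f g.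
Proof.
move=> df cg; split; first exact: cont_L2.
move=> t; rewrite in_itv /= => /andP[]; rewrite le_eqVlt => /predU1P[<- _|at' tb].
  by rewrite Int_aa addr0.
have inI x : a <= x -> x <= t -> x \in `[a, b].
  by move=> ax xt; rewrite in_itv /= ax (le_trans xt).
have cf x : a <= x -> x <= t -> {for x, continuous f}.
  move=> ax xt; apply: differentiable_continuous; apply/derivable1_diffP.
  exact: (@ex_derive _ _ _ _ _ _ _ (df x (inI x ax xt))).
have cgt : cont a t g by exact: cont_sub cg.
have := @continuous_FTC2 R g f a t at' cgt; rewrite /Int /Rintegral => ->.
- by rewrite -EFinB /= addrC subrK.
- split.
  + move=> x; rewrite in_itv /= => /andP[/ltW ax /ltW xt].
    exact: (@ex_derive _ _ _ _ _ _ _ (df x (inI x ax xt))).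
  + by apply: cvg_at_right_filter; apply: cf => //; exact: ltW.
  + by apply: cvg_at_left_filter; apply: cf => //; exact: ltW.
- move=> x; rewrite in_itv /= => /andP[/ltW ax /ltW xt].
  rewrite derive1E; exact: (@derive_val _ _ _ _ _ _ _ (df x (inI x ax xt))).
Qed.

Lemma Int_ac a b f g : a <= b -> ac a b f g -> Int a b g = f b - f a.
Proof. by move=> ab [_ /(_ b)]; rewrite in_itv /= ab lexx => ->//; rewrite addrC addKr. Qed.

(** At a point where [f] were positive, [f] would exceed half of its value there
   on a whole interval. *)
Lemma cont_Int_eq0 a b f : a < b -> cont a b f ->
  (forall t, t \in `[a, b] -> 0 <= f t) -> Int a b f = 0 ->
  forall t, t \in `[a, b] -> f t = 0.
Proof.
move=> ab cf f0 If c cab; apply/eqP; rewrite eq_le f0// andbT leNgt.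
apply/negP => fc0; have Lf := cont_L1 cf.
have /subspace_continuousP /(_ c cab) := cf.
move=> /cvgrPdist_lt /(_ (f c / 2)); rewrite divr_gt0// => /(_ isT).
rewrite /prop_near1 /within /= => /nbhs_ballP[d /= d0 hd].
move: cab; rewrite in_itv /= => /andP[ac cb].
pose x := Num.max a (c - d / 2); pose y := Num.min b (c + d / 2).
have ax : a <= x by rewrite le_max lexx.
have yb : y <= b by rewrite ge_min lexx.
have xy : x < y.
  by rewrite lt_min !gt_max ab; apply/and3P; split; try (apply/andP; split); lra.
have : 0 < Int x y f.
  apply: (@lt_le_trans _ _ (Int x y (fun=> f c / 2))).
    rewrite Int_cst ?ltW// mulr_gt0 ?divr_gt0// subr_gt0//.
  apply: Int_le; [exact: L1_cst|exact: L1_sub Lf|] => t.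
  rewrite in_itv /= => /andP[xt ty].
  have : x <= t by []. have : t <= y by [].
  rewrite /x /y ge_max le_min => /andP[tb td] /andP[at' dt].
  have : `|f c - f t| < f c / 2.
    apply: hd; last by rewrite /= in_itv /= at' tb.
    by rewrite -ball_normE /= ltr_norml; apply/andP; split; lra.
  rewrite ltr_norml => /andP[h1 h2]; lra.
have xb := le_trans (ltW xy) yb.
move: If; rewrite (@Int_cat a x b)// (@Int_cat x y b)//; last exact: L1_sub Lf.
  move=> + h1; have h2 : 0 <= Int a x f.
    apply: Int_ge0 => t; rewrite in_itv /= => /andP[at' tx].
    by apply: f0; rewrite in_itv /= at' (le_trans tx).
  have h3 : 0 <= Int y b f.
    apply: Int_ge0 => t; rewrite in_itv /= => /andP[yt tb].
    by apply: f0; rewrite in_itv /= tb (le_trans (le_trans ax (ltW xy))).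
  lra.
exact: ltW.
Qed.

(** The integral of (k f + g)^2 is nonnegative for all real [k], and is here a
   polynomial in [k] without constant term: its linear coefficient is zero. *)
Lemma Int_sqr_eq0M a b f g : L2 a b f -> L2 a b g ->
  Int a b (fun t => g t ^+ 2) = 0 -> Int a b (fun t => f t * g t) = 0.
Proof.
move=> hf hg Ig.
have H k : 0 <= k ^+ 2 * Int a b (fun t => f t ^+ 2)
    + 2 * k * Int a b (fun t => f t * g t).
  have : 0 <= Int a b (fun t => (k * f t + g t) ^+ 2).
    by apply: Int_ge0 => t _; exact: sqr_ge0.
  rewrite (@Int_ext _ _ _ (fun t => (k ^+ 2 * f t ^+ 2
    + 2 * k * (f t * g t)) + g t ^+ 2)); last by move=> t _; ring.
  have L1a := proj2 hf; have L1b := proj2 hg; have L1c := L2_L1M hf hg.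
  rewrite IntD//; last by apply: L1D; exact: L1Z.
  by rewrite IntD ?IntZ// ?Ig ?addr0//; exact: L1Z.
set A := Int _ _ _ in H; set B := Int _ _ _ in H *.
have A0 : 0 <= A by apply: Int_ge0 => t _; exact: sqr_ge0.
apply/eqP; case: (eqVneq B 0) => // Bn.
have := H (- B / (A + 1)).
have A1 : A + 1 != 0 by lra.
have -> : (- B / (A + 1)) ^+ 2 * A + 2 * (- B / (A + 1)) * B
  = - (B ^+ 2 * ((A + 2) / (A + 1) ^+ 2)) by field.
rewrite oppr_ge0 leNgt mulr_gt0//; first by rewrite exprn_even_gt0.
by rewrite divr_gt0 ?exprn_gt0//; lra.
Qed.
End Integrals.

(** * The Wirtinger inequality between two instants *)

Section Wirtinger.
Variable R : realType.
Implicit Types (a b c t nu lam varpi kappa : R) (P Q p q : R -> R).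

Lemma is_derive_affine nu c t : is_derive t (1 : R) (fun u : R => nu * u + c) nu.
Proof.
have := @is_deriveD _ _ _ (nu \*: (@idfun R)) (cst c) t 1 _ _
  (is_deriveZ nu (is_derive_id t 1)) (is_derive_cst c t 1).
by rewrite addr0 scaler1.
Qed.

Lemma is_derive_cos_affine nu c t :
  is_derive t (1 : R) (fun u => cos (nu * u + c)) (- sin (nu * t + c) * nu).
Proof.
exact: (@is_derive1_comp _ (@cos R) (fun u => nu * u + c) t _ _
  (is_derive_cos _) (is_derive_affine nu c t)).
Qed.

Lemma is_derive_sin_affine nu c t :
  is_derive t (1 : R) (fun u => sin (nu * u + c)) (cos (nu * t + c) * nu).
Proof.
exact: (@is_derive1_comp _ (@sin R) (fun u => nu * u + c) t _ _
  (is_derive_sin _) (is_derive_affine nu c t)).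
Qed.

Lemma cont_cos_affine a b nu c : cont a b (fun t => cos (nu * t + c)).
Proof.
apply: continuous_subspaceT => t; apply: differentiable_continuous.
by apply/derivable1_diffP; exact: (@ex_derive _ _ _ _ _ _ _ (is_derive_cos_affine nu c t)).
Qed.

Lemma cont_sin_affine a b nu c : cont a b (fun t => sin (nu * t + c)).
Proof.
apply: continuous_subspaceT => t; apply: differentiable_continuous.
by apply/derivable1_diffP; exact: (@ex_derive _ _ _ _ _ _ _ (is_derive_sin_affine nu c t)).
Qed.

Lemma ac_cos a b nu c :
  ac a b (fun t => cos (nu * t + c)) (fun t => - nu * sin (nu * t + c)).
Proof.
apply: ac_C1 => [t _|]; last by apply: contM; [exact: cont_cst|exact: cont_sin_affine].
by have := is_derive_cos_affine nu c t; rewrite mulNr -mulrN mulrC.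
Qed.

Lemma ac_sin a b nu c :
  ac a b (fun t => sin (nu * t + c)) (fun t => nu * cos (nu * t + c)).
Proof.
apply: ac_C1 => [t _|]; last by apply: contM; [exact: cont_cst|exact: cont_cos_affine].
by have := is_derive_sin_affine nu c t; rewrite mulrC.
Qed.

(** Solution of the Riccati equation w' = - lam^2 - w^2, the logarithmic
   derivative of cos (lam (t - m)) with m the midpoint, and the weight W with
   W' = - 2 w W. *)
Lemma riccati a b lam : a <= b -> `|lam| * (b - a) < pi ->
  exists w W, [/\ ac a b w (fun t => - lam ^+ 2 - w t ^+ 2),
    ac a b W (fun t => - (2 * w t * W t)) & forall t, t \in `[a, b] -> 0 < W t].
Proof.
move=> ab lT; pose m := (a + b) / 2.
pose C t := cos (lam * t + (- lam * m)); pose S t := sin (lam * t + (- lam * m)).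
have C0 t : t \in `[a, b] -> 0 < C t.
  rewrite in_itv /= => /andP[h1 h2]; apply: cos_gt0_pihalf.
  rewrite -ltr_norml (_ : _ + _ = lam * (t - m)); last by ring.
  rewrite normrM.
  have h3 : `|t - m| <= (b - a) / 2.
    by rewrite ler_norml /m; apply/andP; split; lra.
  have h4 : `|lam| * `|t - m| <= `|lam| * ((b - a) / 2) by apply: ler_wpM2l.
  lra.
have cC : cont a b C by exact: cont_cos_affine.
have cS : cont a b S by exact: cont_sin_affine.
have cV : cont a b (fun t => (C t)^-1).
  apply/subspace_continuousP => t tab; apply: cvgV; first exact: lt0r_neq0 (C0 t tab).
  by have /subspace_continuousP := cC; exact.
have dV t : t \in `[a, b] -> is_derive t (1 : R) (fun u => (C u)^-1) ((C t)^-1 ^+ 2 * (lam * S t)).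
  move=> tab; have dC := is_derive_cos_affine lam (- lam * m) t.
  apply: is_derive_eq (is_deriveV (lt0r_neq0 (C0 t tab)) dC) _.
  by rewrite exprVn /GRing.scale /= /S; ring.
have aV : ac a b (fun t => (C t)^-1) (fun t => (C t)^-1 ^+ 2 * (lam * S t)).
  apply: ac_C1 dV _; apply: contM; first exact: contM.
  by apply: contM => //; exact: cont_cst.
have aS := ac_sin a b lam (- lam * m).
exists (fun t => - lam * (S t * (C t)^-1)), (fun t => (C t)^-1 * (C t)^-1); split.
- apply: ac_ext (acZ (- lam) (acM aS aV)) => // t tab.
  have := C0 t tab; rewrite -/(C t) -/(S t); move: (C t) (S t) => x y x0.
  have xn : x != 0 by rewrite gt_eqF.
  by field.
- apply: ac_ext (acM aV aV) => // t tab.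
  have := C0 t tab; move: (C t) (S t) => x y x0.
  have xn : x != 0 by rewrite gt_eqF.
  by field.
- by move=> t tab; rewrite mulr_gt0// invr_gt0 C0.
Qed.

(** Density of the quadratic action: [|f' + i varpi f|^2 - kappa |f|^2] for
   [f = P + i Q] of derivative [p + i q]. *)
Definition energy varpi kappa P Q p q t : R :=
  (p t - varpi * Q t) ^+ 2 + (q t + varpi * P t) ^+ 2
  - kappa * (P t ^+ 2 + Q t ^+ 2).

Section Quadratic.
Variables (a b varpi : R) (P Q p q : R -> R).
Hypotheses (ab : a <= b) (hP : ac a b P p) (hQ : ac a b Q q).

Let cP := ac_cont ab hP.
Let cQ := ac_cont ab hQ.

Lemma L2_twist : L2 a b (fun t => p t - varpi * Q t) /\
                 L2 a b (fun t => q t + varpi * P t).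
Proof.
split; last by apply: L2D; [exact: ac_L2 hQ|apply: L2Z; exact: cont_L2].
apply: (@L2_ext _ _ _ (fun t => p t + - varpi * Q t)) => [t _|].
  by rewrite mulNr.
by apply: L2D; [exact: ac_L2 hP|apply: L2Z; exact: cont_L2].
Qed.

Lemma L1_sqr2 : L1 a b (fun t => P t ^+ 2 + Q t ^+ 2).
Proof.
by apply: L1D; [exact: proj2 (cont_L2 cP)|exact: proj2 (cont_L2 cQ)].
Qed.

Lemma L1_energy kappa : L1 a b (energy varpi kappa P Q p q).
Proof.
apply: L1B; last exact: L1Z L1_sqr2.
by apply: L1D; [exact: proj2 (proj1 L2_twist)|exact: proj2 (proj2 L2_twist)].
Qed.

Lemma Int_energyB kappa kappa' : Int a b (energy varpi kappa P Q p q) =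
  Int a b (energy varpi kappa' P Q p q)
  + (kappa' - kappa) * Int a b (fun t => P t ^+ 2 + Q t ^+ 2).
Proof.
rewrite -IntZ; last exact: L1_sqr2.
rewrite -IntD; [|exact: L1_energy|exact: L1Z L1_sqr2].
by apply: Int_ext => t _; rewrite /energy; ring.
Qed.

Lemma Int_energy0_ge0 : 0 <= Int a b (energy varpi 0 P Q p q).
Proof.
by apply: Int_ge0 => t _; rewrite /energy mul0r subr0 addr_ge0 ?sqr_ge0.
Qed.

(** Picone identity for functions vanishing at both ends: completing the square
   with a solution [w] of the Riccati equation changes the density by the
   derivative of [w |f|^2]. *)
Lemma picone lam w : P a = 0 -> Q a = 0 -> P b = 0 -> Q b = 0 ->
  ac a b w (fun t => - lam ^+ 2 - w t ^+ 2) ->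
  Int a b (energy varpi (lam ^+ 2) P Q p q) =
  Int a b (fun t => (p t - varpi * Q t - w t * P t) ^+ 2) +
  Int a b (fun t => (q t + varpi * P t - w t * Q t) ^+ 2).
Proof.
move=> Pa Qa Pb Qb hw; have cw := ac_cont ab hw.
have [hD1 hD2] := L2_twist.
have h1 : L2 a b (fun t => p t - varpi * Q t - w t * P t).
  apply: (@L2_ext _ _ _ (fun t => (p t - varpi * Q t) + (-1 * w t) * P t)) => [t _|].
    by ring.
  by apply: L2D => //; apply: L2Mcont; [apply: contM => //; exact: cont_cst|exact: cont_L2].
have h2 : L2 a b (fun t => q t + varpi * P t - w t * Q t).
  apply: (@L2_ext _ _ _ (fun t => (q t + varpi * P t) + (-1 * w t) * Q t)) => [t _|].
    by ring.
  by apply: L2D => //; apply: L2Mcont; [apply: contM => //; exact: cont_cst|exact: cont_L2].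
have hphi := acM hw (acD (acM hP hP) (acM hQ hQ)).
have := Int_ac ab hphi; rewrite Pa Qa Pb Qb !(mul0r, mulr0, addr0) subrr => I0.
rewrite -IntD; [|exact: proj2 h1|exact: proj2 h2].
rewrite -[RHS]addr0 -I0 -IntD; [|by apply: L1D; [case: h1|case: h2]|exact: L2_L1 (ac_L2 hphi)].
by apply: Int_ext => t _; rewrite /energy; ring.
Qed.

(** A strictly subcritical interval carries a Riccati solution, and then the
   Picone identity writes the integral as a sum of squares. *)
Lemma dirichlet_lt lam : P a = 0 -> Q a = 0 -> P b = 0 -> Q b = 0 ->
  `|lam| * (b - a) < pi -> 0 <= Int a b (energy varpi (lam ^+ 2) P Q p q).
Proof.
move=> Pa Qa Pb Qb lT; have [w [W [hw _ _]]] := riccati ab lT.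
rewrite (picone Pa Qa Pb Qb hw) addr_ge0//; apply: Int_ge0 => t _; exact: sqr_ge0.
Qed.

(** The borderline frequency follows from the smaller ones by continuity. *)
Lemma dirichlet_le lam : P a = 0 -> Q a = 0 -> P b = 0 -> Q b = 0 ->
  `|lam| * (b - a) <= pi -> 0 <= Int a b (energy varpi (lam ^+ 2) P Q p q).
Proof.
move=> Pa Qa Pb Qb lT; rewrite (Int_energyB _ 0) sub0r mulNr subr_ge0.
set M := Int _ _ (fun _ => _); set E := Int _ _ _.
have E0 : 0 <= E by exact: Int_energy0_ge0.
have M0 : 0 <= M by apply: Int_ge0 => t _; rewrite addr_ge0 ?sqr_ge0.
have H x : 0 <= x -> x < 1 -> (x * lam) ^+ 2 * M <= E.
  move=> x0 x1; rewrite -subr_ge0 -mulNr -sub0r -Int_energyB.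
  apply: dirichlet_lt => //; rewrite normrM (ger0_norm x0).
  have := pi_gt0 R; have : 0 <= `|lam| * (b - a) by rewrite mulr_ge0 ?subr_ge0.
  rewrite -mulrA; move: (`|lam| * (b - a)) lT => y; nra.
rewrite leNgt; apply/negP => EM.
have LM : 0 < lam ^+ 2 * M := le_lt_trans E0 EM.
pose x := E / (lam ^+ 2 * M).
have x0 : 0 <= x by rewrite divr_ge0// ltW.
have x1 : x < 1 by rewrite ltr_pdivrMr// mul1r.
have Ex : E = x * (lam ^+ 2 * M) by rewrite /x divfK// gt_eqF.
have := H ((1 + x) / 2); rewrite exprMn -mulrA Ex ler_pM2r//.
have -> : (((1 + x) / 2) ^+ 2 <= x) = false.
  by apply/negbTE; rewrite -ltNge; have : 0 < (1 - x) ^+ 2 by [rewrite exprn_gt0// subr_gt0]; nra.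
by move=> h; have : false by apply: h; lra.
Qed.

(** Equality makes both squares of the Picone identity vanish, so that [W |f|^2]
   has derivative zero, [W] being the weight attached to the Riccati solution. *)
Lemma dirichlet_eq0 lam : P a = 0 -> Q a = 0 -> P b = 0 -> Q b = 0 ->
  `|lam| * (b - a) < pi -> Int a b (energy varpi (lam ^+ 2) P Q p q) = 0 ->
  forall t, t \in `[a, b] -> P t = 0 /\ Q t = 0.
Proof.
move=> Pa Qa Pb Qb lT; have [w [W [hw hW W0]]] := riccati ab lT.
rewrite (picone Pa Qa Pb Qb hw) => I0.
pose s1 t := p t - varpi * Q t - w t * P t.
pose s2 t := q t + varpi * P t - w t * Q t.
have cw := ac_cont ab hw; have cW := ac_cont ab hW.
have [hD1 hD2] := L2_twist.
have h1 : L2 a b s1.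
  apply: (@L2_ext _ _ _ (fun t => (p t - varpi * Q t) + (-1 * w t) * P t)) => [t _|].
    by rewrite /s1; ring.
  by apply: L2D => //; apply: L2Mcont; [apply: contM => //; exact: cont_cst|exact: cont_L2].
have h2 : L2 a b s2.
  apply: (@L2_ext _ _ _ (fun t => (q t + varpi * P t) + (-1 * w t) * Q t)) => [t _|].
    by rewrite /s2; ring.
  by apply: L2D => //; apply: L2Mcont; [apply: contM => //; exact: cont_cst|exact: cont_L2].
have p1 : 0 <= Int a b (fun t => s1 t ^+ 2) by apply: Int_ge0 => t _; exact: sqr_ge0.
have p2 : 0 <= Int a b (fun t => s2 t ^+ 2) by apply: Int_ge0 => t _; exact: sqr_ge0.
have I1 : Int a b (fun t => s1 t ^+ 2) = 0 by move: I0 p1 p2; rewrite /s1 /s2; lra.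
have I2 : Int a b (fun t => s2 t ^+ 2) = 0 by move: I0 p1 p2; rewrite /s1 /s2; lra.
move=> c cab; have := cab; rewrite in_itv /= => /andP[lac lcb].
have restrict s : L2 a b s -> Int a b (fun t => s t ^+ 2) = 0 ->
    Int a c (fun t => s t ^+ 2) = 0.
  move=> hs; rewrite (@Int_cat _ a c b)//; last by case: hs.
  have : 0 <= Int a c (fun t => s t ^+ 2) by apply: Int_ge0 => t _; exact: sqr_ge0.
  have : 0 <= Int c b (fun t => s t ^+ 2) by apply: Int_ge0 => t _; exact: sqr_ge0.
  lra.
have hn := ac_sub (lexx a) lcb (acM hW (acD (acM hP hP) (acM hQ hQ))).
have Lac f : L2 a b f -> L2 a c f by exact: L2_sub.
have Cac f : cont a b f -> cont a c f by exact: cont_sub.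
have J1 := Int_sqr_eq0M (cont_L2 (Cac _ (contM cW cP))) (Lac _ h1) (restrict _ h1 I1).
have J2 := Int_sqr_eq0M (cont_L2 (Cac _ (contM cW cQ))) (Lac _ h2) (restrict _ h2 I2).
have := Int_ac lac hn; rewrite Pa Qa !(mul0r, mulr0, addr0) subr0.
rewrite (@Int_ext _ _ _ _ (fun t => 2 * (W t * P t * s1 t) + 2 * (W t * Q t * s2 t))); last first.
  by move=> t _; rewrite /s1 /s2; ring.
have La := L2_L1M (cont_L2 (Cac _ (contM cW cP))) (Lac _ h1).
have Lb := L2_L1M (cont_L2 (Cac _ (contM cW cQ))) (Lac _ h2).
rewrite IntD ?IntZ//; try exact: L1Z.
rewrite J1 J2 !mulr0 addr0 => /esym/eqP.
rewrite mulf_eq0 gt_eqF ?W0//= -!expr2 paddr_eq0 ?sqr_ge0// !sqrf_eq0.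
by move=> /andP[/eqP-> /eqP->].
Qed.
End Quadratic.

(** Wirtinger inequality for functions with [f(b) = e^(i nu (b - a)) f(a)], read
   in a frame rotating with frequency [varpi]: [lam = nu + varpi] is a frequency
   of [f] in the fixed frame.  Subtracting the pure mode [f(a) e^(i nu (t - a))],
   which is orthogonal to the remainder for the quadratic action, leaves a
   function that vanishes at both ends. *)
Section QuasiPeriodic.
Variables (a b varpi lam : R) (P Q p q : R -> R).
Hypotheses (ab : a <= b) (hP : ac a b P p) (hQ : ac a b Q q).
Let nu := lam - varpi.
Hypothesis phaseP : P b = P a * cos (nu * (b - a)) - Q a * sin (nu * (b - a)).
Hypothesis phaseQ : Q b = P a * sin (nu * (b - a)) + Q a * cos (nu * (b - a)).

Let C t := cos (nu * t + - nu * a).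
Let S t := sin (nu * t + - nu * a).
Let P0 t := P a * C t + - Q a * S t.
Let Q0 t := P a * S t + Q a * C t.
Let G1 t := P t - P0 t.
Let G2 t := Q t - Q0 t.
Let g1 t := p t - (P a * (- nu * S t) + - Q a * (nu * C t)).
Let g2 t := q t - (P a * (nu * C t) + Q a * (- nu * S t)).

Let hP0 : ac a b P0 (fun t => P a * (- nu * S t) + - Q a * (nu * C t)).
Proof. by apply: acD; apply: acZ; [exact: ac_cos|exact: ac_sin]. Qed.
Let hQ0 : ac a b Q0 (fun t => P a * (nu * C t) + Q a * (- nu * S t)).
Proof. by apply: acD; apply: acZ; [exact: ac_sin|exact: ac_cos]. Qed.
Let hG1 : ac a b G1 g1. Proof. exact: acB. Qed.
Let hG2 : ac a b G2 g2. Proof. exact: acB. Qed.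

Let G1a : G1 a = 0.
Proof. by rewrite /G1 /P0 /C /S mulNr subrr cos0 sin0; ring. Qed.
Let G2a : G2 a = 0.
Proof. by rewrite /G2 /Q0 /C /S mulNr subrr cos0 sin0; ring. Qed.
Let Eb : nu * b + - nu * a = nu * (b - a). Proof. by ring. Qed.
Let G1b : G1 b = 0.
Proof. by rewrite /G1 /P0 /C /S Eb phaseP; ring. Qed.
Let G2b : G2 b = 0.
Proof. by rewrite /G2 /Q0 /C /S Eb phaseQ; ring. Qed.

(** The cross term between the pure mode and the remainder is the derivative of
   [2 lam (P0 G2 - Q0 G1)], which vanishes at both ends. *)
Lemma energy_split : Int a b (energy varpi (lam ^+ 2) P Q p q) =
  Int a b (energy varpi (lam ^+ 2) G1 G2 g1 g2).
Proof.
have hx := acZ (2 * lam) (acB (acM hP0 hG2) (acM hQ0 hG1)).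
have := Int_ac ab hx; rewrite G1a G2a G1b G2b !(mulr0, subr0) => I0.
rewrite -[RHS]addr0 -I0 -IntD; [|exact: (L1_energy _ ab hG1 hG2)|exact: L2_L1 (ac_L2 hx)].
apply: Int_ext => t _; rewrite /energy /g1 /g2 /G1 /G2 /P0 /Q0.
have -> : lam = nu + varpi by rewrite /nu subrK.
by ring.
Qed.

Lemma wirtinger : `|lam| * (b - a) <= pi ->
  0 <= Int a b (energy varpi (lam ^+ 2) P Q p q).
Proof. by move=> lT; rewrite energy_split; exact: (dirichlet_le _ ab hG1 hG2). Qed.

Lemma wirtinger_eq0 : `|lam| * (b - a) < pi ->
  Int a b (energy varpi (lam ^+ 2) P Q p q) = 0 ->
  forall t, t \in `[a, b] ->
    P t = P a * cos (nu * (t - a)) - Q a * sin (nu * (t - a)) /\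
    Q t = P a * sin (nu * (t - a)) + Q a * cos (nu * (t - a)).
Proof.
move=> lT; rewrite energy_split => I0 t tab.
have Et : nu * t + - nu * a = nu * (t - a) by ring.
have [] := dirichlet_eq0 ab hG1 hG2 G1a G2a G1b G2b lT I0 tab.
rewrite /G1 /G2 /P0 /Q0 /C /S Et => /subr0_eq -> /subr0_eq ->; split=> //; ring.
Qed.
End QuasiPeriodic.
End Wirtinger.

(** * Complex numbers and the circle *)

Section ComplexNumbers.
Variable R : realType.
Implicit Types (x y : R) (z w : R[i]).
Local Notation Re := (@complex.Re R).
Local Notation Im := (@complex.Im R).

Lemma complex_eq z w : Re z = Re w -> Im z = Im w -> z = w.
Proof. by case: z w => a b [c d] /= -> ->. Qed.

Lemma Re_add z w : Re (z + w) = Re z + Re w. Proof. by case: z w => a b []. Qed.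
Lemma Im_add z w : Im (z + w) = Im z + Im w. Proof. by case: z w => a b []. Qed.
Lemma Re_opp z : Re (- z) = - Re z. Proof. by case: z. Qed.
Lemma Im_opp z : Im (- z) = - Im z. Proof. by case: z. Qed.
Lemma Re_mul z w : Re (z * w) = Re z * Re w - Im z * Im w.
Proof. by case: z w => a b []. Qed.
Lemma Im_mul z w : Im (z * w) = Re z * Im w + Im z * Re w.
Proof. by case: z w => a b []. Qed.
Lemma Re_real x : Re x%:C%C = x. Proof. by []. Qed.
Lemma Im_real x : Im x%:C%C = 0. Proof. by []. Qed.
Lemma Re_conj z : Re z^*%C = Re z. Proof. by case: z. Qed.
Lemma Im_conj z : Im z^*%C = - Im z. Proof. by case: z. Qed.
Lemma Re_one : Re 1 = 1. Proof. by []. Qed.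
Lemma Im_one : Im 1 = 0. Proof. by []. Qed.
Lemma Re_zero : Re 0 = 0. Proof. by []. Qed.
Lemma Im_zero : Im 0 = 0. Proof. by []. Qed.
Lemma Re_expi x : Re (expi x) = cos x. Proof. by []. Qed.
Lemma Im_expi x : Im (expi x) = sin x. Proof. by []. Qed.
Lemma Re_pair x y : Re (x +i* y)%C = x. Proof. by []. Qed.
Lemma Im_pair x y : Im (x +i* y)%C = y. Proof. by []. Qed.
Definition ReImE := (Re_pair, Im_pair, Re_add, Im_add, Re_opp, Im_opp,
  Re_mul, Im_mul, Re_real, Im_real, Re_conj, Im_conj,
  Re_one, Im_one, Re_zero, Im_zero, Re_expi, Im_expi).

Lemma Re_sum (I : Type) (r : seq I) (P : pred I) (F : I -> R[i]) :
  Re (\sum_(i <- r | P i) F i) = \sum_(i <- r | P i) Re (F i).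
Proof. by apply: (big_morph Re) => // z w; rewrite Re_add. Qed.

Lemma Im_sum (I : Type) (r : seq I) (P : pred I) (F : I -> R[i]) :
  Im (\sum_(i <- r | P i) F i) = \sum_(i <- r | P i) Im (F i).
Proof. by apply: (big_morph Im) => // z w; rewrite Im_add. Qed.

Lemma conjcM z w : (z * w)^*%C = z^*%C * w^*%C.
Proof. by apply: complex_eq; rewrite !ReImE; ring. Qed.

Lemma conjcD z w : (z + w)^*%C = z^*%C + w^*%C.
Proof. by apply: complex_eq; rewrite !ReImE; ring. Qed.

Lemma conjc_sum (I : Type) (r : seq I) (P : pred I) (F : I -> R[i]) :
  (\sum_(i <- r | P i) F i)^*%C = \sum_(i <- r | P i) (F i)^*%C.
Proof.
apply: (big_morph (fun z : R[i] => z^*%C)) => [z w|]; first exact: conjcD.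
by apply: complex_eq; rewrite /= ?oppr0.
Qed.

Lemma Re_div_real z x : Re (z / x%:C%C) = Re z / x.
Proof.
have -> : (x%:C%C)^-1 = (x^-1)%:C%C by rewrite (fmorphV (real_complex R)).
by rewrite !ReImE mulr0 subr0.
Qed.

Definition nsq z : R := Re z ^+ 2 + Im z ^+ 2.

Lemma nsq_ge0 z : 0 <= nsq z. Proof. by rewrite addr_ge0 ?sqr_ge0. Qed.
Lemma nsqM z w : nsq (z * w) = nsq z * nsq w.
Proof. by rewrite /nsq !ReImE; ring. Qed.
Lemma nsqE z : (nsq z)%:C%C = z * z^*%C.
Proof. by apply: complex_eq; rewrite /nsq !ReImE; ring. Qed.
Lemma nsq_eq0 z : nsq z = 0 -> z = 0.
Proof.
move/eqP; rewrite paddr_eq0 ?sqr_ge0// !sqrf_eq0 => /andP[/eqP h1 /eqP h2].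
exact: complex_eq.
Qed.
Lemma nsq0 : nsq 0 = 0.
Proof. by rewrite /nsq Re_zero Im_zero expr0n addr0. Qed.
Lemma nsq_conj z : nsq z^*%C = nsq z.
Proof. by rewrite /nsq !ReImE sqrrN. Qed.
Lemma nsqC x : nsq x%:C%C = x ^+ 2.
Proof. by rewrite /nsq !ReImE expr0n addr0. Qed.

Local Notation expi := (@expi R).

Lemma expi0 : expi 0 = 1.
Proof. by apply: complex_eq; rewrite /= ?cos0 ?sin0. Qed.
Lemma expiD x y : expi (x + y) = expi x * expi y.
Proof. by apply: complex_eq; rewrite !ReImE /= ?cosD ?sinD//; ring. Qed.
Lemma expi_conj x : (expi x)^*%C = expi (- x).
Proof. by apply: complex_eq; rewrite !ReImE /= ?cosN ?sinN. Qed.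
Lemma nsq_expi x : nsq (expi x) = 1. Proof. exact: cos2Dsin2. Qed.
Lemma expiN x : expi (- x) * expi x = 1.
Proof. by rewrite -expiD addNr expi0. Qed.
Lemma expi_neq0 x : expi x != 0.
Proof.
by apply/eqP => h; have := nsq_expi x; rewrite h /nsq /= expr0n addr0 => /eqP; rewrite eq_sym oner_eq0.
Qed.
Lemma expi_pi : expi pi = -1.
Proof. by apply: complex_eq; rewrite !ReImE /= ?cospi ?sinpi ?oppr0. Qed.

Lemma expiMn x n : expi (x *+ n) = expi x ^+ n.
Proof. by elim: n => [|n IH]; rewrite ?mulr0n ?expi0// mulrS expiD IH exprS. Qed.

Lemma expi2pi (m : int) : expi (2 * pi * m%:~R) = 1.
Proof.
have H n : expi (2 * pi * n%:R) = 1.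
  rewrite mulr_natr expiMn (_ : expi (2 * pi) = 1) ?expr1n//.
  by rewrite mulr_natl mulr2n expiD expi_pi mulrNN mulr1.
case: (intP m) => [|n|n]; first exact: H 0%N.
  exact: H n.+1.
by have := expiN (2 * pi * n.+1%:R); rewrite H mulr1 rmorphN mulrN.
Qed.

Lemma expi_2piD x (m : int) : expi (x + 2 * pi * m%:~R) = expi x.
Proof. by rewrite expiD expi2pi mulr1. Qed.

End ComplexNumbers.

(** * The Wirtinger inequality for quasi-periodic complex functions *)

Section Periodic.
Variable R : realType.
Local Notation Re := (@complex.Re R).
Local Notation Im := (@complex.Im R).
Implicit Types (F G : R -> R[i]).

Definition acC (a b : R) F G :=
  ac a b (Re \o F) (Re \o G) /\ ac a b (Im \o F) (Im \o G).

Definition energyC (varpi kappa : R) F G :=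
  energy varpi kappa (Re \o F) (Im \o F) (Re \o G) (Im \o G).

Lemma energyCE varpi kappa F G t : energyC varpi kappa F G t =
  nsq (G t + (0 +i* varpi)%C * F t) - kappa * nsq (F t).
Proof. by rewrite /energyC /energy /nsq /comp !ReImE; ring. Qed.

Lemma acC_sub a b a' b' F G : a <= a' -> b' <= b -> acC a b F G -> acC a' b' F G.
Proof. by move=> aa bb [h1 h2]; split; [exact: ac_sub h1|exact: ac_sub h2]. Qed.

Lemma acCZ a b (z : R[i]) F G : acC a b F G ->
  acC a b (fun t => z * F t) (fun t => z * G t).
Proof.
move=> [h1 h2]; split.
  by apply: ac_ext (acB (acZ (Re z) h1) (acZ (Im z) h2)) => t _; rewrite /= Re_mul.
by apply: ac_ext (acD (acZ (Re z) h2) (acZ (Im z) h1)) => t _; rewrite /= Im_mul.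
Qed.

Lemma acC_sum (I : Type) (r : seq I) (P : pred I) a b (F G : I -> R -> R[i]) :
  (forall i, P i -> acC a b (F i) (G i)) ->
  acC a b (fun t => \sum_(i <- r | P i) F i t) (fun t => \sum_(i <- r | P i) G i t).
Proof.
move=> h; split.
  have := @ac_sum R _ r P a b _ _ (fun i Pi => proj1 (h i Pi)).
  by apply: ac_ext => t _ /=; rewrite Re_sum.
have := @ac_sum R _ r P a b _ _ (fun i Pi => proj2 (h i Pi)).
by apply: ac_ext => t _ /=; rewrite Im_sum.
Qed.

Lemma acC_energy a b varpi kappa F G : a <= b -> acC a b F G ->
  L1 a b (energyC varpi kappa F G).
Proof. by move=> ab [h1 h2]; apply: L1_energy. Qed.

Lemma acC_nsq_cont a b F G : a <= b -> acC a b F G -> cont a b (fun t => nsq (F t)).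
Proof.
move=> ab [h1 h2]; have c1 := ac_cont ab h1; have c2 := ac_cont ab h2.
exact: contD (contM c1 c1) (contM c2 c2).
Qed.

Lemma shiftZ (F : R -> R[i]) (T nu : R) :
  (forall t, F (t + T) = expi (nu * T) * F t) ->
  forall (m : int) t, F (t + m%:~R * T) = expi (nu * (m%:~R * T)) * F t.
Proof.
move=> HF; have H n t : F (t + n%:R * T) = expi (nu * (n%:R * T)) * F t.
  elim: n t => [|n IH] t; first by rewrite mul0r mulr0 addr0 expi0 mul1r.
  have -> : t + n.+1%:R * T = (t + n%:R * T) + T by rewrite -natr1; ring.
  rewrite HF IH mulrA -expiD; congr (expi _ * _).
  by rewrite -natr1; ring.
move=> m t; case: (intP m) => [|n|n]; [exact: (H 0%N t)|exact: (H n.+1 t)|].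
rewrite rmorphN /= mulNr mulrN.
have := H n.+1 (t - n.+1%:R * T); rewrite subrK => ->.
by rewrite mulrA expiN mul1r.
Qed.

Section OneMode.
Variables (F G : R -> R[i]) (T varpi lam : R) (n : nat).
Let nu := lam - varpi.
Hypotheses (T0 : 0 < T) (hF : acC 0 (n%:R * T) F G).
Hypothesis shift : forall t, F (t + T) = expi (nu * T) * F t.

Let piece m : (m < n)%N -> acC (m%:R * T) (m.+1%:R * T) F G.
Proof.
move=> mn; apply: acC_sub hF; first by rewrite mulr_ge0// ltW.
by rewrite ler_pM2r// ler_nat.
Qed.

Let len m : m.+1%:R * T - m%:R * T = T.
Proof. by rewrite -natr1; ring. Qed.

Let phase m : F (m.+1%:R * T) = expi (nu * (m.+1%:R * T - m%:R * T)) * F (m%:R * T).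
Proof. by rewrite len -shift -natr1 mulrDl mul1r. Qed.

Let le_piece m : m%:R * T <= m.+1%:R * T.
Proof. by rewrite ler_pM2r// ler_nat. Qed.

Let phaseRe m := etrans (congr1 Re (phase m)) (Re_mul _ _).
Let phaseIm m := etrans (congr1 Im (phase m)) (Im_mul _ _).

Let piece_ge0 m : (m < n)%N -> `|lam| * T <= pi ->
  0 <= Int (m%:R * T) (m.+1%:R * T) (energyC varpi (lam ^+ 2) F G).
Proof.
move=> mn lT; have [h1 h2] := piece mn.
apply: (wirtinger (le_piece m) h1 h2); last by rewrite len.
  by rewrite /= phaseRe /=; ring.
by rewrite /= phaseIm /=; ring.
Qed.

(* the quasi-period cuts the interval into pieces of length T *)
Let prefix_ge0 m : (m <= n)%N -> `|lam| * T <= pi ->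
  0 <= Int 0 (m%:R * T) (energyC varpi (lam ^+ 2) F G).
Proof.
move=> + lT; elim: m => [|m IH] mn; first by rewrite mul0r Int_aa.
rewrite (@Int_cat _ 0 (m%:R * T) (m.+1%:R * T))//; first last.
- apply: acC_energy; first by rewrite mulr_ge0// ltW.
  by apply: acC_sub hF => //; rewrite ler_pM2r// ler_nat.
- by rewrite mulr_ge0// ltW.
by rewrite addr_ge0 ?IH ?piece_ge0// ltnW.
Qed.

Lemma periodic_wirtinger : `|lam| * T <= pi ->
  0 <= Int 0 (n%:R * T) (energyC varpi (lam ^+ 2) F G).
Proof. exact: prefix_ge0. Qed.

(** In the subcritical case equality forces a pure mode: on the first period by
   the equality case over an interval, then everywhere by translation. *)
Lemma periodic_wirtinger_eq0 : (0 < n)%N -> `|lam| * T < pi ->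
  Int 0 (n%:R * T) (energyC varpi (lam ^+ 2) F G) = 0 ->
  forall t, F t = expi (nu * t) * F 0.
Proof.
move=> n0 lT I0 t.
have I1 : Int 0 T (energyC varpi (lam ^+ 2) F G) = 0.
  have LE : L1 0 (n%:R * T) (energyC varpi (lam ^+ 2) F G).
    by apply: acC_energy => //; rewrite mulr_ge0// ltW.
  have Tn : T <= n%:R * T by rewrite ler_peMl ?ler1n// ltW.
  have : 0 <= Int 0 T (energyC varpi (lam ^+ 2) F G).
    by have := piece_ge0 n0 (ltW lT); rewrite mul0r mul1r.
  have : 0 <= Int T (n%:R * T) (energyC varpi (lam ^+ 2) F G).
    have H m : (m < n)%N -> 0 <= Int T (m.+1%:R * T) (energyC varpi (lam ^+ 2) F G).
      elim: m => [|m IH] mn; first by rewrite mul1r Int_aa.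
      rewrite (@Int_cat _ T (m.+1%:R * T) (m.+2%:R * T))//.
      - by apply: addr_ge0; [exact: IH (ltnW mn)|exact: piece_ge0 mn (ltW lT)].
      - by rewrite ler_peMl ?ler1n// ltW.
      - by apply: L1_sub LE; [exact: ltW|rewrite ler_pM2r// ler_nat].
    by have := H n.-1; rewrite prednK//; apply.
  by move: I0; rewrite (Int_cat (ltW T0) Tn LE); lra.
have base u : 0 <= u -> u <= T -> F u = expi (nu * u) * F 0.
  move=> u0 uT; have := piece n0; rewrite mul0r mul1r => -[h1 h2].
  have hr : F T = expi (nu * (T - 0)) * F 0 by rewrite -[in LHS](add0r T) shift subr0.
  have pRe : (Re \o F) T = (Re \o F) 0 * cos (nu * (T - 0)) - (Im \o F) 0 * sin (nu * (T - 0)).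
    by rewrite /= hr Re_mul /=; ring.
  have pIm : (Im \o F) T = (Re \o F) 0 * sin (nu * (T - 0)) + (Im \o F) 0 * cos (nu * (T - 0)).
    by rewrite /= hr Im_mul /=; ring.
  have lT' : `|lam| * (T - 0) < pi by rewrite subr0.
  have uI : u \in `[0, T] by rewrite in_itv /= u0 uT.
  have [/= e1 e2] := wirtinger_eq0 (ltW T0) h1 h2 pRe pIm lT' I1 uI.
  by apply: complex_eq; rewrite ?Re_mul ?Im_mul ?e1 ?e2 subr0 /=; ring.
pose m := Num.floor (t / T).
have /andP[m1 m2] : m%:~R <= t / T < (m + 1)%:~R by exact: floor_itv.
have tE : t = (t - m%:~R * T) + m%:~R * T by rewrite subrK.
rewrite [in LHS]tE (shiftZ shift) base.
- rewrite mulrA -expiD; congr (expi _ * _); ring.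
- by rewrite subr_ge0 -ler_pdivlMr.
- move: m2; rewrite ltr_pdivrMr// rmorphD /= mulrDl mul1r => m2.
  by rewrite lerBlDl ltW.
Qed.

End OneMode.

End Periodic.

(** * Phase rules and their harmonics *)

Section QuasiPeriod.
Variable R : realType.

(** Let [m] be the floor of [x] and y = pi (x - m): then cos (2 y) = 1, which is
   impossible for [y] strictly between 0 and pi. *)
Lemma expi_eq1 (x : R) : expi (2 * pi * x) = 1 -> exists m : int, x = m%:~R.
Proof.
move=> h; exists (Num.floor x); set m := Num.floor x.
have /andP[m1 m2] : m%:~R <= x < (m + 1)%:~R by exact: floor_itv.
move: m2; rewrite rmorphD /= => m2.
case: (ltgtP m%:~R x) m1 => // mx _.
have := expi_2piD (2 * pi * x) (- m); rewrite h rmorphN /=.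
have -> : 2 * pi * x + 2 * pi * - m%:~R = pi * (x - m%:~R) + pi * (x - m%:~R) by ring.
set y := pi * _ => /(congr1 (@complex.Re R)); rewrite !ReImE cosD.
have s0 : 0 < sin y.
  by apply: sin_gt0_pi; rewrite /y; have := pi_gt0 R => p0; apply/andP; split; nra.
have := cos2Dsin2 y; nra.
Qed.

(** The harmonics [q] compatible with the phase rules of a function [f]: the
   function may contain [e^(i (mu + 2 pi q) t)] exactly for these [q]. *)
Definition admissible (N : nat) (k l e q : int) : Prop :=
  (exists m, q = e + 2 * m) /\ (exists m, q * k = l + N%:Z * m).

Definition phase_rule (N : nat) (k l e : int) (mu : R) (f : R -> R[i]) : Prop :=
  forall (b d : int) (t : R), let th := b%:~R / 2 + k%:~R * (d%:~R / N%:R) in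
  f (t + th) = expi (mu * th + 2 * pi * (l%:~R * d%:~R / N%:R) + pi * (e%:~R * b%:~R)) * f t.

Definition qgcd (N : nat) (k : int) : nat := `|gcdz N%:Z (2 * k)|%N.

(** The translations th of a phase rule generate the group of multiples of
   this number. *)
Definition qperiod (N : nat) (k : int) : R := (qgcd N k)%:R / (2 * N%:R).

Section Fixed.
Variables (N : nat) (k l e : int) (mu : R) (f : R -> R[i]).
Hypothesis N0 : (0 < N)%N.
Local Notation g := (qgcd N k).

Let NR : N%:R != 0 :> R. Proof. by rewrite pnatr_eq0 -lt0n. Qed.

Lemma qgcdE : g%:Z = gcdz N%:Z (2 * k).
Proof. by rewrite /qgcd gez0_abs. Qed.

Lemma qgcd_gt0 : (0 < g)%N.
Proof. by rewrite /qgcd absz_gt0 gcdz_eq0 negb_and eqz_nat -lt0n N0. Qed.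

Lemma qperiod_gt0 : 0 < qperiod N k.
Proof. by rewrite divr_gt0 ?mulr_gt0 ?ltr0n ?qgcd_gt0. Qed.

Lemma qgcd_dvdN : exists M : nat, (N = M * g)%N.
Proof.
have /dvdnP[M hM] : (g %| N)%N by have := dvdz_gcdl N%:Z (2 * k); rewrite -qgcdE.
by exists M.
Qed.

Lemma qgcd_dvdk : exists c : int, 2 * k = c * g%:Z.
Proof. by have /dvdzP := dvdz_gcdr N%:Z (2 * k); rewrite -qgcdE. Qed.

Let bezout : exists u v : int, u * N%:Z + v * (2 * k) = g%:Z.
Proof. by have [u [v h]] := Bezoutz N%:Z (2 * k); exists u, v; rewrite qgcdE. Qed.

Lemma admissibleD q (n : int) (M : nat) : (N = M * g)%N ->
  admissible N k l e q -> admissible N k l e (q + 2 * M%:Z * n).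
Proof.
move=> hM [[m1 h1] [m2 h2]]; have [c hc] := qgcd_dvdk; split.
  by exists (m1 + M%:Z * n); rewrite h1; ring.
have NE : N%:Z = M%:Z * g%:Z by rewrite -PoszM -hM.
exists (m2 + c * n); rewrite mulrDl h2.
have -> : 2 * M%:Z * n * k = M%:Z * n * (2 * k) by ring.
have -> : M%:Z * n * (2 * k) = M%:Z * g%:Z * (c * n) by rewrite hc; ring.
by rewrite -NE; ring.
Qed.

Hypothesis rule : phase_rule N k l e mu f.

Lemma quasi_period_admissible q : admissible N k l e q -> forall t,
  f (t + qperiod N k) = expi ((mu + 2 * pi * q%:~R) * qperiod N k) * f t.
Proof.
move=> [[m1 h1] [m2 h2]] t; have [u [v huv]] := bezout.
have gR : g%:R = u%:~R * N%:R + v%:~R * (2 * k%:~R) :> R.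
  have := congr1 (fun z : int => z%:~R : R) huv.
  by rewrite /= rmorphD !rmorphM /= => /esym.
have thE : u%:~R / 2 + k%:~R * (v%:~R / N%:R) = qperiod N k.
  by rewrite /qperiod gR; field.
have := rule u v t; rewrite /= thE => ->; congr (_ * _).
have qk : q%:~R * k%:~R = l%:~R + N%:R * m2%:~R :> R.
  by have := congr1 (fun z : int => z%:~R : R) h2; rewrite /= rmorphD !rmorphM.
have qe : q%:~R = e%:~R + 2 * m1%:~R :> R.
  by have := congr1 (fun z : int => z%:~R : R) h1; rewrite /= rmorphD !rmorphM.
rewrite -[LHS](expi_2piD _ (m1 * u + m2 * v)); congr expi.
rewrite rmorphD !rmorphM /= [(mu + _) * _]mulrDl -!addrA; congr (_ + _).
rewrite -thE.
have -> : 2 * pi * q%:~R * (u%:~R / 2 + k%:~R * (v%:~R / N%:R))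
   = pi * q%:~R * u%:~R + 2 * pi * (q%:~R * k%:~R) * v%:~R / N%:R :> R by field.
by rewrite qk qe; field.
Qed.

(** The relation [th = 0] for a suitable pair [(b, d)] forces the phase to be
   trivial, which is the divisibility making the harmonics nonempty. *)
Lemma zero_or_admissible : (forall t, f t = 0) \/ exists q, admissible N k l e q.
Proof.
case: (pselect (forall t, f t = 0)) => [|/existsNP[t0 /eqP ft0]]; [by left|right].
have [u [v huv]] := bezout; have [M hM] := qgcd_dvdN; have [c hc] := qgcd_dvdk.
have gn0 : g%:R != 0 :> R by rewrite pnatr_eq0 -lt0n qgcd_gt0.
have NE : N%:R = M%:R * g%:R :> R by rewrite -natrM -hM.
have kE : 2 * k%:~R = c%:~R * g%:R :> R.
  by have := congr1 (fun z : int => z%:~R : R) hc; rewrite /= !rmorphM.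
have MR : M%:R != 0 :> R by move: NR; rewrite NE mulf_eq0 negb_or => /andP[].
have kE2 : k%:~R = c%:~R * g%:R / 2 :> R by rewrite -kE; field.
have := rule (- c) M t0; rewrite /=.
have -> : (- c)%:~R / 2 + k%:~R * (M%:~R / N%:R) = 0 :> R.
  by rewrite rmorphN /= kE2 NE; field; rewrite MR gn0.
rewrite addr0 mulr0 add0r => /esym/eqP; rewrite -subr_eq0 -{2}(mul1r (f t0)) -mulrBl.
rewrite mulf_eq0 (negbTE ft0) orbF subr_eq0 => /eqP.
have -> : 2 * pi * (l%:~R * M%:~R / N%:R) + pi * (e%:~R * (- c)%:~R)
   = 2 * pi * ((l - e * k)%:~R / g%:R) :> R.
  rewrite rmorphB rmorphM rmorphN /= kE2 NE; field.
  by rewrite MR gn0.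
move=> /expi_eq1[w /(canRL (divfK gn0)) hw].
have {}hw : l - e * k = w * g%:Z.
  by apply: (intr_inj (R := R)); rewrite hw rmorphM.
exists (e + 2 * (v * w)); split; first by exists (v * w).
exists (- (u * w)).
have -> : (e + 2 * (v * w)) * k = e * k + w * (v * (2 * k)) by ring.
have -> : v * (2 * k) = g%:Z - u * N%:Z by rewrite -huv; ring.
have -> : e * k = l - w * g%:Z by rewrite -hw; ring.
ring.
Qed.

(** The admissible harmonics contain a progression of step 2 N / g, where g is
   [qgcd N k]: the frequencies then have step 2 pi / qperiod, and one of them is
   within pi / qperiod of zero, as the Wirtinger inequality requires. *)
Lemma small_admissible (X : R) q : admissible N k l e q ->
  exists2 q', admissible N k l e q' & `|X + 2 * pi * q'%:~R| * qperiod N k <= pi.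
Proof.
move=> hq; have [M hM] := qgcd_dvdN.
pose y := (X + 2 * pi * q%:~R) * qperiod N k.
pose n := Num.floor (y / (2 * pi) + 2^-1).
exists (q + 2 * M%:Z * (- n)); first exact: admissibleD.
have p0 := pi_gt0 R; have pn : pi != 0 :> R by rewrite gt_eqF.
have /andP[n1 n2] : n%:~R <= y / (2 * pi) + 2^-1 < (n + 1)%:~R by exact: floor_itv.
have gn0 : g%:R != 0 :> R by rewrite pnatr_eq0 -lt0n qgcd_gt0.
have NE : N%:R = M%:R * g%:R :> R by rewrite -natrM -hM.
have MR : M%:R != 0 :> R by move: NR; rewrite NE mulf_eq0 negb_or => /andP[].
rewrite -[X in _ * X <= _](gtr0_norm qperiod_gt0) -normrM.
have -> : (X + 2 * pi * (q + 2 * M%:Z * - n)%:~R) * qperiod N k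
    = y - 2 * pi * n%:~R.
  rewrite /y rmorphD !rmorphM rmorphN /= /qperiod NE; field.
  by rewrite MR gn0.
set z := y / (2 * pi) in n1 n2 *.
have -> : y = 2 * pi * z by rewrite /z mulrC divfK// mulf_neq0// pnatr_eq0.
move: n2; rewrite rmorphD /= => n2.
have h1 : 0 <= pi * (z - n%:~R + 2^-1) by rewrite mulr_ge0 ?(ltW p0)//; lra.
have h2 : 0 <= pi * (2^-1 - (z - n%:~R)) by rewrite mulr_ge0 ?(ltW p0)//; lra.
by rewrite ler_norml; apply/andP; split; lra.
Qed.
End Fixed.
End QuasiPeriod.

(** * Fourier analysis over the labels *)

Section RootsOfUnity.
Variables (R : realType) (N : nat).
Hypothesis hN : (1 < N)%N.
Local Notation Re := (@complex.Re R).

(** The [m]-th power of [zeta], written with its argument so that it combines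
   with the phases depending on time. *)
Definition rt (m : int) : R[i] := expi (2 * pi * (m%:~R / N%:R)).

Let NR : N%:R != 0 :> R. Proof. by rewrite pnatr_eq0 -lt0n ltnW. Qed.

Lemma rt0 : rt 0 = 1. Proof. by rewrite /rt mul0r mulr0 expi0. Qed.
Lemma rtD m m' : rt (m + m') = rt m * rt m'.
Proof. by rewrite /rt -expiD rmorphD; congr expi => /=; ring. Qed.
Lemma rtN m : rt (- m) = (rt m)^*%C.
Proof. by rewrite /rt expi_conj rmorphN; congr expi => /=; ring. Qed.
Lemma rt_neq0 m : rt m != 0. Proof. exact: expi_neq0. Qed.
Lemma rt_per m : rt (N%:Z * m) = 1.
Proof.
by rewrite -[RHS](expi2pi R m) /rt rmorphM; congr expi => /=; field.
Qed.
Lemma nsq_rt m : nsq (rt m) = 1. Proof. exact: nsq_expi. Qed.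

Lemma rt_eq1 m : rt m = 1 -> (N%:Z %| m)%Z.
Proof.
move=> /expi_eq1[w hw]; apply/dvdzP; exists w; apply: (intr_inj (R := R)).
by rewrite rmorphM /= -hw divfK.
Qed.

Lemma rt_mod m m' : (N%:Z %| m - m')%Z -> rt m = rt m'.
Proof.
by move=> /dvdzP[w hw]; rewrite -(subrK m' m) hw mulrC rtD rt_per mul1r.
Qed.

Lemma rt_exp (m : int) (n : nat) : rt m ^+ n = rt (m * n%:Z).
Proof.
elim: n => [|n IH]; first by rewrite mulr0 rt0.
by rewrite exprS IH -rtD; congr rt; rewrite -addn1 PoszD; ring.
Qed.

Lemma zetaX n : zeta R N ^+ n = rt n%:Z.
Proof. by rewrite -[n%:Z]mul1r -rt_exp /rt /zeta mul1r. Qed.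

Lemma zetaXz (m : int) : zeta R N ^ m = rt m.
Proof.
case: m => n; first exact: zetaX.
rewrite NegzE -exprnN zetaX; apply: (mulfI (rt_neq0 n.+1)).
by rewrite divff ?rt_neq0// -rtD subrr rt0.
Qed.

Lemma ZN_val (i j : 'Z_N) : (nat_of_ord (i + j)%R = (i + j) %% N)%N.
Proof. by rewrite /=; move: (nat_of_ord i) (nat_of_ord j) => a b; rewrite Zp_cast. Qed.

Lemma ZN_addz (i j : 'Z_N) : (N%:Z %| (i + j)%R%:Z - (i%:Z + j%:Z))%Z.
Proof.
rewrite ZN_val -PoszD {2}(divn_eq (i + j) N) PoszD opprD addrCA subrr addr0.
by rewrite PoszM dvdzE abszN abszM /= dvdn_mull.
Qed.

Lemma rt_ZND (m : int) (i j : 'Z_N) : rt (m * (i + j)%R%:Z) = rt (m * i%:Z) * rt (m * j%:Z).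
Proof.
rewrite -rtD; apply: rt_mod; rewrite -mulrDr -mulrBr.
by apply: dvdz_mull; exact: ZN_addz.
Qed.

Lemma ZN_lt (i : 'Z_N) : (i < N)%N.
Proof. by rewrite -[X in (_ < X)%N](Zp_cast hN) ltn_ord. Qed.

Lemma ZN_eq0 (d : 'Z_N) : (d != 0) = (0 < d)%N.
Proof. by rewrite lt0n. Qed.

Lemma ZN_dvd (i j : 'Z_N) : (N%:Z %| i%:Z - j%:Z)%Z -> i = j.
Proof.
move=> h; apply/val_inj/eqP => /=; rewrite -eqz_nat -subr_eq0.
have := ZN_lt i; have := ZN_lt j; move: h; move: (nat_of_ord i) (nat_of_ord j) => a b.
move=> /dvdzP[w hw] bN aN; rewrite hw mulf_eq0; apply/orP; left.
by apply/eqP; nia.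
Qed.

Lemma sum_ZN (V : nmodType) (F : nat -> V) :
  \sum_(1 <= j < N) F j = \sum_(d : 'Z_N | d != 0) F d.
Proof.
rewrite -[X in index_iota _ X](Zp_cast hN).
transitivity (\sum_(0 <= j < (Zp_trunc N).+2 | j != 0%N) F j).
  by rewrite [RHS]big_ltn_cond//= big_nat_cond [RHS]big_nat_cond; apply: eq_bigl => -[|j].
by rewrite big_mkord; apply: eq_bigl => i.
Qed.

(** Shifting the index multiplies the sum by [rt m], which is not 1 unless [N]
   divides [m]. *)
Lemma rt_orth m : \sum_(j : 'Z_N) rt (m * j%:Z) = if (N%:Z %| m)%Z then N%:R else 0.
Proof.
case: ifPn => [/dvdzP[w ->]|hm].
  rewrite (eq_bigr (fun=> 1)) => [|j _].
    by rewrite sumr_const card_ord Zp_cast.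
  by rewrite -mulrA mulrCA rt_per.
have h1 : rt m * \sum_(j : 'Z_N) rt (m * j%:Z) = \sum_(j : 'Z_N) rt (m * j%:Z).
  rewrite [RHS](reindex_inj (addIr (1 : 'Z_N))) mulr_sumr; apply: eq_bigr => j _.
  rewrite rt_ZND mulrC; congr (_ * rt _).
  by rewrite /= modn_small ?mulr1.
have : (rt m - 1) * \sum_(j : 'Z_N) rt (m * j%:Z) = 0 by rewrite mulrBl mul1r h1 subrr.
move/eqP; rewrite mulf_eq0 subr_eq0 => /orP[/eqP /rt_eq1 h|/eqP//].
by rewrite h in hm.
Qed.

Definition dft (l : int) (c : 'Z_N -> R[i]) : R[i] :=
  \sum_(j : 'Z_N) rt (- l * j%:Z) * c j.

Lemma dft_mod l l' c : (N%:Z %| l - l')%Z -> dft l c = dft l' c.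
Proof.
move=> h; apply: eq_bigr => j _; congr (_ * _); apply: rt_mod.
rewrite (_ : _ - _ = (l - l') * - j%:Z); last by ring.
by apply: dvdz_mulr.
Qed.

Lemma dftB l c c' : dft l (fun j => c j - c' j) = dft l c - dft l c'.
Proof. by rewrite /dft -sumrB; apply: eq_bigr => j _; ring. Qed.

Lemma dftD l c c' : dft l (fun j => c j + c' j) = dft l c + dft l c'.
Proof. by rewrite /dft -big_split; apply: eq_bigr => j _; rewrite mulrDr. Qed.

Lemma dftZ l z c : dft l (fun j => z * c j) = z * dft l c.
Proof. by rewrite /dft mulr_sumr; apply: eq_bigr => j _; rewrite mulrCA. Qed.

Lemma dft_shift l (d : 'Z_N) c : dft l (fun j => c (j + d)) = rt (l * d%:Z) * dft l c.
Proof.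
rewrite /dft [in RHS](reindex_inj (addIr d)) mulr_sumr; apply: eq_bigr => j _.
rewrite rt_ZND !mulrA; congr (_ * _).
rewrite mulrAC -rtD (_ : l * d%:Z + - l * d%:Z = 0); last by ring.
by rewrite rt0 mul1r.
Qed.

Lemma dft_inv (j : 'Z_N) c : \sum_(l : 'Z_N) rt (l%:Z * j%:Z) * dft l%:Z c = N%:R * c j.
Proof.
rewrite /dft; under eq_bigr do rewrite mulr_sumr.
rewrite exchange_big /= (bigD1 j) //= [X in _ + X]big1 ?addr0 => [|i ij].
  rewrite (eq_bigr (fun=> c j)) => [|l _].
    by rewrite sumr_const card_ord Zp_cast// mulr_natl.
  rewrite mulrA -rtD (_ : l%:Z * j%:Z + - l%:Z * j%:Z = 0); last by ring.
  by rewrite rt0 mul1r.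
under eq_bigr => l _.
  rewrite mulrA -rtD (_ : _ + _ = (j%:Z - i%:Z) * l%:Z); last by ring.
  over.
rewrite -mulr_suml rt_orth; case: ifPn => [/ZN_dvd h|]; last by rewrite mul0r.
by rewrite h eqxx in ij.
Qed.

Lemma parseval c : \sum_(l : 'Z_N) nsq (dft l%:Z c) = N%:R * \sum_(j : 'Z_N) nsq (c j).
Proof.
have sumC (I : finType) (F : I -> R) : (\sum_i F i)%:C%C = \sum_i (F i)%:C%C.
  exact: (rmorph_sum (real_complex R)).
apply: (@complexI R); rewrite rmorphM /= !sumC.
have -> : (N%:R : R)%:C%C = N%:R by exact: (rmorph_nat (real_complex R)).
transitivity (\sum_(l : 'Z_N) \sum_(j : 'Z_N) (c j)^*%C * (rt (l%:Z * j%:Z) * dft l%:Z c)).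
  apply: eq_bigr => l _; rewrite nsqE {2}/dft conjc_sum mulr_sumr.
  by apply: eq_bigr => j _; rewrite conjcM -rtN mulNr opprK; ring.
rewrite exchange_big mulr_sumr; apply: eq_bigr => j _.
by rewrite -mulr_sumr dft_inv nsqE; ring.
Qed.

(** A shift of the labels multiplies the mode [l] by a root of unity, so that
   Parseval's identity diagonalises every translation invariant form. *)
Lemma shift_form (w : 'Z_N -> R) c :
  \sum_(d : 'Z_N | d != 0) w d * \sum_(j : 'Z_N) nsq (c (j + d) - c j) =
  N%:R^-1 * \sum_(l : 'Z_N)
    (\sum_(d : 'Z_N | d != 0) w d * nsq (rt (l%:Z * d%:Z) - 1)) * nsq (dft l%:Z c).
Proof.
have H d : \sum_(j : 'Z_N) nsq (c (j + d) - c j) =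
    N%:R^-1 * \sum_(l : 'Z_N) nsq (rt (l%:Z * d%:Z) - 1) * nsq (dft l%:Z c).
  apply: (mulfI NR); rewrite mulVKf// -parseval; apply: eq_bigr => l _.
  by rewrite dftB dft_shift -nsqM; congr nsq; ring.
under eq_bigr do rewrite H.
rewrite mulr_sumr; under [RHS]eq_bigr do rewrite mulr_suml mulr_sumr.
rewrite [RHS]exchange_big /=; apply: eq_bigr => d _.
by rewrite mulrCA mulr_sumr mulr_sumr; apply: eq_bigr => l _; ring.
Qed.

(** * The frequencies of the regular polygon *)

Lemma rho_sq (d : nat) : rho R N d ^+ 2 = nsq (rt d%:Z - 1).
Proof.
rewrite /rho zetaX; case: (rt d%:Z - 1) => x y /=.
by rewrite sqr_sqrtr ?addr_ge0 ?sqr_ge0.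
Qed.

Lemma rho_ge0 d : 0 <= rho R N d.
Proof. by rewrite /rho; case: (_ - _) => x y; exact: sqrtr_ge0. Qed.

Lemma rho_gt0 d : (0 < d)%N -> (d < N)%N -> 0 < rho R N d.
Proof.
move=> d0 dN; rewrite lt_neqAle rho_ge0 andbT eq_sym; apply/eqP => h.
have := rho_sq d; rewrite h expr0n /= => /esym/nsq_eq0/eqP.
rewrite subr_eq0 => /eqP/rt_eq1; rewrite dvdzE /= => /(dvdn_leq d0).
by rewrite leqNgt dN.
Qed.

Lemma rhoZ_gt0 (d : 'Z_N) : d != 0 -> 0 < rho R N d.
Proof. by rewrite ZN_eq0 => d0; exact: rho_gt0 d0 (ZN_lt d). Qed.

Lemma nsq_rtB1 m : nsq (rt m - 1) = 2 * (1 - cos (2 * pi * (m%:~R / N%:R))).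
Proof.
rewrite /nsq !ReImE; have := cos2Dsin2 (2 * pi * (m%:~R / N%:R) : R).
by move=> h; rewrite oppr0 addr0; lra.
Qed.

Lemma omega_sq (l : int) : omega R N l ^+ 2 =
  2^-1 * \sum_(d : 'Z_N | d != 0) (rho R N d ^+ 3)^-1 * nsq (rt (l * d%:Z) - 1).
Proof.
have H : Re (\sum_(1 <= j < N) (1 - zeta R N ^ (j%:Z * l)) / ((rho R N j ^+ 3)%:C)%C)
  = 2^-1 * \sum_(d : 'Z_N | d != 0) (rho R N d ^+ 3)^-1 * nsq (rt (l * d%:Z) - 1).
  rewrite sum_ZN Re_sum mulr_sumr; apply: eq_bigr => d _.
  rewrite zetaXz Re_div_real nsq_rtB1 Re_add Re_one Re_opp (mulrC l).
  rewrite /rt Re_expi; by rewrite [_^-1 * (2 * _)]mulrC !mulrA mulVf ?mul1r ?pnatr_eq0.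
rewrite /omega H sqr_sqrtr// mulr_ge0// sumr_ge0// => d d0.
by rewrite mulr_ge0 ?nsq_ge0// invr_ge0 exprn_ge0// rho_ge0.
Qed.

Lemma omega_ge0 l : 0 <= omega R N l. Proof. exact: sqrtr_ge0. Qed.

Lemma omega_eq l l' : omega R N l ^+ 2 = omega R N l' ^+ 2 -> omega R N l = omega R N l'.
Proof. by move=> h; apply/eqP; rewrite -(@eqrXn2 _ 2)// ?omega_ge0// h. Qed.

Lemma omega_mod l l' : (N%:Z %| l - l')%Z -> omega R N l = omega R N l'.
Proof.
move=> h; apply: omega_eq; rewrite !omega_sq; congr (_ * _).
apply: eq_bigr => d _; congr (_ * nsq (_ - _)); apply: rt_mod.
by rewrite -mulrBl; apply: dvdz_mulr.
Qed.

Lemma omegaN l : omega R N (- l) = omega R N l.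
Proof.
apply: omega_eq; rewrite !omega_sq; congr (_ * _); apply: eq_bigr => d _; congr (_ * _).
by rewrite !nsq_rtB1 mulNr rmorphN /= mulNr mulrN cosN.
Qed.

Lemma omega_dvd l : (N%:Z %| l)%Z -> omega R N l = 0.
Proof.
move=> h; apply/eqP; rewrite -sqrf_eq0 omega_sq big1 ?mulr0// => d _.
have -> : rt (l * d%:Z) = 1.
  by rewrite -rt0; apply: rt_mod; rewrite subr0; exact: dvdz_mulr.
by rewrite subrr nsq0 mulr0.
Qed.

Lemma omega1_gt0 : 0 < omega R N 1.
Proof.
rewrite lt_neqAle omega_ge0 andbT eq_sym -sqrf_eq0 omega_sq.
rewrite mulf_eq0 negb_or invr_eq0 pnatr_eq0 /=.
have F0 (d : 'Z_N) : d != 0 -> 0 < (rho R N d ^+ 3)^-1 * nsq (rt (1 * d%:Z) - 1).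
  by move=> d0; rewrite mul1r -rho_sq mulr_gt0 ?invr_gt0 ?exprn_gt0 ?rhoZ_gt0.
rewrite gt_eqF// (bigD1 (1 : 'Z_N)) ?oner_neq0//.
apply: ltr_pwDl; first exact: F0 (oner_neq0 _).
by apply: sumr_ge0 => d /andP[d0 _]; exact: ltW (F0 _ d0).
Qed.

(** * Monotonicity of the frequencies *)

(** A sequence that is concave on [0, N/2], antisymmetric about (N-1)/2 and
   positive at 0 is positive before (N-1)/2: if some increment before [l] were
   negative, all the increments between [l] and its mirror image would be, so the
   sequence would decrease from D l to - D l. *)
Lemma concave_antisym_gt0 (D E : nat -> R) :
  (forall l, E l.+1 = D l.+1 - D l) ->
  (forall l, (2 * l + 1 < N)%N -> E l.+1 < E l) ->
  (forall l, (l <= N)%N -> E (N - l)%N = E l) ->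
  (forall l, (l < N)%N -> D (N - 1 - l)%N = - D l) ->
  0 < D 0%N -> forall l, (2 * l + 1 < N)%N -> 0 < D l.
Proof.
move=> ED Edec Esym Dsym D0; elim=> [//|l IH] lN.
have {}IH : 0 < D l by apply: IH; lia.
have [El|El] := leP 0 (E l.+1); first by move: El; rewrite ED; lra.
have H1 m : (l.+1 <= m)%N -> (2 * m <= N)%N -> E m < 0.
  elim: m => // m IHm; rewrite leq_eqVlt => /orP[/eqP <- //|lm] mN.
  apply: (@lt_trans _ _ (E m)); first by apply: Edec; lia.
  by apply: IHm => //; lia.
have H2 m : (l.+1 <= m)%N -> (m + l.+1 <= N)%N -> E m < 0.
  move=> lm mN; have [h|h] := leqP (2 * m)%N N; first exact: H1.
  by rewrite -Esym ?H1//; lia.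
have H3 m : (l.+1 < m)%N -> (m + l.+1 <= N)%N -> D m < D l.+1.
  elim: m => // m IHm lm mN; have := H2 m.+1 (ltnW lm) mN; rewrite ED.
  move: lm; rewrite ltnS leq_eqVlt => /orP[/eqP <-|lm]; first by lra.
  by have := IHm lm (ltnW mN); lra.
have := H3 (N - 1 - l.+1)%N; rewrite Dsym; last by lia.
by move=> h; have := h ltac:(lia) ltac:(lia); lra.
Qed.

Let phi (j : nat) : R := pi * j%:R / N%:R.

Let sin_phi j : (0 < j)%N -> (j < N)%N -> 0 < sin (phi j).
Proof.
move=> j0 jN; apply: sin_gt0_pi; have p0 := pi_gt0 R.
have NR0 : 0 < N%:R :> R by rewrite ltr0n ltnW.
apply/andP; split; first by rewrite divr_gt0// mulr_gt0// ltr0n.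
by rewrite /phi ltr_pdivrMr// ltr_pM2l// ltr_nat.
Qed.

Lemma rho_sin j : (0 < j)%N -> (j < N)%N -> rho R N j = 2 * sin (phi j).
Proof.
move=> j0 jN; have s0 := sin_phi j0 jN.
apply/eqP; rewrite -(@eqrXn2 _ 2)// ?rho_ge0 ?mulr_ge0// ?ltW//.
rewrite rho_sq nsq_rtB1 (_ : 2 * pi * _ = phi j *+ 2); last by rewrite /phi mulr2n; ring.
by rewrite cos_mulr2n exprMn sin2cos2 mulr2n; apply/eqP; ring.
Qed.

Let omega_sin (l : nat) : omega R N l%:Z ^+ 2 =
  \sum_(1 <= j < N) (1 - cos (2 * l%:R * phi j)) / (8 * sin (phi j) ^+ 3).
Proof.
rewrite omega_sq -(sum_ZN (fun d : nat => (rho R N d ^+ 3)^-1 * nsq (rt (l%:Z * d%:Z) - 1))).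
rewrite mulr_sumr; apply: eq_big_nat => j /andP[j0 jN].
rewrite rho_sin// nsq_rtB1 rmorphM /=.
rewrite (_ : 2 * pi * _ = 2 * l%:R * phi j); last by rewrite /phi; ring.
have s0 := sin_phi j0 jN; have sn : sin (phi j) != 0 by rewrite gt_eqF.
by field.
Qed.

(* four times the increments of omega_l^2, and the increments of these *)
Let D (l : nat) : R := \sum_(1 <= j < N) sin ((2 * l%:R + 1) * phi j) / sin (phi j) ^+ 2.
Let E (l : nat) : R := \sum_(1 <= j < N) 2 * cos (2 * l%:R * phi j) / sin (phi j).

Let omega_step (l : nat) : omega R N l.+1%:Z ^+ 2 - omega R N l%:Z ^+ 2 = D l / 4.
Proof.
rewrite !omega_sin -sumrB mulr_suml; apply: eq_big_nat => j /andP[j0 jN].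
have s0 := sin_phi j0 jN; have sn : sin (phi j) != 0 by rewrite gt_eqF.
rewrite (_ : 2 * l.+1%:R * phi j = (2 * l%:R + 1) * phi j + phi j); last by rewrite -natr1; ring.
rewrite (_ : 2 * l%:R * phi j = (2 * l%:R + 1) * phi j - phi j); last by ring.
by rewrite cosD cosB; field.
Qed.

Let E_D l : E l.+1 = D l.+1 - D l.
Proof.
rewrite -sumrB; apply: eq_big_nat => j /andP[j0 jN].
have s0 := sin_phi j0 jN; have sn : sin (phi j) != 0 by rewrite gt_eqF.
rewrite (_ : (2 * l.+1%:R + 1) * phi j = 2 * l.+1%:R * phi j + phi j); last by ring.
rewrite (_ : (2 * l%:R + 1) * phi j = 2 * l.+1%:R * phi j - phi j); last by rewrite -natr1; ring.
by rewrite sinD sinB; field.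
Qed.

Let cosP (x : R) (m : nat) : cos (2 * pi * m%:R - x) = cos x.
Proof.
rewrite addrC -[cos (_ + _)]Re_expi -[m%:R]/(m%:Z%:~R) expi_2piD Re_expi.
exact: cosN.
Qed.

Let sinP (x : R) (m : nat) : sin (2 * pi * m%:R - x) = - sin x.
Proof.
rewrite addrC -[sin (_ + _)]Im_expi -[m%:R]/(m%:Z%:~R) expi_2piD Im_expi.
exact: sinN.
Qed.

Let E_sym l : (l <= N)%N -> E (N - l)%N = E l.
Proof.
move=> lN; apply: eq_bigr => j _; congr (2 * _ / _).
rewrite natrB// (_ : 2 * _ * _ = 2 * pi * j%:R - 2 * l%:R * phi j) ?cosP//.
by rewrite /phi; field.
Qed.

Let D_sym l : (l < N)%N -> D (N - 1 - l)%N = - D l.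
Proof.
move=> lN; rewrite -sumrN; apply: eq_bigr => j _; rewrite -mulNr; congr (_ / _).
rewrite -subnDA natrB ?add1n// (_ : _ * phi j = 2 * pi * j%:R - (2 * l%:R + 1) * phi j).
  by rewrite sinP.
by rewrite -natr1 /phi; field.
Qed.

(* the closed form of this sum is a cotangent *)
Let sum_sin_gt0 l : (2 * l + 1 < N)%N ->
  0 < \sum_(1 <= j < N) sin ((2 * l%:R + 1) * phi j).
Proof.
move=> lN; pose al : R := (2 * l%:R + 1) * pi / N%:R.
have p0 := pi_gt0 R; have NR0 : 0 < N%:R :> R by rewrite ltr0n ltnW.
have al0 : 0 < al / 2.
  by rewrite !divr_gt0// mulr_gt0// addr_gt0// mulr_ge0.
have alp : al / 2 < pi / 2.
  rewrite ltr_pM2r ?invr_gt0// /al ltr_pdivrMr// mulrC ltr_pM2l//.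
  by rewrite -natrM natr1 ltr_nat -addn1.
have s0 : 0 < sin (al / 2) by apply: sin_gt0_pihalf; rewrite al0.
have c0 : 0 < cos (al / 2).
  by apply: cos_gt0_pihalf; rewrite alp (lt_trans _ al0)// oppr_lt0 divr_gt0.
rewrite -(pmulr_rgt0 _ (mulr_gt0 (ltr0Sn R 1) s0)).
pose u (j : nat) := - cos ((j%:R - 2^-1) * al).
have -> : 2 * sin (al / 2) * (\sum_(1 <= j < N) sin ((2 * l%:R + 1) * phi j))
    = \sum_(1 <= j < N) (u j.+1 - u j).
  rewrite mulr_sumr; apply: eq_bigr => j _; rewrite /u.
  rewrite (_ : (2 * l%:R + 1) * phi j = j%:R * al); last by rewrite /al /phi; ring.
  rewrite (_ : (j.+1%:R - 2^-1) * al = j%:R * al + al / 2); last by rewrite -natr1; field.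
  rewrite (_ : (j%:R - 2^-1) * al = j%:R * al - al / 2); last by field.
  by rewrite cosD cosB; ring.
rewrite telescope_sumr ?(ltnW hN)// /u.
rewrite (_ : (N%:R - 2^-1) * al = 2 * pi * l%:R - (al / 2 - pi)); last by rewrite /al; field.
rewrite cosP cosB cospi sinpi (_ : (1 - 2^-1) * al = al / 2); last by field.
by lra.
Qed.

Let E_dec l : (2 * l + 1 < N)%N -> E l.+1 < E l.
Proof.
move=> lN; have := sum_sin_gt0 lN; suff -> : E l.+1 = E l
   - 4 * \sum_(1 <= j < N) sin ((2 * l%:R + 1) * phi j) by lra.
rewrite mulr_sumr -sumrB; apply: eq_big_nat => j /andP[j0 jN].
have s0 := sin_phi j0 jN; have sn : sin (phi j) != 0 by rewrite gt_eqF.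
rewrite (_ : 2 * l.+1%:R * phi j = (2 * l%:R + 1) * phi j + phi j); last by rewrite -natr1; ring.
rewrite (_ : 2 * l%:R * phi j = (2 * l%:R + 1) * phi j - phi j); last by ring.
by rewrite cosD cosB; field.
Qed.

Let D0_gt0 : 0 < D 0.
Proof.
have F0 j : (0 < j)%N -> (j < N)%N -> 0 < sin ((2 * 0%:R + 1) * phi j) / sin (phi j) ^+ 2.
  by move=> j0 jN; rewrite mulr0 add0r mul1r divr_gt0 ?exprn_gt0 ?sin_phi.
rewrite /D big_ltn//; apply: ltr_pwDl; first exact: F0.
by rewrite big_nat; apply: sumr_ge0 => j /andP[j1 jN]; rewrite ltW// F0// ltnW.
Qed.

Let omega_incr (l : nat) : (2 <= l)%N -> (2 * l <= N)%N -> omega R N 1 < omega R N l%:Z.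
Proof.
move=> + lN; have H m : (m < l)%N -> omega R N m%:Z ^+ 2 < omega R N m.+1%:Z ^+ 2.
  move=> ml; rewrite -subr_gt0 omega_step divr_gt0//.
  by apply: (concave_antisym_gt0 E_D E_dec E_sym D_sym D0_gt0); lia.
rewrite -(@ltr_pXn2r _ 2)// ?nnegrE ?omega_ge0//.
elim: l lN H => // l IH lN H; rewrite ltnS leq_eqVlt => /orP[/eqP l1|l2].
  by rewrite -l1 in H *; exact: (H 1%N).
apply: lt_trans (H l _) => //; apply: IH => //; first by lia.
by move=> m ml; apply: H; lia.
Qed.

(** By periodicity and parity it suffices to compare the indices from 2 to N / 2
   with 1, and on that range the increments of omega_l^2 are positive. *)
Lemma omega1_lt (l : int) : ~~ (N%:Z %| l)%Z -> ~~ (N%:Z %| l - 1)%Z ->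
  ~~ (N%:Z %| l + 1)%Z -> omega R N 1 < omega R N l.
Proof.
move=> l0 l1 lm1; pose m := `|(l %% N%:Z)%Z|%N.
have Nn0 : N%:Z != 0 by rewrite eqz_nat -lt0n ltnW.
have mE : m%:Z = (l %% N%:Z)%Z by rewrite /m gez0_abs// modz_ge0.
have mN : (m < N)%N by rewrite -ltz_nat mE ltz_pmod// ltz_nat ltnW.
have lE : l = (l %/ N%:Z)%Z * N%:Z + m%:Z by rewrite mE -divz_eq.
set w := (l %/ N%:Z)%Z in lE.
have dv x : (N%:Z %| w * N%:Z + x)%Z = (N%:Z %| x)%Z.
  apply/idP/idP => /dvdzP[q hq]; apply/dvdzP.
    by exists (q - w); rewrite mulrBl -hq; ring.
  by exists (q + w); rewrite hq; ring.
rewrite lE dv in l0; rewrite lE -addrA dv in l1; rewrite lE -addrA dv in lm1.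
have m0 : m != 0%N by apply: contra l0 => /eqP ->; exact: dvdz0.
have m1 : m != 1%N by apply: contra l1 => /eqP ->; rewrite subrr; exact: dvdz0.
have mm1 : m != N.-1.
  by apply: contra lm1 => /eqP ->; rewrite -PoszD addn1 prednK ?dvdzz// ltnW.
rewrite (@omega_mod l m%:Z); last by rewrite lE addrK dvdz_mull.
have [h|h] := leqP (2 * m)%N N; first by apply: omega_incr => //; lia.
rewrite -(omegaN m%:Z) (@omega_mod (- m%:Z) (N - m)%N%:Z); last first.
  by apply/dvdzP; exists (-1); lia.
by apply: omega_incr; lia.
Qed.

Lemma omega1_le (l : int) : ~~ (N%:Z %| l)%Z -> omega R N 1 <= omega R N l.
Proof.
move=> l0; case: (boolP (N%:Z %| l - 1)%Z) => [/omega_mod->//|l1].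
case: (boolP (N%:Z %| l + 1)%Z) => [h|lm1]; last by rewrite ltW// omega1_lt.
rewrite -(omegaN 1) (@omega_mod (- 1) l)//.
by move: h => /dvdzP[q hq]; apply/dvdzP; exists (- q); rewrite mulNr -hq; ring.
Qed.

End RootsOfUnity.

(** * Frequencies of the modes *)

Lemma multiple_small (N : nat) (m z : int) : z = N%:Z * m -> `|z| < N%:Z -> z = 0.
Proof.
move=> ->; have [->|m0] := eqVneq m 0; first by rewrite mulr0.
rewrite normrM ltNge (_ : N%:Z <= _)//.
by rewrite -[leLHS]mulr1 ler_wpM2l// -gtz0_ge1 normr_gt0.
Qed.

Section ModeBounds.
Variables (R : realType) (N : nat).
Hypothesis hN : (1 < N)%N.
Local Notation om := (omega R N).

Lemma le_divE (Y x y : R) : 0 < y -> (Y%:E <= x%:E / y%:E)%E -> Y * y <= x.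
Proof.
move=> y0; rewrite inver gt_eqF// -EFinM lee_fin.
by rewrite ler_pdivlMr.
Qed.

(** The two families of terms of the bound are those with [n < 0] and with
   [n > 0]: they bound [Y omega_l] by [omega_1 |Y + 4 pi n|] after the sign of
   [Y + 4 pi n] is settled.  For [n = 0] both sides agree, and for a mode
   with [N | l] the left-hand side is zero. *)
Lemma Hbound_mode (sgn k eta : int) (Y : R) : 0 <= Y ->
  (Y%:E <= Hbound R N sgn k eta)%E -> forall n : int,
  Y ^+ 2 * om (1 + sgn * (2 * n * k * eta)) ^+ 2 <= om 1 ^+ 2 * (Y + 4 * pi * n%:~R) ^+ 2.
Proof.
move=> Y0 hY n; set l := 1 + _; have o1 := omega1_gt0 R hN; have ol := omega_ge0 R N l.
have p0 := pi_gt0 R.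
have sq (u v : R) : 0 <= u -> u <= v -> u ^+ 2 <= v ^+ 2 by move=> ? ?; nra.
case: (boolP (nonzero_mode N l)) => [nz|]; last first.
  by rewrite negbK => /(@omega_dvd R N hN) ->; rewrite expr0n mulr0 mulr_ge0 ?sqr_ge0.
have lb x : Hbound R N sgn k eta = ereal_inf x -> forall z, x z -> (Y%:E <= z)%E.
  by move=> e z xz; apply: (le_trans hY); rewrite e; exact: ereal_inf_lbound.
have {}lb := lb _ erefl.
have [n0|n0] := ltrP n 0.
  have nR : n%:~R < 0 :> R by rewrite ltrz0.
  have h : Y * (om 1 + om l) <= 4 * (- n)%:~R * pi * om 1.
    apply: le_divE; first by rewrite ltr_wpDr.
    apply: (lb (Hterm_sum R N (- n) l)); left; right; exists (- n).
    have -> : 1 - sgn * (2 * - n * k * eta) = l by rewrite /l; ring.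
    by split; rewrite ?oppr_gt0.
  rewrite rmorphN /= in h.
  rewrite -!exprMn -[leRHS]sqrrN; apply: sq; first by rewrite mulr_ge0.
  lra.
have nR : 0 <= n%:~R :> R by rewrite ler0z.
rewrite -!exprMn; apply: sq; first by rewrite mulr_ge0.
have : 0 <= pi * n%:~R * om 1 by rewrite !mulr_ge0// ltW.
have [le|lt] := lerP (om l) (om 1); first by nra.
move: n0; rewrite le_eqVlt => /predU1P[n0|n0].
  by move: lt; rewrite /l -n0 !(mulr0, mul0r) addr0 ltxx.
have : Y * (om l - om 1) <= 4 * n%:~R * pi * om 1.
  apply: le_divE; first by rewrite subr_gt0.
  by apply: (lb (Hterm_diff R N n l)); right; exists n.
lra.
Qed.

(** The index [- p - 1] gives the same value as [p], which reduces a negative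
   index to one of the terms of the bound. *)
Lemma Vbound_mode (k eta : int) (Y : R) : 0 <= Y ->
  (Y%:E <= Vbound R N k eta)%E -> forall p : int,
  Y * om ((1 + 2 * p) * k * eta) <= om 1 * (`|(1 + 2 * p)%:~R| * (2 * pi)).
Proof.
move=> Y0 hY p; have o1 := omega1_gt0 R hN; have p0 := pi_gt0 R.
wlog pp : p / 0 <= p.
  move=> H; have [/H//|p1] := leP 0 p.
  have := H (- p - 1); rewrite (_ : 1 + 2 * (- p - 1) = - (1 + 2 * p)); last by ring.
  by rewrite !mulNr omegaN// rmorphN normrN; apply; lia.
set l := _ * k * eta; have ol := omega_ge0 R N l.
case: (boolP (nonzero_mode N l)) => [nz|]; last first.
  by rewrite negbK => /(@omega_dvd R N hN) ->//; rewrite mulr0 !mulr_ge0// ltW.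
have olp : 0 < om l by apply: lt_le_trans o1 _; exact: omega1_le.
have : (Y%:E <= (om 1)%:E / (om l)%:E * (`|(1 + 2 * p)%:~R * (2 * pi)|%R)%:E)%E.
  by apply: (le_trans hY); apply: ereal_inf_lbound; exists p; split.
rewrite inver gt_eqF// -!EFinM lee_fin normrM [`|2 * pi|]ger0_norm; last by rewrite mulr_ge0// ltW.
by rewrite mulrAC ler_pdivlMr.
Qed.

Variables (k eta : int) (X : R).
Hypotheses (heta : eta = 1 \/ eta = -1) (X0 : X != 0).
Hypothesis Xge : (- Order.min (Vbound R N k eta) (Hminus R N k eta) <= X%:E)%E.
Hypothesis Xle : (X%:E <= Order.min (Vbound R N k eta) (Hplus R N k eta))%E.

Let not_multiple (c : int) : c != 0 -> `|c| < N%:Z -> ~~ (N%:Z %| c)%Z.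
Proof.
move=> /eqP c0 cN; apply/negP => /dvdzP[w hw].
by apply: c0; apply: multiple_small cN; rewrite hw mulrC.
Qed.

(* the sign of [X] selects between the two horizontal bounds *)
Let sg_bound : exists sgn : int, [/\ sgn * sgn = 1, X = sgn%:~R * `|X|,
  (`|X|%:E <= Vbound R N k eta)%E & (`|X|%:E <= Hbound R N sgn k eta)%E].
Proof.
have [X1|X1|X1] := ltgtP X 0; last by move: X0; rewrite X1 eqxx.
  move: Xge; rewrite leeNl le_min => /andP[h1 h2].
  by exists (-1); split; rewrite ?ltr0_norm//; ring.
move: Xle; rewrite le_min => /andP[h1 h2].
by exists 1; split; rewrite ?gtr0_norm// ?mul1r.
Qed.

(** The bound [V] says that every frequency 2 pi q that the symmetry allows in
   the vertical mode [l] has modulus at least |X| omega_l / omega_1. *)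
Lemma vertical_mode l q : admissible N (k * eta) l 1 q ->
  X ^+ 2 * om l ^+ 2 <= om 1 ^+ 2 * (2 * pi * q%:~R) ^+ 2.
Proof.
move=> [[p hp] [m hm]]; have [sgn [_ _ hV _]] := sg_bound.
have := Vbound_mode (normr_ge0 X) hV p.
rewrite -hp (@omega_mod _ _ hN _ l); last first.
  by apply/dvdzP; exists m; rewrite -mulrA hm; ring.
move=> h; rewrite -(real_normK (num_real X)) -[(2 * pi * _) ^+ 2](real_normK (num_real _)).
rewrite -!exprMn; have h0 : 0 <= `|X| * om l by rewrite mulr_ge0// omega_ge0.
have p0 := pi_gt0 R.
have E2 : `|2 * pi * q%:~R| = `|q%:~R| * (2 * pi) :> R.
  by rewrite mulrC normrM [`|2 * pi|]ger0_norm// mulr_ge0// ltW.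
by rewrite E2; nra.
Qed.

(** The bounds [H] say the same of the frequencies [X + 2 pi q] of the
   horizontal mode [l] in the inertial frame. *)
Lemma horizontal_mode l q : admissible N (k * eta) (l - 1) 0 q ->
  X ^+ 2 * om l ^+ 2 <= om 1 ^+ 2 * (X + 2 * pi * q%:~R) ^+ 2.
Proof.
move=> [[p hp] [m hm]]; have [sgn [s1 Xs _ hH]] := sg_bound.
have := Hbound_mode (normr_ge0 X) hH (sgn * p).
rewrite (@omega_mod _ _ hN _ l); last first.
  apply/dvdzP; exists m; rewrite [_ * N%:Z]mulrC.
  have -> : N%:Z * m = q * (k * eta) - (l - 1) by rewrite hm; ring.
  rewrite hp (_ : sgn * _ = sgn * sgn * (2 * p * k * eta)); last by ring.
  by rewrite s1; ring.
have s2 : sgn%:~R * sgn%:~R = 1 :> R by rewrite -intrM s1.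
have -> : (X + 2 * pi * q%:~R) ^+ 2 = (`|X| + 4 * pi * (sgn * p)%:~R) ^+ 2.
  have -> : X + 2 * pi * q%:~R = sgn%:~R * (`|X| + 4 * pi * (sgn * p)%:~R).
    rewrite {1}Xs hp [(sgn * p)%:~R]rmorphM /=.
    have -> : sgn%:~R * (`|X| + 4 * pi * (sgn%:~R * p%:~R))
       = sgn%:~R * `|X| + 4 * pi * p%:~R * (sgn%:~R * sgn%:~R) by ring.
    by rewrite s2 rmorphD rmorphM /=; ring.
  by rewrite exprMn expr2 s2 mul1r.
by rewrite real_normK ?num_real.
Qed.

(** The first term of [V] is 2 pi omega_1 / omega_k, and omega_1 is the smallest
   frequency; strictly so if [k > 1]. *)
Lemma frequency_le (hk1 : 1 <= k) (hk2 : 2 * k <= N%:Z) : `|X| <= 2 * pi.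
Proof.
have [sgn [_ _ hV _]] := sg_bound.
have := Vbound_mode (normr_ge0 X) hV 0; rewrite mulr0 addr0 mul1r normr1 mul1r.
have nd : ~~ (N%:Z %| k * eta)%Z.
  by apply: not_multiple; case: heta => ->; lia.
have o1 := omega1_gt0 R hN; have := omega1_le R hN nd.
have := normr_ge0 X; move: (om (k * eta)) => o *.
by rewrite -(ler_pM2l o1); nra.
Qed.

Lemma frequency_lt (hk1 : 1 < k) (hk2 : 2 * k <= N%:Z) (hN3 : (2 < N)%N) : `|X| < 2 * pi.
Proof.
have [sgn [_ _ hV _]] := sg_bound.
have := Vbound_mode (normr_ge0 X) hV 0; rewrite mulr0 addr0 mul1r normr1 mul1r.
have o1 := omega1_gt0 R hN.
have : om 1 < om (k * eta).
  by apply: omega1_lt => //; apply: not_multiple; case: heta => ->; lia.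
have X1 : 0 < `|X| by rewrite normr_gt0.
move: (om (k * eta)) => o h1 h2.
by rewrite -(ltr_pM2l o1); nra.
Qed.

End ModeBounds.

(** * Integrals of extended real functions and weak derivatives *)

Section ExtendedIntegrals.
Variable R : realType.
Local Notation mu := (@lebesgue_measure R).

(** The integral of a nonnegative function is a supremum over simple functions,
   so that monotonicity needs no measurability; the potential is bounded below
   in this way. *)
Lemma ge0_integral_mono (D : set R) (f g : R -> \bar R) :
  (forall t, D t -> (0 <= f t)%E) -> (forall t, D t -> (f t <= g t)%E) ->
  (\int[mu]_(t in D) f t <= \int[mu]_(t in D) g t)%E.
Proof.
move=> f0 fg; have g0 t : D t -> (0 <= g t)%E by move=> Dt; apply: le_trans (fg t Dt); exact: f0.
rewrite !ge0_integralE//; apply: ge_ereal_sup => _ [h /= hf <-].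
apply: ereal_sup_ubound; exists h => //= t; apply: le_trans (hf t) _.
by rewrite /patch; case: ifPn => // tD; apply: fg; rewrite inE in tD.
Qed.

Lemma Int_EFin a b (f : R -> R) : L1 a b f ->
  (Int a b f)%:E = (\int[mu]_(t in `[a, b]) (f t)%:E)%E.
Proof.
by move=> hf; rewrite /Int /Rintegral fineK//; exact: integrable_fin_num.
Qed.

Lemma Int_le_integral a b (f : R -> R) (g : R -> \bar R) : L1 a b f ->
  (forall t, t \in `[a, b] -> (0 <= g t)%E) ->
  (forall t, t \in `[a, b] -> ((f t)%:E <= g t)%E) ->
  ((Int a b f)%:E <= \int[mu]_(t in `[a, b]) g t)%E.
Proof.
move=> hf g0 fg; have mf := L1_measurable hf.
pose f' t := Num.max (f t) 0.
have hf' : L1 a b f'.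
  apply: (L1_le _ _ (L1_abs hf)).
    by apply: measurable_maxr => //; exact: measurable_cst.
  move=> t _; rewrite /f'; case: (leP (f t) 0) => h; last by rewrite lexx.
  by rewrite normr0.
apply: (@le_trans _ _ (Int a b f')%:E).
  by rewrite lee_fin; apply: Int_le => // t _; rewrite /f' le_max lexx.
rewrite Int_EFin//; apply: ge0_integral_mono => t /= tab.
  by rewrite lee_fin /f' le_max lexx orbT.
rewrite /f'; case: (leP (f t) 0) => h; first exact: g0.
exact: fg.
Qed.

(** When the tangent line to 1 / sqrt u at u = r0^2 (with u = e^2) and the gap are
   subtracted from 1 / e, there remains (e - r0)^2 / (r0^2 e). *)
Lemma inv_tangent (e r0 : R) : 0 <= e -> 0 < r0 ->
  ((3 / (2 * r0) - e ^+ 2 / (2 * r0 ^+ 3) + (e - r0) ^+ 2 / (2 * r0 ^+ 3))%:E <= e%:E^-1)%E.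
Proof.
move=> e0 r00; move: e0; rewrite le_eqVlt => /predU1P[<-|e0].
  by rewrite inver eqxx leey.
have en : e != 0 by rewrite gt_eqF. have rn : r0 != 0 by rewrite gt_eqF.
rewrite inver gt_eqF// lee_fin -subr_ge0.
have -> : e^-1 - (3 / (2 * r0) - e ^+ 2 / (2 * r0 ^+ 3) + (e - r0) ^+ 2 / (2 * r0 ^+ 3))
  = (r0 - e) ^+ 2 / (r0 ^+ 2 * e) by field; rewrite rn en.
by rewrite divr_ge0 ?sqr_ge0// mulr_ge0 ?sqr_ge0// ltW.
Qed.

End ExtendedIntegrals.

Section Sobolev.
Variable R : realType.

Lemma weak_derivative_ac (s : R) (f g : R -> R) : weak_derivative s f g -> ac 0 s f g.
Proof.
move=> [mg ig fE]; split; last by move=> t; rewrite in_itv /=; exact: fE.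
split; first exact: mg.
apply/integrableP; split.
  by apply/measurable_EFinP; exact: measurable_funX.
apply: le_lt_trans ig; apply: ge0_integral_mono => t _; first exact: abse_ge0.
by rewrite /= ger0_norm ?sqr_ge0.
Qed.

Lemma ac_weak_derivative (s : R) (f g : R -> R) : ac 0 s f g -> weak_derivative s f g.
Proof.
move=> [[mg /integrableP[_ ig]] fE]; split=> //.
  apply: le_lt_trans ig; apply: ge0_integral_mono => t _.
    by rewrite lee_fin sqr_ge0.
  by rewrite /= ger0_norm ?sqr_ge0.
Qed.

Lemma wderiv_ac (s : R) (f : R -> R) : H1 s f -> ac 0 s f (wderiv s f).
Proof.
move=> [g hg]; apply: weak_derivative_ac.
exact: (@xgetPex _ _ [set g | weak_derivative s f g] (ex_intro _ g hg)).
Qed.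

Local Notation mu := (@lebesgue_measure R).

(** By Lebesgue differentiation, a function all of whose integrals from [a] vanish
   is zero almost everywhere. *)
Lemma primitive_eq0 (a b : R) (d : R -> R) : a <= b -> L1 a b d ->
  (forall t, t \in `[a, b] -> Int a t d = 0) -> Int a b (fun t => d t ^+ 2) = 0.
Proof.
move=> ab hd I0; pose f := d \_ `[a, b].
have fT : mu.-integrable setT (EFin \o f).
  by rewrite /f -restrict_EFin; apply/integrable_restrict => //=; rewrite setTI.
have F0 x : \int[mu]_(t in [set` `]-oo, x]]) f t = 0.
  rewrite -Rintegral_mkcondr.
  have [xa|ax] := ltP x a.
    rewrite (_ : _ `&` _ = set0) ?Rintegral_set0//.
    apply/seteqP; split=> // t [] /=; rewrite !in_itv /= => tx /andP[at' _].
    by have := lt_le_trans xa (le_trans at' tx); rewrite ltxx.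
  have [xb|bx] := leP x b.
    rewrite (_ : _ `&` _ = `[a, x]%classic); first by apply: I0; rewrite in_itv /= ax.
    apply/seteqP; split=> t /=; rewrite !in_itv /=.
      by move=> [tx /andP[-> _]].
    by move=> /andP[at' tx]; rewrite at' tx (le_trans tx xb).
  rewrite (_ : _ `&` _ = `[a, b]%classic); first by apply: I0; rewrite in_itv /= ab lexx.
  apply/seteqP; split=> t /=; rewrite !in_itv /=; first by case.
  by move=> /andP[at' tb]; rewrite at' tb (le_trans tb (ltW bx)).
have int_y y : mu.-integrable [set` `]-oo, y]] (EFin \o f) by exact: integrableS fT.
have loc : locally_integrable [set: R] f by exact: integrable_locally hd.
have ae0 : {ae mu, forall x, f x = 0}.
  have := FTC1Ny int_y loc; apply: filterS; first exact: (ae_filter_ringOfSetsType mu).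
  move=> x [_ <-].
  rewrite (_ : (fun x => _) = cst 0); last by apply/funext => x'; exact: F0.
  by rewrite derive1E derive_cst.
rewrite /Int /Rintegral (@ae_eq_integral _ _ _ mu `[a, b] (cst 0%E)) ?integral0//=.
- by apply/measurable_EFinP; apply: measurable_funX; exact: L1_measurable hd.
- move: ae0; apply: filterS; first exact: (ae_filter_ringOfSetsType mu).
  move=> x fx0 xab; move: fx0; rewrite /f /patch mem_set// => ->.
  by rewrite expr0n.
Qed.

Lemma ac_unique (a b : R) (f g g' : R -> R) : a <= b -> ac a b f g -> ac a b f g' ->
  Int a b (fun t => (g t - g' t) ^+ 2) = 0.
Proof.
move=> ab h h'; apply: primitive_eq0 => //.
  by apply: L1B; apply: L2_L1; [case: h|case: h'].
move=> t tab; have [_ /(_ t tab)] := acB h h'.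
by rewrite !subrr add0r => <-.
Qed.

Lemma Int_sqr_unique (a b : R) (f g g' u : R -> R) : a <= b -> ac a b f g -> ac a b f g' ->
  L2 a b u -> Int a b (fun t => (g t + u t) ^+ 2) = Int a b (fun t => (g' t + u t) ^+ 2).
Proof.
move=> ab h h' hu; have I0 := ac_unique ab h h'.
have hd := ac_L2 (acB h h'); have hs := L2D (ac_L2 h') hu.
have J0 := Int_sqr_eq0M hs hd I0.
rewrite (@Int_ext _ _ _ _ (fun t => (g' t + u t) ^+ 2 + (2 * ((g' t + u t) * (g t - g' t))
  + (g t - g' t) ^+ 2))); last by move=> t _; ring.
have L2' := L2_L1M hs hd.
rewrite IntD; [|by case: hs|by apply: L1D; [exact: L1Z|case: hd]].
rewrite IntD; [|exact: L1Z|by case: hd].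
by rewrite IntZ// J0 I0 mulr0 !addr0.
Qed.

(** The action refers to some choice of the weak derivative; an explicit
   derivative gives the same integral. *)
Lemma Int_energy_unique (a b varpi kap : R) (F G G' : R -> R[i]) : a <= b ->
  acC a b F G -> acC a b F G' ->
  Int a b (energyC varpi kap F G) = Int a b (energyC varpi kap F G').
Proof.
move=> ab [h1 h2] [h1' h2']; have c1 := ac_cont ab h1; have c2 := ac_cont ab h2.
have [a1 a2] := L2_twist varpi ab h1 h2; have [b1 b2] := L2_twist varpi ab h1' h2'.
have Ln := L1_sqr2 ab h1 h2.
rewrite /energyC /energy !IntB//; first last.
- exact: L1Z.
- by apply: L1D; [case: a1|case: a2].
- exact: L1Z.
- by apply: L1D; [case: b1|case: b2].
rewrite !IntD//; [|by case: b1|by case: b2|by case: a1|by case: a2].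
congr (_ + _ - _).
  apply: (@Int_sqr_unique a b _ _ _ (fun t => - (varpi * (@complex.Im R \o F) t)) ab h1 h1').
  apply: (@L2_ext _ _ _ (fun t => - varpi * (@complex.Im R \o F) t)) => [t _|].
    by rewrite mulNr.
  by apply: L2Z; exact: cont_L2.
apply: (@Int_sqr_unique a b _ _ _ (fun t => varpi * (@complex.Re R \o F) t) ab h2 h2').
by apply: L2Z; exact: cont_L2.
Qed.

End Sobolev.

(** * Sums over pairs of bodies *)

Section Pairs.
Variables (R : realType) (N : nat).
Hypothesis hN : (1 < N)%N.

(** Ordered pairs of distinct labels are parametrised by the first label and the
   difference. *)
Lemma sum_pairs (f : 'Z_N -> 'Z_N -> R) : (forall i j, f i j = f j i) ->
  \sum_(i : 'Z_N) \sum_(j : 'Z_N | (i < j)%N) f i j =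
  2^-1 * \sum_(d : 'Z_N | d != 0) \sum_(i : 'Z_N) f i (i + d).
Proof.
move=> fC; set P := LHS.
have P' : \sum_(i : 'Z_N) \sum_(j : 'Z_N | (j < i)%N) f i j = P.
  rewrite /P (exchange_big_dep xpredT)//=; apply: eq_bigr => i _.
  by apply: eq_bigr => j _; exact: fC.
have -> : \sum_(d : 'Z_N | d != 0) \sum_(i : 'Z_N) f i (i + d) = P + P; last by field.
rewrite exchange_big /= -{2}P' -big_split /=; apply: eq_bigr => i _.
transitivity (\sum_(j : 'Z_N | j != i) f i j).
  rewrite [RHS](reindex_inj (addrI i)) /=; apply: eq_bigl => d.
  by rewrite -[X in _ = (_ != X)]addr0 (inj_eq (addrI i)).
rewrite (bigID (fun j : 'Z_N => (i < j)%N)) /=; congr (_ + _); apply: eq_bigl => j.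
  by rewrite -val_eqE /=; case: ltngtP.
by rewrite -val_eqE /=; case: ltngtP.
Qed.

Local Notation rd d := (rho R N (nat_of_ord (d : 'Z_N))).

Lemma rhoN (d : 'Z_N) : rd (- d) = rd d.
Proof.
apply/eqP; rewrite -(@eqrXn2 _ 2)// ?rho_ge0// !rho_sq; apply/eqP.
have -> : rt R N (- d)%R%:Z = (rt R N d%:Z)^*%C.
  rewrite -rtN; apply: rt_mod => //.
  have := ZN_addz hN (- d) d; rewrite addNr /= sub0r opprD.
  move=> /dvdzP[q hq]; apply/dvdzP; exists (- q); rewrite mulNr -hq; ring.
rewrite -[in RHS]nsq_conj; congr nsq; apply: complex_eq; rewrite !ReImE //.
by rewrite oppr0 !addr0.
Qed.

(** The potential of the regular polygon, in terms of omega_1: the term of index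
   [d] in omega_1^2 is [rho_d^2 / rho_d^3] up to a factor. *)
Lemma sum_inv_rho : \sum_(d : 'Z_N | d != 0) (rd d)^-1 = 2 * omega R N 1 ^+ 2.
Proof.
rewrite omega_sq// mulrA mulfV ?pnatr_eq0// mul1r; apply: eq_bigr => d d0.
have := rhoZ_gt0 R hN d0; move=> r0; rewrite mul1r -rho_sq; field.
by rewrite gt_eqF.
Qed.

End Pairs.

(** * The lower bound of the action *)

Section Enorm.
Variable R : realType.

Lemma enorm_ge0 (u : body R) : 0 <= enorm u. Proof. exact: sqrtr_ge0. Qed.

Lemma enorm_sq (u : body R) : enorm u ^+ 2 = nsq u.1 + u.2 ^+ 2.
Proof. by rewrite sqr_sqrtr// addr_ge0 ?sqr_ge0// addr_ge0 ?sqr_ge0. Qed.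

Lemma enormN (u v : body R) : enorm (u - v) = enorm (v - u).
Proof.
apply/eqP; rewrite -(@eqrXn2 _ 2)// ?enorm_ge0// !enorm_sq; apply/eqP.
by rewrite /nsq /= !ReImE; ring.
Qed.

End Enorm.

Section ActionBound.
Variables (R : realType) (N : nat) (S varpi a : R) (y : R -> conf R N).
Hypotheses (hN : (1 < N)%N) (S0 : 0 < S) (a0 : 0 < a) (hy : Lambda S y).
Local Notation mu := (@lebesgue_measure R).
Local Notation om := (omega R N).
Local Notation rd d := (rho R N (nat_of_ord (d : 'Z_N))).

(* the vertical coordinate is made complex, so that both components have the same
   Fourier transform *)
Definition hor (j : 'Z_N) (t : R) : R[i] := (y t j).1.
Definition ver (j : 'Z_N) (t : R) : R[i] := ((y t j).2)%:C%C.
Definition dhor (j : 'Z_N) (t : R) : R[i] := (velocity S y t j).1.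
Definition dver (j : 'Z_N) (t : R) : R[i] := ((velocity S y t j).2)%:C%C.

Lemma hor_ac j : acC 0 S (hor j) (dhor j).
Proof. by have [_ /(_ j)[hx hy' hz] _] := hy; split; exact: wderiv_ac. Qed.

Lemma ver_ac j : acC 0 S (ver j) (dver j).
Proof.
have [_ /(_ j)[hx hy' hz] _] := hy; split; first exact: wderiv_ac.
exact: ac_cst.
Qed.

Definition hmode (l : int) t := dft l (fun j => hor j t).
Definition vmode (l : int) t := dft l (fun j => ver j t).
Definition dhmode (l : int) t := dft l (fun j => dhor j t).
Definition dvmode (l : int) t := dft l (fun j => dver j t).

Lemma hmode_ac l : acC 0 S (hmode l) (dhmode l).
Proof. by apply: acC_sum => j _; apply: acCZ; exact: hor_ac. Qed.

Lemma vmode_ac l : acC 0 S (vmode l) (dvmode l).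
Proof. by apply: acC_sum => j _; apply: acCZ; exact: ver_ac. Qed.

Let dist (i j : 'Z_N) t := enorm (y t i - y t j).

Let dist_sq i j t : dist i j t ^+ 2 = nsq (hor i t - hor j t) + nsq (ver i t - ver j t).
Proof. by rewrite /dist enorm_sq /hor /ver /= /nsq !ReImE; ring. Qed.

Let dist_cont i j : cont 0 S (dist i j).
Proof.
have [h1 h2] := hor_ac i; have [h3 h4] := hor_ac j.
have [h5 _] := ver_ac i; have [h6 _] := ver_ac j.
have c1 := ac_cont (ltW S0) (acB h1 h3); have c2 := ac_cont (ltW S0) (acB h2 h4).
have c3 := ac_cont (ltW S0) (acB h5 h6).
have c := contD (contD (contM c1 c1) (contM c2 c2)) (contM c3 c3).
have c' : cont 0 S (fun t => dist i j t ^+ 2).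
  apply: (@eq_ind _ _ (fun F => cont 0 S F) c (fun t => dist i j t ^+ 2)).
  by apply/funext => u; rewrite dist_sq /nsq /comp !ReImE; ring.
have -> : dist i j = Num.sqrt \o (fun t => dist i j t ^+ 2).
  by apply/funext => t; rewrite /= sqrtr_sqr ger0_norm ?enorm_ge0.
apply/subspace_continuousP => t tS; move/subspace_continuousP: c' => /(_ t tS) ct.
by apply: cvg_comp ct _; exact: sqrt_continuous.
Qed.

(** Squared frequency of the mode [l] in the linear system obtained by replacing
   each attraction of the polygon of radius [a] by a spring. *)
Definition kappa (l : int) : R := om l ^+ 2 / a ^+ 3.

Let kin t := norm2 (fun j => velocity S y t j + bscale varpi (Jgen (y t j))).

Lemma norm2_velocity t :
  norm2 (fun j => velocity S y t j + bscale varpi (Jgen (y t j))) =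
  \sum_(j : 'Z_N) (energyC varpi 0 (hor j) (dhor j) t + energyC 0 0 (ver j) (dver j) t).
Proof.
apply: eq_bigr => j _; rewrite enorm_sq !energyCE !mul0r !subr0; congr (_ + _).
  congr nsq; congr (_ + _).
  by apply: complex_eq; rewrite /hor /= !ReImE /=; case: (y t j).1 => u v /=; ring.
by rewrite /ver /dver /nsq !ReImE /=; ring.
Qed.

Let kinE t : kin t = N%:R^-1 * \sum_(l : 'Z_N)
  (nsq (dhmode l%:Z t + (0 +i* varpi)%C * hmode l%:Z t) + nsq (dvmode l%:Z t)).
Proof.
have NR : N%:R != 0 :> R by rewrite pnatr_eq0 -lt0n ltnW.
rewrite /kin norm2_velocity big_split [in RHS]big_split /=.
under [X in _ = _ * (X + _)]eq_bigr do rewrite /hmode /dhmode -dftZ -dftD.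
rewrite !parseval// -mulrDr mulKf//; congr (_ + _); apply: eq_bigr => j _.
  by rewrite energyCE mul0r subr0.
by rewrite /ver /dver /energyC /energy /nsq !ReImE /=; ring.
Qed.

(* the part of the tangent lines that is quadratic in the distances *)
Let pot t := \sum_(d : 'Z_N | d != 0) (rd d ^+ 3)^-1 * \sum_(i : 'Z_N) dist (i + d) i t ^+ 2.

Let potE t : pot t = 2 * N%:R^-1 * \sum_(l : 'Z_N)
   om l%:Z ^+ 2 * (nsq (hmode l%:Z t) + nsq (vmode l%:Z t)).
Proof.
have F c : \sum_(d : 'Z_N | d != 0) (rd d ^+ 3)^-1 * \sum_(i : 'Z_N) nsq (c (i + d) - c i)
   = 2 * N%:R^-1 * \sum_(l : 'Z_N) om l%:Z ^+ 2 * nsq (dft l%:Z c).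
  rewrite (shift_form hN (fun d : 'Z_N => (rd d ^+ 3)^-1)) [2 * _]mulrC -mulrA; congr (_ * _).
  rewrite mulr_sumr; apply: eq_bigr => l _.
  by rewrite omega_sq// !mulrA mulfV ?pnatr_eq0// mul1r.
rewrite /pot; under eq_bigr do under eq_bigr do rewrite dist_sq.
under eq_bigr do rewrite big_split mulrDr.
rewrite big_split /= (F (fun j => hor j t)) (F (fun j => ver j t)) -mulrDr -big_split /=.
by congr (_ * _); apply: eq_bigr => l _; rewrite -mulrDr.
Qed.

Definition quadratic_action : R := N%:R^-1 * \sum_(l : 'Z_N)
  (Int 0 S (energyC varpi (kappa l%:Z) (hmode l%:Z) (dhmode l%:Z)) +
   Int 0 S (energyC 0 (kappa l%:Z) (vmode l%:Z) (dvmode l%:Z))).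

Let quad t := kin t - (2 * a ^+ 3)^-1 * pot t.

Let quadE t : quad t = N%:R^-1 * \sum_(l : 'Z_N)
  (energyC varpi (kappa l%:Z) (hmode l%:Z) (dhmode l%:Z) t +
   energyC 0 (kappa l%:Z) (vmode l%:Z) (dvmode l%:Z) t).
Proof.
have an : a != 0 by rewrite gt_eqF.
have NR : N%:R != 0 :> R by rewrite pnatr_eq0 -lt0n ltnW.
rewrite /quad kinE potE.
rewrite (_ : (2 * a ^+ 3)^-1 * _ = N%:R^-1 * (a ^- 3 * \sum_(l : 'Z_N)
   om l%:Z ^+ 2 * (nsq (hmode l%:Z t) + nsq (vmode l%:Z t)))); last by field; rewrite an NR.
rewrite -mulrBr mulr_sumr -sumrB; congr (_ * _); apply: eq_bigr => l _.
rewrite !energyCE /kappa.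
have -> : dvmode l%:Z t + (0 +i* 0)%C * vmode l%:Z t = dvmode l%:Z t.
  by apply: complex_eq; rewrite !ReImE; ring.
by ring.
Qed.

Let r (d : 'Z_N) := a * rd d.
Definition gap t := \sum_(i : 'Z_N) \sum_(j : 'Z_N | (i < j)%N)
  (enorm (y t i - y t j) - r (j - i)) ^+ 2 / (2 * r (j - i) ^+ 3).

Let r_gt0 d : d != 0 -> 0 < r d.
Proof. by move=> d0; rewrite mulr_gt0// rhoZ_gt0. Qed.

Let rN d : r (- d) = r d. Proof. by rewrite /r rhoN. Qed.

(** Kinetic energy plus potential of the relative equilibrium of radius [a]. *)
Definition const_bound : R := 3 * N%:R * om 1 ^+ 2 / (2 * a).

Let lower t : ((2^-1 * quad t + (const_bound + gap t))%:E <=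
  (2^-1 * kin t)%:E + U (y t))%E.
Proof.
have an : a != 0 by rewrite gt_eqF.
have cst (x : R) : \sum_(i : 'Z_N) x = N%:R * x.
  by rewrite sumr_const card_ord Zp_cast// mulr_natl.
have -> : 2^-1 * quad t + (const_bound + gap t) = 2^-1 * kin t +
   \sum_(i : 'Z_N) \sum_(j : 'Z_N | (i < j)%N)
   (3 / (2 * r (j - i)) - dist i j t ^+ 2 / (2 * r (j - i) ^+ 3)
    + (dist i j t - r (j - i)) ^+ 2 / (2 * r (j - i) ^+ 3)).
  rewrite /quad mulrBr -addrA; congr (_ + _).
  rewrite addrA; under [RHS]eq_bigr do rewrite big_split.
  rewrite [RHS]big_split; congr (_ + _).
  rewrite (@sum_pairs R N (fun i j =>
    3 / (2 * r (j - i)) - dist i j t ^+ 2 / (2 * r (j - i) ^+ 3))); last first.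
    by move=> i j; rewrite -[in RHS]rN opprB /dist enormN.
  under [in RHS]eq_bigr => d d0.
    rewrite (eq_bigr (fun i => 3 / (2 * r d) - (2 * r d ^+ 3)^-1 * dist (i + d) i t ^+ 2)); last first.
      by move=> i _; rewrite addrAC subrr add0r /dist enormN [_^-1 * _]mulrC.
    rewrite sumrB cst -mulr_sumr.
    over.
  rewrite sumrB mulrBr addrC; congr (_ - _).
    rewrite /const_bound (_ : 3 * N%:R * _ / _ =
      (2^-1 * (3 * N%:R / (2 * a))) * (2 * om 1 ^+ 2)); last by field.
    rewrite -sum_inv_rho// -mulrA; congr (_ * _); rewrite mulr_sumr; apply: eq_bigr => d d0.
    have := rhoZ_gt0 R hN d0 => r0; rewrite /r; field.
    by rewrite an gt_eqF.
  rewrite /pot !mulr_sumr; apply: eq_bigr => d d0.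
  have := rhoZ_gt0 R hN d0 => r0; rewrite /r; field.
  by rewrite an gt_eqF.
rewrite EFinD leeD2l// /U -sumEFin; apply: lee_sum => i _.
rewrite -sumEFin; apply: lee_sum => j ij; apply: inv_tangent; first exact: enorm_ge0.
apply: r_gt0; rewrite subr_eq0; apply: contraTneq ij => ->; by rewrite ltnn.
Qed.

Let gap_cont : cont 0 S gap.
Proof.
apply: cont_sum => i _; apply: cont_sum => j _.
have c : cont 0 S (fun t => dist i j t - r (j - i)).
  by apply: contD; [exact: dist_cont|exact: cont_cst].
by apply: contM; [exact: contM|exact: cont_cst].
Qed.

Lemma gap_ge0 t : 0 <= gap t.
Proof.
apply: sumr_ge0 => i _; apply: sumr_ge0 => j ij; rewrite divr_ge0 ?sqr_ge0// mulr_ge0//.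
by rewrite exprn_ge0// mulr_ge0 ?rho_ge0// ltW.
Qed.

(** Replacing [1/r] by its tangent line at the regular polygon bounds the action
   from below by a constant plus a quadratic form, diagonal in the modes, and a
   term controlling the mutual distances. *)
Lemma action_ge : ((2^-1 * quadratic_action + const_bound * S + Int 0 S gap)%:E
  <= action S varpi y)%E.
Proof.
have Lh l kap : L1 0 S (energyC varpi kap (hmode l) (dhmode l)).
  by apply: acC_energy; [exact: ltW|exact: hmode_ac].
have Lv l kap : L1 0 S (energyC 0 kap (vmode l) (dvmode l)).
  by apply: acC_energy; [exact: ltW|exact: vmode_ac].
have Lq : L1 0 S quad.
  apply: (L1_ext (fun t _ => esym (quadE t))); apply: L1Z; apply: L1_sum => l _.
  by apply: L1D.
have Lg := cont_L1 gap_cont.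
have <- : Int 0 S (fun t => 2^-1 * quad t + (const_bound + gap t)) =
    2^-1 * quadratic_action + const_bound * S + Int 0 S gap.
  have Lc := L1_cst 0 S const_bound.
  rewrite IntD; [|exact: L1Z|exact: L1D].
  rewrite IntZ// IntD// Int_cst ?ltW// subr0 addrA; congr (_ * _ + _ + _).
  rewrite (Int_ext (fun t _ => quadE t)) IntZ; last by apply: L1_sum => l _; exact: L1D.
  rewrite Int_sum; last by move=> l _; exact: L1D.
  by congr (_ * _); apply: eq_bigr => l _; rewrite IntD.
apply: Int_le_integral => [|t _|t _]; last exact: lower.
  by apply: L1D; [exact: L1Z|apply: L1D => //; exact: L1_cst].
apply: adde_ge0; first by rewrite lee_fin mulr_ge0// sumr_ge0// => j _; exact: sqr_ge0.
apply: sume_ge0 => i _; apply: sume_ge0 => j _.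
by rewrite inve_ge0 lee_fin enorm_ge0.
Qed.

(** A vanishing gap means that all the mutual distances are those of the regular
   polygon, at every time of the period by continuity. *)
Lemma gap0_dist : Int 0 S gap = 0 -> forall t, t \in `[0, S] ->
  forall i j : 'Z_N, enorm (y t i - y t j) = a * rd (j - i).
Proof.
move=> I0 t tS; have := cont_Int_eq0 S0 gap_cont (fun t _ => gap_ge0 t) I0 tS.
have pos (i j : 'Z_N) : (i < j)%N -> 0 <= (enorm (y t i - y t j) - r (j - i)) ^+ 2 / (2 * r (j - i) ^+ 3).
  move=> _; rewrite divr_ge0 ?sqr_ge0// mulr_ge0//.
  by rewrite exprn_ge0// mulr_ge0 ?rho_ge0// ltW.
move=> g0.
have H (i j : 'Z_N) : (i < j)%N -> enorm (y t i - y t j) = r (j - i).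
  move=> ij; have := g0; rewrite /gap => /eqP.
  rewrite psumr_eq0; last by move=> i' _; apply: sumr_ge0 => j' /pos.
  move=> /allP /(_ i (mem_index_enum _)) /=; rewrite psumr_eq0; last by move=> j' /pos.
  move=> /allP /(_ j (mem_index_enum _)); rewrite ij /= mulf_eq0 sqrf_eq0 subr_eq0.
  have rp : 0 < r (j - i).
    by apply: r_gt0; rewrite subr_eq0; apply: contraTneq ij => ->; rewrite ltnn.
  have rn : (2 * r (j - i) ^+ 3)^-1 != 0 by rewrite invr_eq0 gt_eqF// mulr_gt0// exprn_gt0.
  by rewrite (negbTE rn) orbF => /eqP.
move=> i j; have [ij|ij|/val_inj ->] := ltngtP i j; first exact: H.
  by rewrite enormN H// -rN opprB.
rewrite !subrr /rho expr0 subrr.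
by rewrite /enorm /= /ComplexField.Normc.normc /= !expr0n /= !addr0 sqrtr0 mulr0.
Qed.

End ActionBound.

(** * Sign of the energy of a mode *)

Section ModeEnergy.
Variables (R : realType) (N : nat) (k l e : int) (mu varpi kap : R) (n : nat).
Variables (F G : R -> R[i]).
Hypotheses (N0 : (0 < N)%N) (n0 : (0 < n)%N).
Hypothesis hF : acC 0 n%:R F G.
Hypothesis rule : phase_rule N k l e mu F.
Hypothesis low : forall q, admissible N k l e q -> kap <= (mu + varpi + 2 * pi * q%:~R) ^+ 2.

Local Notation T := (qperiod R N k).

(* the period of the loop is a multiple of the quasi-period *)
Let periods : exists2 m : nat, (0 < m)%N & m%:R * T = n%:R.
Proof.
have [M hM] := qgcd_dvdN N k; exists (2 * M * n)%N.
  by rewrite !muln_gt0 n0 andbT /=; case: M hM N0 => // ->; rewrite mul0n.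
have g0 : (qgcd N k)%:R != 0 :> R by rewrite pnatr_eq0 -lt0n qgcd_gt0.
have NE : N%:R = M%:R * (qgcd N k)%:R :> R by rewrite -natrM -hM.
have NR : N%:R != 0 :> R by rewrite pnatr_eq0 -lt0n.
have MR : M%:R != 0 :> R by move: NR; rewrite NE mulf_eq0 negb_or => /andP[].
by rewrite /qperiod !natrM NE; field; rewrite MR g0.
Qed.

Let nsq_int := Int 0 n%:R (fun t => nsq (F t)).

Let nsq_int_ge0 : 0 <= nsq_int.
Proof. by apply: Int_ge0 => t _; exact: nsq_ge0. Qed.

Let energy_cmp lam : Int 0 n%:R (energyC varpi kap F G) =
  Int 0 n%:R (energyC varpi (lam ^+ 2) F G) + (lam ^+ 2 - kap) * nsq_int.
Proof. by have [h1 h2] := hF; apply: Int_energyB. Qed.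

Let shift_lam lam q : lam = mu + varpi + 2 * pi * q%:~R -> admissible N k l e q ->
  forall t, F (t + T) = expi ((lam - varpi) * T) * F t.
Proof.
move=> lE hq t; rewrite (quasi_period_admissible N0 rule hq).
by rewrite lE; congr (expi (_ * _) * _); ring.
Qed.

Let wirtinger_ge0 q : admissible N k l e q ->
  `|mu + varpi + 2 * pi * q%:~R| * T <= pi ->
  0 <= Int 0 n%:R (energyC varpi ((mu + varpi + 2 * pi * q%:~R) ^+ 2) F G).
Proof.
move=> hq lT; have [m m0 mT] := periods; rewrite -mT.
apply: periodic_wirtinger lT; first exact: qperiod_gt0.
  by rewrite mT.
exact: shift_lam hq.
Qed.

(** The Wirtinger inequality at an admissible frequency that is small enough for
   the quasi-period, and whose square is at least [kap] as for all of them. *)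
Lemma mode_energy_ge0 : 0 <= Int 0 n%:R (energyC varpi kap F G).
Proof.
have [F0|[q0 hq0]] := zero_or_admissible N0 rule.
  apply: Int_ge0 => t _; rewrite energyCE F0 mulr0 addr0 nsq0 mulr0 subr0.
  exact: nsq_ge0.
have [q hq lT] := small_admissible N0 (mu + varpi) hq0.
rewrite (energy_cmp (mu + varpi + 2 * pi * q%:~R)) addr_ge0 ?wirtinger_ge0//.
by rewrite mulr_ge0// subr_ge0 low.
Qed.

(** Let [lam] be the frequency used for the inequality.  If [lam ^+ 2 > kap], the
   mean square of [F] has to vanish; otherwise the equality case of the Wirtinger
   inequality applies. *)
Lemma mode_energy_eq0 : Int 0 n%:R (energyC varpi kap F G) = 0 ->
  (forall x, x ^+ 2 = kap -> `|x| * T < pi) ->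
  (forall t, F t = 0) \/
  exists q, [/\ admissible N k l e q, (mu + varpi + 2 * pi * q%:~R) ^+ 2 = kap &
    forall t, F t = expi ((mu + 2 * pi * q%:~R) * t) * F 0].
Proof.
move=> I0 strict; have [|[q0 hq0]] := zero_or_admissible N0 rule; first by left.
have [q hq lT] := small_admissible N0 (mu + varpi) hq0.
set lam := mu + varpi + 2 * pi * q%:~R.
have h0 := wirtinger_ge0 hq lT.
have [m m0 mT] := periods.
have sh := shift_lam (erefl lam) hq.
have T0 : 0 < T := qperiod_gt0 R k N0.
move: I0; rewrite (energy_cmp lam) -/lam in h0 *; move=> I0.
have [kl|kl] := eqVneq (lam ^+ 2) kap.
  right; exists q; split=> // t.
  rewrite (@periodic_wirtinger_eq0 R F G T varpi lam m T0 _ sh m0 (strict _ kl)).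
  - by congr (expi (_ * _) * _); rewrite /lam; ring.
  - by rewrite mT.
  - by move: I0; rewrite kl subrr mul0r addr0 mT.
left; have lk : 0 < lam ^+ 2 - kap by rewrite subr_gt0 lt_neqAle eq_sym kl low.
have J0 : nsq_int = 0.
  by apply/eqP; rewrite eq_le nsq_int_ge0 andbT -(pmulr_rle0 _ lk); lra.
have z t : t \in `[0, n%:R] -> F t = 0.
  move=> tI; apply: nsq_eq0.
  have nR : 0 < n%:R :> R by rewrite ltr0n.
  exact: (cont_Int_eq0 nR (acC_nsq_cont (ltW nR) hF) (fun u _ => nsq_ge0 (F u)) J0).
move=> t; pose w := Num.floor (t / T).
have /andP[w1 w2] : w%:~R <= t / T < (w + 1)%:~R by exact: floor_itv.
rewrite -(subrK (w%:~R * T) t) (shiftZ sh) z ?mulr0//.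
move: w1 w2; rewrite ler_pdivlMr// ltr_pdivrMr// rmorphD mulrDl mul1r => w1 w2.
have Tn : T <= n%:R by rewrite -mT ler_peMl ?ler1n// ltW.
rewrite in_itv /= subr_ge0 w1 /= (le_trans _ Tn)//; lra.
Qed.

End ModeEnergy.

(** * Phase rules from the symmetry of a loop *)

Section Symmetry.
Variables (R : realType) (N : nat) (r s k eta : int) (y : R -> conf R N).
Hypotheses (hN : (1 < N)%N).
Hypothesis sym : G_symmetric r s k eta y.

Let NR : N%:R != 0 :> R. Proof. by rewrite pnatr_eq0 -lt0n ltnW. Qed.

Let sym1 (th : R) (d : 'Z_N) (beta : bool) (m : int) (j : 'Z_N) (t : R) :
  th = beta%:R / 2 + (k * eta)%:~R * ((d : nat)%:R / N%:R) + m%:~R ->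
  hor y j (t + th) = expi (2 * pi * (r%:~R / s%:~R * th - (d : nat)%:R / N%:R)) * hor y (j + d) t
  /\ ver y j (t + th) = (-1) ^+ beta * ver y (j + d) t.
Proof.
move=> hth; have := sym (or_introl (erefl 1)) (ex_intro _ m hth) j (t + th).
rewrite /= !mulr1z mul1r addrK => -[h1 h2]; split; first exact: h1.
rewrite /ver h2; case: (beta); rewrite ?expr1 ?expr0 ?mul1r// !mulN1r.
by apply: complex_eq; rewrite !ReImE // oppr0.
Qed.

(* integers written with representatives of Z/2 and Z/N *)
Let decompose (b d : int) : exists (beta : bool) (n : int) (d' : 'Z_N) (w : int),
  b = beta%:R + 2 * n /\ d = (d' : nat)%:Z + N%:Z * w.
Proof.
exists (odd `|(b %% 2)%Z|%N), (b %/ 2)%Z, (inZp `|(d %% N%:Z)%Z|%N), (d %/ N%:Z)%Z; split.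
  have := divz_eq b 2; have := modz_ge0 b (d := 2) isT; have := ltz_pmod b (d := 2) isT.
  move: (b %% 2)%Z (b %/ 2)%Z => x z x2 x0 ->; have [->|->] : x = 0 \/ x = 1 by lia.
    by rewrite /=; ring.
  by rewrite /=; ring.
have N0 : N%:Z != 0 by rewrite eqz_nat -lt0n ltnW.
have Np : 0 < N%:Z by rewrite ltz_nat ltnW.
rewrite /= modn_small; last first.
  rewrite Zp_cast//; have := ltz_pmod d Np; have := modz_ge0 d N0.
  by move: (d %% N%:Z)%Z => x; lia.
rewrite gez0_abs ?modz_ge0//; rewrite {1}(divz_eq d N%:Z); ring.
Qed.

Let decompose_time (b d n w : int) (beta : bool) (d' : 'Z_N) :
  b = beta%:R + 2 * n -> d = (d' : nat)%:Z + N%:Z * w ->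
  b%:~R / 2 + (k * eta)%:~R * (d%:~R / N%:R) =
  beta%:R / 2 + (k * eta)%:~R * ((d' : nat)%:R / N%:R) + (n + k * eta * w)%:~R :> R.
Proof.
move=> -> ->; rewrite !rmorphD !rmorphM /=.
have -> : (beta%:R : int)%:~R = beta%:R :> R by case: (beta).
by field.
Qed.

(** A translation of time by an element of the symmetry group permutes the labels
   cyclically and turns the plane, hence multiplies a mode by a phase. *)
Lemma hmode_rule l : phase_rule N (k * eta) (l - 1) 0 (2 * pi * (r%:~R / s%:~R)) (hmode y l).
Proof.
move=> b d t; have [beta [n [d' [w [hb hd]]]]] := decompose b d.
rewrite /= (decompose_time hb hd); set th := _ + _ + _.
rewrite /hmode (_ : (fun j => hor y j (t + th)) = fun j =>
  expi (2 * pi * (r%:~R / s%:~R * th - (d' : nat)%:R / N%:R)) * hor y (j + d') t); last first.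
  by apply/funext => j; exact: (proj1 (sym1 _ _ erefl)).
rewrite dftZ (dft_shift hN l d' (fun j => hor y j t)) mulrA; congr (_ * _).
rewrite -expiD -[LHS](expi_2piD _ ((l - 1) * w)); congr expi.
rewrite hd !rmorphD !rmorphM !rmorphN /=; move: th (r%:~R / s%:~R : R) => th mu.
by field.
Qed.

Lemma vmode_rule l : phase_rule N (k * eta) l 1 0 (vmode y l).
Proof.
move=> b d t; have [beta [n [d' [w [hb hd]]]]] := decompose b d.
rewrite /= (decompose_time hb hd); set th := _ + _ + _.
rewrite /vmode (_ : (fun j => ver y j (t + th)) = fun j =>
  (-1) ^+ beta * ver y (j + d') t); last first.
  by apply/funext => j; exact: (proj2 (sym1 _ _ erefl)).
rewrite dftZ (dft_shift hN l d' (fun j => ver y j t)) mulrA; congr (_ * _).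
have -> : (-1) ^+ beta = expi (pi * beta%:R) :> R[i].
  by case: (beta); rewrite ?mulr1 ?expi_pi// mulr0 expi0.
rewrite -expiD -[LHS](expi_2piD _ (n + l * w)); congr expi.
rewrite hb hd !rmorphD !rmorphM /=.
have -> : (beta%:R : int)%:~R = beta%:R :> R by case: (beta).
by move: th => th; field.
Qed.

(* the element of the group that reverses time and the labels *)
Let reflect j : hor y j 0 = (hor y (- j) 0)^*%C /\ ver y j 0 = (ver y (- j) 0)^*%C.
Proof.
have h0 : (0 : R) = false%:R / 2 + (k * eta)%:~R * (((0%R : 'Z_N) : nat)%:R / N%:R) + 0%:~R.
  by rewrite !(mul0r, mulr0, addr0).
have := sym (or_intror (erefl (-1))) (ex_intro _ 0 h0) j 0.
rewrite /= subr0 mulr0 mulN1r oppr0 addr0 mulrNz mulr1z => -[h1 h2].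
split; last by apply: complex_eq; rewrite !ReImE ?oppr0// h2 mul1r.
move: h1; rewrite (_ : 2 * pi * _ = 0) ?expi0 ?mul1r//.
by rewrite mul0r subrr !mulr0.
Qed.

Let mode_real (c : 'Z_N -> R[i]) l : (forall j, c j = (c (- j))^*%C) -> complex.Im (dft l c) = 0.
Proof.
move=> hc; have : dft l c = (dft l c)^*%C.
  rewrite [in RHS]/dft conjc_sum /dft (reindex_inj oppr_inj); apply: eq_bigr => j _.
  rewrite conjcM [in LHS]hc opprK -rtN; congr (_ * _); apply: rt_mod => //.
  rewrite mulNr opprK -mulNr -mulrDr; apply: dvdz_mull.
  by have := ZN_addz hN (- j) j; rewrite addNr /= sub0r dvdzE abszN -dvdzE.
by move=> /(congr1 (@complex.Im R)); rewrite !ReImE; lra.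
Qed.

Lemma hmode0_real l : complex.Im (hmode y l 0) = 0.
Proof. by apply: mode_real => j; have [] := reflect j. Qed.

Lemma vmode0_real l : complex.Im (vmode y l 0) = 0.
Proof. by apply: mode_real => j; have [] := reflect j. Qed.

End Symmetry.

(** * Configurations with the distances of the regular polygon *)

Section Rigidity.
Variables (R : realType) (N : nat) (a : R) (y : R -> conf R N) (t : R).
Hypotheses (hN : (2 < N)%N).
Let hN1 : (1 < N)%N. Proof. exact: ltnW. Qed.
Local Notation om := (omega R N).
Local Notation rd d := (rho R N (nat_of_ord (d : 'Z_N))).
Hypothesis ctr : centered (y t).
Hypothesis rigid : forall i j : 'Z_N, enorm (y t i - y t j) = a * rd (j - i).

Let NR : N%:R != 0 :> R. Proof. by rewrite pnatr_eq0 -lt0n ltnW. Qed.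

Lemma sum_ZN_cst (x : R) : \sum_(i : 'Z_N) x = N%:R * x.
Proof. by rewrite sumr_const card_ord Zp_cast// mulr_natl. Qed.

Lemma fst_sum (I : Type) (s : seq I) (F : I -> body R) :
  (\sum_(i <- s) F i).1 = \sum_(i <- s) (F i).1.
Proof. exact: (big_morph (fun u : body R => u.1)). Qed.

Lemma snd_sum (I : Type) (s : seq I) (F : I -> body R) :
  (\sum_(i <- s) F i).2 = \sum_(i <- s) (F i).2.
Proof. exact: (big_morph (fun u : body R => u.2)). Qed.

Lemma sum_nsq_rtB1 l : \sum_(d : 'Z_N | d != 0) nsq (rt R N (l * d%:Z) - 1)
  = if (N%:Z %| l)%Z then 0 else 2 * N%:R.
Proof.
have -> : \sum_(d : 'Z_N | d != 0) nsq (rt R N (l * d%:Z) - 1) =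
    \sum_(d : 'Z_N) nsq (rt R N (l * d%:Z) - 1).
  rewrite [RHS](bigD1 (0 : 'Z_N))//= mulr0 rt0 subrr nsq0 add0r.
  by [].
under eq_bigr do rewrite nsq_rtB1 -Re_expi.
rewrite -mulr_sumr sumrB sum_ZN_cst mulr1 -Re_sum.
have := rt_orth R hN1 l; rewrite /rt => ->; case: ifP => _.
  by rewrite (_ : complex.Re N%:R = N%:R) ?subrr ?mulr0// -(rmorph_nat (real_complex R)).
by rewrite Re_zero subr0.
Qed.

Let A l := nsq (hmode y l t) + nsq (vmode y l t).

Let A_ge0 l : 0 <= A l. Proof. by rewrite addr_ge0 ?nsq_ge0. Qed.

Let dist_sq (i j : 'Z_N) : enorm (y t i - y t j) ^+ 2 =
  nsq (hor y i t - hor y j t) + nsq (ver y i t - ver y j t).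
Proof. by rewrite enorm_sq /hor /ver /= /nsq !ReImE; ring. Qed.

(* the shape identity tested against an arbitrary translation invariant weight *)
Let shape (w : 'Z_N -> R) : \sum_(l : 'Z_N)
  (\sum_(d : 'Z_N | d != 0) w d * nsq (rt R N (l%:Z * d%:Z) - 1)) * A l%:Z =
  N%:R ^+ 2 * a ^+ 2 * \sum_(d : 'Z_N | d != 0) w d * rd d ^+ 2.
Proof.
have := f_equal2 +%R (shift_form hN1 w (fun j => hor y j t)) (shift_form hN1 w (fun j => ver y j t)).
rewrite -mulrDr -!big_split /= => /(congr1 (fun x => N%:R * x)).
rewrite mulrA mulfV// mul1r => E1.
under eq_bigr do rewrite mulrDr; rewrite -E1 !mulr_sumr; apply: eq_bigr => d d0.
rewrite -mulrDr -big_split /=.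
rewrite (eq_bigr (fun=> (a * rd d) ^+ 2)); first by rewrite sum_ZN_cst; ring.
move=> j _; rewrite -dist_sq rigid; congr ((a * _) ^+ 2).
by rewrite opprD addrA subrr add0r rhoN.
Qed.

Let A0 l : (N%:Z %| l)%Z -> A l = 0.
Proof.
move=> hl; have z (c : 'Z_N -> R[i]) : \sum_j c j = 0 -> dft l c = 0 :> R[i].
  move=> <-; apply: eq_bigr => j _; rewrite -[RHS]mul1r -(rt0 R N); congr (_ * _).
  by apply: rt_mod => //; rewrite subr0; apply: dvdz_mulr; rewrite dvdzE abszN -dvdzE.
have h1 : \sum_j hor y j t = 0 by rewrite -fst_sum ctr.
have h2 : \sum_j ver y j t = 0.
  have : \sum_j (y t j).2 = 0 by rewrite -snd_sum ctr.
  by move=> /(congr1 (real_complex R)); rewrite rmorph_sum rmorph0.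
by rewrite /A /hmode /vmode z// z// nsq0 addr0.
Qed.

Let sumA : \sum_(l : 'Z_N) A l%:Z = N%:R ^+ 2 * a ^+ 2.
Proof.
have := shape (fun=> 1).
under eq_bigr do under eq_bigr do rewrite mul1r.
under eq_bigr do rewrite sum_nsq_rtB1.
under [in RHS]eq_bigr => d _ do rewrite mul1r rho_sq// -[d%:Z]mul1r.
rewrite sum_nsq_rtB1 ifN; last by rewrite dvdzE /= dvdn1 gtn_eqF// ltnW.
have -> : \sum_(l : 'Z_N) (if (N%:Z %| l%:Z)%Z then 0 else 2 * N%:R) * A l%:Z =
    2 * N%:R * \sum_(l : 'Z_N) A l%:Z.
  rewrite mulr_sumr; apply: eq_bigr => l _; case: ifPn => // /A0 ->.
  by rewrite !mulr0.
have n2 : 2 * N%:R != 0 :> R by rewrite mulf_neq0// pnatr_eq0.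
by move=> h; apply: (mulfI n2); rewrite h mulrC.
Qed.

Let sumAom : \sum_(l : 'Z_N) om l%:Z ^+ 2 * A l%:Z = N%:R ^+ 2 * a ^+ 2 * om 1 ^+ 2.
Proof.
have := shape (fun d => (rd d ^+ 3)^-1).
have -> : \sum_(d : 'Z_N | d != 0) (rd d ^+ 3)^-1 * rd d ^+ 2 = 2 * om 1 ^+ 2.
  rewrite -sum_inv_rho//; apply: eq_bigr => d d0.
  by have := rhoZ_gt0 R hN1 d0; move=> r0; field; rewrite gt_eqF.
move=> h; apply: (mulfI (_ : 2 != 0 :> R)); first by rewrite pnatr_eq0.
rewrite [RHS]mulrCA -h mulr_sumr; apply: eq_bigr => l _.
by rewrite omega_sq// !mulrA mulfV ?pnatr_eq0// mul1r.
Qed.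

(** The sums over the modes of the squared amplitudes, with the weights 1 and
   omega_l^2, are those of the polygon; as omega_1 is the smallest frequency, no
   amplitude is left for the other modes. *)
Lemma rigid_modes (l : 'Z_N) : ~~ (N%:Z %| l%:Z - 1)%Z -> ~~ (N%:Z %| l%:Z + 1)%Z ->
  hmode y l%:Z t = 0 /\ vmode y l%:Z t = 0.
Proof.
move=> l1 lm1; suff : A l%:Z = 0.
  move/eqP; rewrite paddr_eq0 ?nsq_ge0// => /andP[/eqP/nsq_eq0 -> /eqP/nsq_eq0 ->].
  by [].
have [/A0//|l0] := boolP (N%:Z %| l%:Z)%Z.
have : \sum_(m : 'Z_N) (om m%:Z ^+ 2 - om 1 ^+ 2) * A m%:Z = 0.
  under eq_bigr do rewrite mulrBl; rewrite sumrB sumAom -mulr_sumr sumA; ring.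
move/eqP; rewrite psumr_eq0 => [/allP /(_ l (mem_index_enum _))|m _]; last first.
  have [/A0->|m0] := boolP (N%:Z %| m%:Z)%Z; first by rewrite mulr0.
  rewrite mulr_ge0// subr_ge0; have := omega1_le R hN1 m0; have := omega_ge0 R N 1; nra.
rewrite /= mulf_eq0 subr_eq0 => /orP[|/eqP//].
have := omega1_lt R hN1 l0 l1 lm1; have := omega_ge0 R N 1.
by move=> o0 olt /eqP oeq; exfalso; nra.
Qed.

(** The sum of the squared distances from one body to all the others determines
   its distance to the center of mass, the total moment being known. *)
Lemma rigid_norm (j : 'Z_N) : enorm (y t j) ^+ 2 = a ^+ 2.
Proof.
have par (c : 'Z_N -> R) (q : R) : \sum_i c i = 0 ->
    \sum_i (c i - q) ^+ 2 = \sum_i c i ^+ 2 + N%:R * q ^+ 2.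
  move=> c0; have -> : \sum_i c i ^+ 2 + N%:R * q ^+ 2
    = \sum_i c i ^+ 2 + N%:R * q ^+ 2 + - (2 * q) * \sum_i c i by rewrite c0 mulr0 addr0.
  by rewrite mulr_sumr -sum_ZN_cst -!big_split; apply: eq_bigr => i _ /=; ring.
have h1 : \sum_i (y t i).1 = 0 by rewrite -fst_sum ctr.
have h2 : \sum_i (y t i).2 = 0 by rewrite -snd_sum ctr.
have hr : \sum_i complex.Re (y t i).1 = 0 by rewrite -Re_sum h1.
have hi : \sum_i complex.Im (y t i).1 = 0 by rewrite -Im_sum h1.
have E1 : \sum_i enorm (y t i - y t j) ^+ 2 =
   \sum_i enorm (y t i) ^+ 2 + N%:R * enorm (y t j) ^+ 2.
  under eq_bigr => i _ do rewrite enorm_sq /nsq /= !ReImE.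
  rewrite !big_split /= (par _ _ hr) (par _ _ hi) (par _ _ h2).
  under [in RHS]eq_bigr => i _ do rewrite enorm_sq /nsq.
  by rewrite !big_split /= enorm_sq /nsq; ring.
have E2 : \sum_i enorm (y t i - y t j) ^+ 2 = 2 * N%:R * a ^+ 2.
  rewrite (reindex_inj (addrI j)) /=.
  transitivity (a ^+ 2 * \sum_(d : 'Z_N | d != 0) rd d ^+ 2).
    rewrite [LHS](bigD1 (0 : 'Z_N))//= addr0 subrr (_ : enorm 0 = 0) ?expr0n ?add0r; last first.
      by rewrite /enorm /= expr0n /= !addr0 sqrtr0.
    rewrite mulr_sumr; apply: eq_bigr => d d0; rewrite rigid -exprMn.
    by rewrite opprD addrA subrr add0r rhoN.
  under eq_bigr => d _ do rewrite rho_sq// -[d%:Z]mul1r.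
  rewrite sum_nsq_rtB1 ifN; last by rewrite dvdzE /= dvdn1 gtn_eqF// ltnW.
  by ring.
have E3 : \sum_i enorm (y t i) ^+ 2 = N%:R * a ^+ 2.
  apply: (mulfI NR); rewrite mulrA -expr2 -sumA /A big_split /= /hmode /vmode.
  rewrite !parseval// -mulrDr -big_split; congr (_ * _); apply: eq_bigr => i _.
  by rewrite enorm_sq /hor /ver nsqC.
apply: (mulfI NR); move: E1; rewrite E2 E3; lra.
Qed.

Let ZN1 : ((1%R : 'Z_N) : nat) = 1%N. Proof. by rewrite /= modn_small// Zp_cast. Qed.

Let ZNN1 : (N%:Z %| ((- (1 : 'Z_N))%R : nat)%:Z + 1)%Z.
Proof. by have := ZN_addz hN1 (- 1) 1; rewrite addNr ZN1 /= sub0r dvdzE abszN -dvdzE. Qed.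

Let two_modes (m : 'Z_N -> R[i]) (c : 'Z_N -> R[i]) (j : 'Z_N) :
  (forall l : 'Z_N, ~~ (N%:Z %| l%:Z - 1)%Z -> ~~ (N%:Z %| l%:Z + 1)%Z -> dft l%:Z c = 0) ->
  N%:R * c j = rt R N j%:Z * dft 1 c + rt R N (- j%:Z) * dft (-1) c.
Proof.
move=> hz; rewrite -(dft_inv hN1) (bigD1 (1 : 'Z_N))//= (bigD1 (- 1 : 'Z_N))/=; last first.
  apply/eqP => h; have := ZNN1; rewrite h ZN1 dvdzE /= => /dvdn_leq.
  by move=> /(_ isT); rewrite leqNgt hN.
rewrite big1 ?addr0 => [|l /andP[l1 lm1]]; last first.
  rewrite hz ?mulr0//.
    by apply: contra l1 => h; apply/eqP; apply: (ZN_dvd R hN1); rewrite ZN1.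
  apply: contra lm1 => h; apply/eqP; apply: (ZN_dvd R hN1).
  rewrite (_ : _ - _ = (l%:Z + 1) - (((- (1 : 'Z_N))%R : nat)%:Z + 1)); last by ring.
  by move: h ZNN1 => /dvdzP[q1 ->] /dvdzP[q2 ->]; rewrite -mulrBl dvdz_mull.
rewrite -[((1 %% _)%N)]/((1%R : 'Z_N) : nat) ZN1 mul1r; congr (_ + _ * _).
  apply: rt_mod => //; rewrite (_ : _ - _ = (((- (1 : 'Z_N))%R : nat)%:Z + 1) * j%:Z); last by ring.
  by apply: dvdz_mulr.
by apply: dft_mod => //; rewrite opprK.
Qed.

Lemma rigid_hor j : N%:R * hor y j t =
  rt R N j%:Z * hmode y 1 t + rt R N (- j%:Z) * hmode y (-1) t.
Proof. by apply: two_modes => // l l1 lm1; have [] := rigid_modes l1 lm1. Qed.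

Lemma rigid_ver j : N%:R * ver y j t =
  rt R N j%:Z * vmode y 1 t + rt R N (- j%:Z) * vmode y (-1) t.
Proof. by apply: two_modes => // l l1 lm1; have [] := rigid_modes l1 lm1. Qed.

End Rigidity.

(** * The relative equilibrium *)

Section RelativeEquilibrium.
Variables (R : realType) (N : nat) (k eta r s : int) (varpi X mu : R).
Hypotheses (hN : (2 < N)%N) (hs : 1 <= s).
Hypotheses (muE : mu = 2 * pi * (r%:~R / s%:~R)) (XE : X = varpi + mu).
Hypothesis X0 : X != 0.
Let hN1 : (1 < N)%N. Proof. exact: ltnW. Qed.
Local Notation om := (omega R N).
Local Notation a := (Defs.radius N X).
Local Notation S := (s%:~R : R).
Local Notation rd d := (rho R N (nat_of_ord (d : 'Z_N))).
Let ybar : R -> conf R N := rel_eq_rotating varpi X.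

Let S0 : 0 < S. Proof. by rewrite ltr0z; apply: lt_le_trans hs. Qed.

Lemma radius_gt0 : 0 < a.
Proof. by rewrite powR_gt0 ?divr_gt0 ?omega1_gt0 ?normr_gt0. Qed.

(** Kepler's third law for the polygon. *)
Lemma radius_cube : a ^+ 3 = om 1 ^+ 2 / X ^+ 2.
Proof.
have b0 : 0 < om 1 / `|X| by rewrite divr_gt0 ?omega1_gt0 ?normr_gt0.
rewrite /Defs.radius -powR_mulrn ?powR_ge0// -powRrM (_ : 2 / 3 * 3%:R = 2%:R :> R); last by field.
by rewrite powR_mulrn ?ltW// expr_div_n real_normK ?num_real.
Qed.

Lemma ybar_hor j t : hor ybar j t = a%:C%C * (rt R N j%:Z * expi (mu * t)).
Proof.
rewrite /hor /ybar /rel_eq_rotating /rel_eq /= zetaX// mulrA -expiD mulrCA; congr (_ * _).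
by rewrite mulrC; congr (_ * expi _); rewrite XE; ring.
Qed.

Lemma ybar_ver j t : (ybar t j).2 = 0.
Proof. by rewrite /= mulr0. Qed.

Let ybar_ver0 j t : ver ybar j t = 0.
Proof. by rewrite /ver ybar_ver. Qed.

Let ybar_angle j t : hor ybar j t = a%:C%C * expi (mu * t + 2 * pi * (j%:R / N%:R)).
Proof. by rewrite ybar_hor /rt -expiD addrC. Qed.

Let ybar_dhor (j : 'Z_N) t : R[i] := (0 +i* mu)%C * hor ybar j t.

Let ybar_ac (j : 'Z_N) : acC 0 S (hor ybar j) (ybar_dhor j).
Proof.
split.
  apply: ac_ext (acZ a (ac_cos 0 S mu (2 * pi * (j%:R / N%:R)))) => t _ /=.
    by rewrite ybar_angle !ReImE; ring.
  by rewrite /ybar_dhor ybar_angle !ReImE; ring.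
apply: ac_ext (acZ a (ac_sin 0 S mu (2 * pi * (j%:R / N%:R)))) => t _ /=.
  by rewrite ybar_angle !ReImE; ring.
by rewrite /ybar_dhor ybar_angle !ReImE; ring.
Qed.

Lemma body_eq (u v : body R) : u.1 = v.1 -> u.2 = v.2 -> u = v.
Proof. by case: u v => ? ? [? ?] /= -> ->. Qed.

Lemma ybar_Lambda : Lambda S ybar.
Proof.
split=> [t|j|t].
- apply/funext => j; apply: body_eq; last by rewrite !ybar_ver.
  rewrite -/(hor ybar j (t + S)) -/(hor ybar j t) !ybar_hor; congr (_ * (_ * _)).
  rewrite -[RHS](expi_2piD _ r); congr expi; rewrite muE; field.
  by rewrite gt_eqF.
- have [h1 h2] := ybar_ac j; split; eexists; apply: ac_weak_derivative; first exact: h1.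
    exact: h2.
  by apply: ac_ext (ac_cst 0 S 0) => // t _; rewrite /coordz ybar_ver.
- apply: body_eq; rewrite ?fst_sum ?snd_sum; last by rewrite big1 // => j _; rewrite ybar_ver.
  rewrite (eq_bigr (fun j : 'Z_N => a%:C%C * expi (mu * t) * rt R N (1 * j%:Z))).
    rewrite -mulr_sumr rt_orth// ifN ?mulr0//.
    by rewrite dvdzE /= dvdn1 gtn_eqF// ltnW.
  by move=> j _; rewrite -/(hor ybar j t) ybar_hor mul1r -mulrA [expi _ * _]mulrC.
Qed.

Lemma ybar_symmetric : G_symmetric r s k eta ybar.
Proof.
move=> th d beta xi hxi _ al j t u; split; last first.
  by rewrite ybar_ver /u ybar_ver mulr0.
rewrite -/(hor ybar j t) ybar_hor.
have jd : rt R N (j + d)%R%:Z = rt R N j%:Z * rt R N d%:Z.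
  by rewrite -rtD; apply: rt_mod => //; exact: ZN_addz.
have phase : a%:C%C * (rt R N j%:Z * expi (mu * t)) = expi (2 * pi * al) *
    (a%:C%C * (rt R N (j + d)%R%:Z * expi (mu * (t - th)))).
  rewrite jd [RHS]mulrCA; congr (_ * _).
  rewrite /rt -!expiD; congr expi; rewrite /al muE.
  by move: (r%:~R / s%:~R : R) => q; ring.
have yh j' t' : (ybar t' j').1 = a%:C%C * (rt R N j'%:Z * expi (mu * t')) by exact: ybar_hor.
case: hxi => xiE; subst xi; rewrite /u.
  by rewrite eqxx !mulr1z mul1r yh.
rewrite (_ : (-1 == 1 :> int) = false)// !mulrNz !mulr1z mulN1r.
rewrite yh phase; congr (_ * _).
rewrite !conjcM expi_conj; congr (_ * (_ * _)).
- by apply: complex_eq; rewrite !ReImE ?oppr0.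
- rewrite -rtN; apply: rt_mod => //.
  have /dvdzP[w hw] := ZN_addz hN1 (- (j + d)) (j + d); rewrite addNr /= sub0r in hw.
  by apply/dvdzP; exists (- w); rewrite mulNr -hw; ring.
- by congr expi; ring.
Qed.

Let ybar_dist (i j : 'Z_N) t : enorm (ybar t i - ybar t j) = a * rd (j - i).
Proof.
apply/eqP; rewrite -(@eqrXn2 _ 2)// ?enorm_ge0 ?mulr_ge0 ?rho_ge0 ?ltW ?radius_gt0//.
apply/eqP; rewrite enorm_sq exprMn rho_sq//.
have -> : (ybar t i - ybar t j).2 = 0.
  by transitivity ((ybar t i).2 - (ybar t j).2) => //; rewrite !ybar_ver subrr.
rewrite expr0n addr0 -[(_ - _).1]/(hor ybar i t - hor ybar j t) !ybar_hor.
have -> : rt R N j%:Z = rt R N i%:Z * rt R N (j - i)%R%:Z.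
  rewrite -rtD -[in LHS](subrK i j) [j - i + i]addrC.
  by apply: rt_mod => //; exact: ZN_addz.
have -> : a%:C%C * (rt R N i%:Z * expi (mu * t)) -
    a%:C%C * (rt R N i%:Z * rt R N (j - i)%R%:Z * expi (mu * t)) =
    a%:C%C * (rt R N i%:Z * (expi (mu * t) * (- (rt R N (j - i)%R%:Z - 1)))) by ring.
rewrite !nsqM nsqC nsq_rt nsq_expi !mul1r; congr (_ * _).
by rewrite /nsq !ReImE; ring.
Qed.

Let an : a != 0. Proof. by rewrite gt_eqF ?radius_gt0. Qed.

Let ybar_U t : U (ybar t) = (N%:R * om 1 ^+ 2 / a)%:E.
Proof.
transitivity ((\sum_(i : 'Z_N) \sum_(j : 'Z_N | (i < j)%N) (a * rd (j - i))^-1)%:E).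
  rewrite /U -sumEFin; apply: eq_bigr => i _; rewrite -sumEFin; apply: eq_bigr => j ij.
  rewrite ybar_dist inver gt_eqF//.
  rewrite mulr_gt0 ?radius_gt0 ?rhoZ_gt0// subr_eq0.
  by apply: contraTneq ij => ->; rewrite ltnn.
congr (_%:E); rewrite (@sum_pairs R N (fun i j => (a * rd (j - i))^-1)); last first.
  by move=> i j; rewrite -(@rhoN R N hN1 (j - i)) opprB.
have -> : \sum_(d : 'Z_N | d != 0) \sum_(i : 'Z_N) (a * rd (i + d - i))^-1
    = N%:R * a^-1 * \sum_(d : 'Z_N | d != 0) (rd d)^-1.
  rewrite mulr_sumr; apply: eq_bigr => d _.
  rewrite (eq_bigr (fun=> (a * rd d)^-1)); first by rewrite sum_ZN_cst// invfM; ring.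
  by move=> i _; rewrite addrAC subrr add0r.
by rewrite sum_inv_rho//; field.
Qed.

(** The relative equilibrium attains the constant of the lower bound: its two
   terms are constant in time, and X^2 a^2 = omega_1^2 / a. *)
Lemma ybar_action : action S varpi ybar = (const_bound N a * S)%:E.
Proof.
have hy := ybar_Lambda.
have Xsq : X ^+ 2 * a ^+ 2 = om 1 ^+ 2 / a.
  have -> : om 1 ^+ 2 = X ^+ 2 * a ^+ 3 by rewrite radius_cube; field.
  by field.
pose K t := norm2 (fun j => velocity S ybar t j + bscale varpi (Jgen (ybar t j))).
have KE t : K t = \sum_(j : 'Z_N) (energyC varpi 0 (hor ybar j) (dhor S ybar j) t
    + energyC 0 0 (ver ybar j) (dver S ybar j) t) by exact: norm2_velocity.
have Lh (j : 'Z_N) : L1 0 S (energyC varpi 0 (hor ybar j) (dhor S ybar j)).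
  by apply: acC_energy; [exact: ltW|exact: hor_ac].
have Lv (j : 'Z_N) : L1 0 S (energyC 0 0 (ver ybar j) (dver S ybar j)).
  by apply: acC_energy; [exact: ltW|exact: ver_ac].
have LK : L1 0 S K.
  apply: (L1_ext (fun t _ => esym (KE t))); apply: L1_sum => j _; exact: L1D.
have Ih (j : 'Z_N) : Int 0 S (energyC varpi 0 (hor ybar j) (dhor S ybar j)) = om 1 ^+ 2 / a * S.
  rewrite (Int_energy_unique varpi 0 (ltW S0) (hor_ac hy j) (ybar_ac j)).
  rewrite (@Int_ext _ _ _ _ (fun=> om 1 ^+ 2 / a)) ?Int_cst ?ltW ?subr0// => t _.
  rewrite energyCE mul0r subr0 /ybar_dhor -mulrDl nsqM ybar_hor !nsqM nsqC nsq_rt nsq_expi.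
  by rewrite -Xsq /nsq !ReImE XE; ring.
have Iv (j : 'Z_N) : Int 0 S (energyC 0 0 (ver ybar j) (dver S ybar j)) = 0.
  have h0 : acC 0 S (ver ybar j) (fun=> 0).
    by split; apply: ac_ext (ac_cst 0 S 0) => // t _; rewrite /comp ybar_ver0.
  rewrite (Int_energy_unique 0 0 (ltW S0) (ver_ac hy j) h0).
  rewrite (@Int_ext _ _ _ _ (fun=> 0)) ?Int_cst ?ltW ?mul0r// => t _.
  by rewrite energyCE ybar_ver0 mulr0 addr0 nsq0 mul0r subr0.
rewrite /action -[RHS](_ : (Int 0 S (fun t => 2^-1 * K t + N%:R * om 1 ^+ 2 / a))%:E = _).
  rewrite Int_EFin; last by apply: L1D; [exact: L1Z|exact: L1_cst].
  by apply: eq_integral => t _; rewrite ybar_U.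
congr (_%:E); rewrite IntD; [|exact: L1Z|exact: L1_cst].
rewrite (IntZ 2^-1 LK) Int_cst ?ltW// subr0 (Int_ext (fun t _ => KE t)) Int_sum; last first.
  by move=> j _; exact: L1D.
under eq_bigr do rewrite IntD// Ih Iv addr0.
by rewrite sum_ZN_cst// /const_bound; field.
Qed.
End RelativeEquilibrium.

(** * Tilted orbits *)

Definition angle (R : realType) (N : nat) (X : R) (j : 'Z_N) (t : R) : R :=
  2 * pi * (j%:R / N%:R) + X * t.

Section Congruence.
Variables (R : realType) (N : nat) (X varpi a c0 c1 b : R) (y : R -> conf R N).
Hypothesis a0 : 0 < a.
Hypothesis aE : a = Defs.radius N X.
Hypotheses (e1 : (c0 + c1) ^+ 2 + b ^+ 2 = a ^+ 2) (e2 : (c0 - c1) ^+ 2 = a ^+ 2).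
Local Notation th := (@angle R N X).
Hypothesis hh : forall t (j : 'Z_N), expi (varpi * t) * (y t j).1 =
  (((c0 + c1) * cos (th j t)) +i* ((c0 - c1) * sin (th j t)))%C.
Hypothesis hz : forall t (j : 'Z_N), (y t j).2 = b * cos (th j t).

(** The orbit of the polygon turned about a diameter of its circle, possibly
   composed with a reflection: the images of the first two axes are the vectors
   [(c0 + c1, 0, b) / a] and [(0, (c0 - c1) / a, 0)]. *)
Lemma tilted_congruent : congruent_motions (inertial varpi y) (@rel_eq R N X).
Proof.
have an : a != 0 by rewrite gt_eqF.
pose g (u : body R) : body R :=
  ((((complex.Re u.1 * (c0 + c1) - u.2 * b) / a) +i* (complex.Im u.1 * (c0 - c1) / a))%C,
   (complex.Re u.1 * b + u.2 * (c0 + c1)) / a).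
exists g; split.
- move=> u v; apply/eqP; rewrite -(@eqrXn2 _ 2)// ?enorm_ge0// !enorm_sq /nsq.
  apply/eqP; rewrite /g /= !ReImE.
  move: (complex.Re u.1) (complex.Im u.1) u.2 (complex.Re v.1) (complex.Im v.1) v.2 => p q w p' q' w'.
  have -> : ((p * (c0 + c1) - w * b) / a - (p' * (c0 + c1) - w' * b) / a) ^+ 2 +
    (q * (c0 - c1) / a - q' * (c0 - c1) / a) ^+ 2 +
    ((p * b + w * (c0 + c1)) / a - (p' * b + w' * (c0 + c1)) / a) ^+ 2 =
    (((p - p') ^+ 2 + (w - w') ^+ 2) * ((c0 + c1) ^+ 2 + b ^+ 2)
     + (q - q') ^+ 2 * (c0 - c1) ^+ 2) / a ^+ 2 by field.
  by rewrite e1 e2; field.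
- rewrite /g (_ : (0 : body R).1 = 0)// (_ : (0 : body R).2 = 0)//.
  by rewrite Re_zero Im_zero !mul0r subrr addr0 mul0r.
move=> t j.
have r1 : (@rel_eq R N X t j).1 = a%:C%C * (rt R N j%:Z * expi (X * t)).
  by rewrite /rel_eq /= zetaX// -aE mulrCA [expi _ * _]mulrC.
have r2 : (@rel_eq R N X t j).2 = 0 by rewrite /= mulr0.
have cE : cos (th j t) = complex.Re (rt R N j%:Z * expi (X * t)).
  by rewrite /angle /rt -expiD.
have sE : sin (th j t) = complex.Im (rt R N j%:Z * expi (X * t)).
  by rewrite /angle /rt -expiD.
have /= := f_equal2 pair (hh t j) (hz t j); rewrite /inertial /rotJ => ->.
rewrite /g r1 r2 cE sE; move: (rt R N j%:Z * expi (X * t)) => z.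
have aRe : complex.Re (a%:C%C * z) = a * complex.Re z by rewrite !ReImE mul0r subr0.
have aIm : complex.Im (a%:C%C * z) = a * complex.Im z by rewrite !ReImE mul0r addr0.
rewrite aRe aIm !mul0r subr0 addr0.
by congr ((_ +i* _)%C, _); field.
Qed.

End Congruence.

(** * Minimality, and the case of equality *)

Definition direct_amplitude (R : realType) (N : nat) (y : R -> conf R N) : R :=
  complex.Re (hmode y 1 0) / N%:R.

Definition retrograde_amplitude (R : realType) (N : nat) (y : R -> conf R N) : R :=
  complex.Re (hmode y (-1) 0) / N%:R.

(** A real oscillation of amplitude [b] splits into the modes 1 and -1, which are
   conjugate to each other. *)
Definition vertical_amplitude (R : realType) (N : nat) (y : R -> conf R N) : R :=
  2 * complex.Re (vmode y 1 0) / N%:R.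

Section Minimizers.
Variables (R : realType) (N : nat) (k eta r s : int) (varpi X mu : R).
Hypotheses (hN : (2 < N)%N) (hk1 : 1 <= k) (hk2 : 2 * k <= N%:Z).
Hypotheses (heta : eta = 1 \/ eta = -1) (hs : 1 <= s).
Hypotheses (muE : mu = 2 * pi * (r%:~R / s%:~R)) (XE : X = varpi + mu).
Hypothesis X0 : X != 0.
Hypothesis XV : (- Order.min (Vbound R N k eta) (Hminus R N k eta) <= X%:E)%E /\
  (X%:E <= Order.min (Vbound R N k eta) (Hplus R N k eta))%E.
Variable y : R -> conf R N.
Hypothesis hy : LambdaG r s k eta y.

Let hN1 : (1 < N)%N. Proof. exact: ltnW. Qed.
Let N0 : (0 < N)%N. Proof. exact: ltnW. Qed.
Local Notation om := (omega R N).
Local Notation a := (Defs.radius N X).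
Local Notation S := (s%:~R : R).
Local Notation rd d := (rho R N (nat_of_ord (d : 'Z_N))).
Local Notation ybar := (@rel_eq_rotating R N varpi X).
Local Notation n := `|s|%N.

Let yL : Lambda S y. Proof. by case: hy. Qed.
Let ysym : G_symmetric r s k eta y. Proof. by case: hy. Qed.

Let nS : n%:R = S. Proof. by rewrite -[LHS]/((`|s|%N%:Z)%:~R) gez0_abs//; apply: le_trans hs. Qed.
Let n0 : (0 < n)%N. Proof. by lia. Qed.
Let S0 : 0 < S. Proof. by rewrite -nS ltr0n. Qed.
Let a0 : 0 < a. Proof. exact: radius_gt0. Qed.
Let p0 : 0 < pi :> R. Proof. exact: pi_gt0. Qed.
Let muX : mu + varpi = X. Proof. by rewrite XE addrC. Qed.

Lemma kappa_polygon l : kappa N a l * om 1 ^+ 2 = X ^+ 2 * om l ^+ 2.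
Proof.
have o1 := omega1_gt0 R hN1.
have F (o x w : R) : o != 0 -> x != 0 -> w / (o ^+ 2 / x ^+ 2) * o ^+ 2 = x ^+ 2 * w.
  by move=> on xn; field; rewrite on xn.
by rewrite /kappa radius_cube// F// gt_eqF.
Qed.

Lemma kappa_le l x : X ^+ 2 * om l ^+ 2 <= om 1 ^+ 2 * x ^+ 2 -> kappa N a l <= x ^+ 2.
Proof.
have o1 := omega1_gt0 R hN1; rewrite -kappa_polygon [_ * om 1 ^+ 2]mulrC ler_pM2l//.
by rewrite exprn_gt0.
Qed.

Lemma kappa_direct : kappa N a 1 = X ^+ 2.
Proof.
have o1 := omega1_gt0 R hN1; apply: (mulIf (_ : om 1 ^+ 2 != 0)); last exact: kappa_polygon.
by rewrite expf_neq0// gt_eqF.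
Qed.

Lemma hmode_frequency_ge l q : admissible N (k * eta) (l - 1) 0 q ->
  kappa N a l <= (mu + varpi + 2 * pi * q%:~R) ^+ 2.
Proof. by move=> hq; apply: kappa_le; rewrite muX; exact: (horizontal_mode hN1 X0 XV.1 XV.2 hq). Qed.

Lemma vmode_frequency_ge l q : admissible N (k * eta) l 1 q ->
  kappa N a l <= (0 + 0 + 2 * pi * q%:~R) ^+ 2.
Proof. by move=> hq; apply: kappa_le; rewrite !add0r; exact: (vertical_mode hN1 X0 XV.1 XV.2 hq). Qed.

Lemma hmode_acn l : acC 0 n%:R (hmode y l) (dhmode S y l). Proof. by rewrite nS; exact: hmode_ac. Qed.
Lemma vmode_acn l : acC 0 n%:R (vmode y l) (dvmode S y l). Proof. by rewrite nS; exact: vmode_ac. Qed.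

Lemma hmode_rule_mu l : phase_rule N (k * eta) (l - 1) 0 mu (hmode y l).
Proof. by rewrite muE; exact: hmode_rule. Qed.

Definition hmode_energy l := Int 0 S (energyC varpi (kappa N a l) (hmode y l) (dhmode S y l)).
Definition vmode_energy l := Int 0 S (energyC 0 (kappa N a l) (vmode y l) (dvmode S y l)).

Lemma hmode_energy_ge0 l : 0 <= hmode_energy l.
Proof.
by have := mode_energy_ge0 N0 n0 (hmode_acn l) (hmode_rule_mu l) (@hmode_frequency_ge l); rewrite nS.
Qed.

Lemma vmode_energy_ge0 l : 0 <= vmode_energy l.
Proof.
by have := mode_energy_ge0 N0 n0 (vmode_acn l) (vmode_rule hN1 ysym l) (@vmode_frequency_ge l); rewrite nS.
Qed.

Lemma quadratic_action_ge0 : 0 <= quadratic_action S varpi a y.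
Proof.
apply: mulr_ge0; first by rewrite invr_ge0.
by apply: sumr_ge0 => l _; exact: (addr_ge0 (hmode_energy_ge0 l%:Z) (vmode_energy_ge0 l%:Z)).
Qed.

Lemma Int_gap_ge0 : 0 <= Int 0 S (gap a y).
Proof. by apply: Int_ge0 => t _; exact: gap_ge0. Qed.

Lemma polygon_minimizes : (action S varpi ybar <= action S varpi y)%E.
Proof.
rewrite (ybar_action hN hs muE XE X0); apply: le_trans (action_ge varpi hN1 S0 a0 yL).
by rewrite lee_fin; move: quadratic_action_ge0 Int_gap_ge0; lra.
Qed.

Lemma minimizer_equalities : action S varpi y = action S varpi ybar ->
  quadratic_action S varpi a y = 0 /\ Int 0 S (gap a y) = 0.
Proof.
move=> eqA; have := action_ge varpi hN1 S0 a0 yL; rewrite eqA (ybar_action hN hs muE XE X0) lee_fin.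
by move: quadratic_action_ge0 Int_gap_ge0; lra.
Qed.

Hypothesis equalities : quadratic_action S varpi a y = 0 /\ Int 0 S (gap a y) = 0.

Lemma ZN_residue (l : int) : exists l' : 'Z_N, (N%:Z %| l - l'%:Z)%Z.
Proof.
have Nn0 : N%:Z != 0 by rewrite eqz_nat -lt0n.
have [m mN hm] : exists2 m : nat, (m < N)%N & (N%:Z %| l - m%:Z)%Z.
  exists `|(l %% N%:Z)%Z|%N; have E := gez0_abs (modz_ge0 l Nn0).
    by rewrite -ltz_nat E ltz_pmod// ltz_nat.
  by rewrite E {1}(divz_eq l N%:Z) addrK dvdz_mull.
exists (inZp m); suff -> : (inZp m : 'Z_N) = m :> nat by [].
rewrite /= modn_small; first by [].
by rewrite Zp_cast; [exact: mN|exact: hN1].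
Qed.

(** A sum of nonnegative terms over the residues mod [N] vanishes, and a mode
   depends on its index mod [N] only. *)
Lemma mode_energies_eq0 l : hmode_energy l = 0 /\ vmode_energy l = 0.
Proof.
have [l' hl] := ZN_residue l.
have -> : hmode_energy l = hmode_energy l'%:Z.
  rewrite /hmode_energy /kappa (omega_mod R hN1 hl); congr Int; congr energyC; apply/funext => t.
    exact: dft_mod.
  exact: dft_mod.
have -> : vmode_energy l = vmode_energy l'%:Z.
  rewrite /vmode_energy /kappa (omega_mod R hN1 hl); congr Int; congr energyC; apply/funext => t.
    exact: dft_mod.
  exact: dft_mod.
have [+ _] := equalities; rewrite /quadratic_action.
have -> : \sum_(l : 'Z_N) (Int 0 S (energyC varpi (kappa N a l%:Z) (hmode y l%:Z) (dhmode S y l%:Z)) +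
   Int 0 S (energyC 0 (kappa N a l%:Z) (vmode y l%:Z) (dvmode S y l%:Z)))
   = \sum_(l : 'Z_N) (hmode_energy l%:Z + vmode_energy l%:Z) by [].
have := vmode_energy_ge0; have := hmode_energy_ge0; move: hmode_energy vmode_energy => f g f0 g0 /eqP.
rewrite mulf_eq0 invr_eq0 pnatr_eq0 -leqn0 leqNgt N0 /=.
rewrite psumr_eq0 => [/allP /(_ l' (mem_index_enum _))|m _]; last exact: addr_ge0.
by rewrite (paddr_eq0 (f0 _) (g0 _)) => /andP[/eqP h1 /eqP h2]; split; [exact: h1|exact: h2].
Qed.

(** The vanishing gap gives this on the first period, and periodicity elsewhere. *)
Lemma polygon_distances t (i j : 'Z_N) : enorm (y t i - y t j) = a * rd (j - i).
Proof.
have [_ G0] := equalities.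
have per (m : int) u : y (u + m%:~R * S) = y u.
  have [hper _ _] := yL.
  have H (p : nat) v : y (v + p%:R * S) = y v.
    elim: p v => [|p IH] v; first by rewrite mul0r addr0.
    by rewrite -natr1 mulrDl mul1r addrA hper IH.
  case: (intP m) => [|p|p]; [exact: (H 0%N)|exact: (H p.+1)|].
  by rewrite rmorphN mulNr -[in RHS](subrK (p.+1%:R * S) u) H.
pose m := Num.floor (t / S).
have /andP[m1 m2] : m%:~R <= t / S < (m + 1)%:~R by exact: floor_itv.
have -> : y t = y (t - m%:~R * S) by rewrite -[in LHS](subrK (m%:~R * S) t) per.
apply: (gap0_dist hN1 S0 a0 yL G0).
move: m1 m2; rewrite ler_pdivlMr// ltr_pdivrMr// rmorphD mulrDl mul1r => m1 m2.
by rewrite in_itv /= subr_ge0 m1 /=; lra.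
Qed.

Let ctr t : centered (y t). Proof. by have [_ _] := yL. Qed.

Lemma speed_le : `|X| <= 2 * pi.
Proof. exact: (frequency_le hN1 heta X0 XV.1 XV.2 hk1 hk2). Qed.

Lemma speed_max : `|X| = 2 * pi -> k = 1.
Proof.
move=> hX; have [//|k1] : k = 1 \/ 1 < k by lia.
by have := frequency_lt hN1 heta X0 XV.1 XV.2 k1 hk2 hN; rewrite hX ltxx.
Qed.

(** The quasi-period is 1 / (2 M) with M = N / gcd(N, 2 k).  As |X| <= 2 pi, only
   M = 1 could be critical; but then [N] divides 2 k, so k > 1 and |X| < 2 pi. *)
Lemma subcritical x : x ^+ 2 = X ^+ 2 -> `|x| * qperiod R N (k * eta) < pi.
Proof.
move=> xX; have -> : `|x| = `|X|.
  by apply/eqP; rewrite -(@eqrXn2 _ 2)// !real_normK ?num_real// xX.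
have [M hM] := qgcd_dvdN N (k * eta); have [c hc] := qgcd_dvdk N (k * eta).
have g0 : (qgcd N (k * eta))%:R != 0 :> R by rewrite pnatr_eq0 -lt0n qgcd_gt0.
have NE : N%:R = M%:R * (qgcd N (k * eta))%:R :> R by rewrite -natrM -hM.
have M0 : (0 < M)%N by case: M hM N0 {NE} => // ->.
have MR : M%:R != 0 :> R by rewrite pnatr_eq0 -lt0n.
have -> : qperiod R N (k * eta) = (2 * M%:R)^-1.
  by rewrite /qperiod NE; field; rewrite MR g0.
rewrite ltr_pdivrMr ?mulr_gt0 ?ltr0n//.
have [M2|M1] := leqP 2 M.
  have : 0 <= (M%:R - 2) * pi :> R by rewrite mulr_ge0 ?subr_ge0 ?ler_nat// ltW.
  by move: speed_le p0; lra.
have {}M1 : M = 1%N by lia.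
have gN : qgcd N (k * eta) = N by rewrite [RHS]hM M1 mul1n.
have k1 : 1 < k.
  rewrite gN in hc; have [//|kk] : 1 < k \/ k = 1 by lia.
  have := multiple_small (etrans hc (mulrC _ _)); rewrite kk mul1r; clear -heta hN.
  by case: heta => ->; lia.
have := frequency_lt hN1 heta X0 XV.1 XV.2 k1 hk2 hN.
by rewrite M1; lra.
Qed.

(** The frequency is -X, so that pi q = - X, and |X| <= 2 pi leaves two even
   values of [q]. *)
Lemma opposite_frequency q : (exists m, q = 0 + 2 * m) -> q != 0 ->
  (mu + varpi + 2 * pi * q%:~R) ^+ 2 = X ^+ 2 ->
  [/\ k = 1, X = - (pi * q%:~R) & q = 2 \/ q = -2].
Proof.
move=> [m hm] q0 /eqP; rewrite muX eqf_sqr => /orP[/eqP h|/eqP h].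
  have : 2 * pi * q%:~R = 0 :> R by apply: (addrI X); rewrite addr0.
  by move/eqP; rewrite !mulf_eq0 !(gt_eqF p0) pnatr_eq0 intr_eq0 (negbTE q0).
have Xq : X = - (pi * q%:~R) by lra.
have := speed_le; rewrite Xq normrN normrM (gtr0_norm p0) mulrC ler_pM2r// -intr_norm.
rewrite -[2]/(2%:~R) ler_int => q2.
have q22 : q = 2 \/ q = -2 by lia.
split=> //; apply: speed_max; rewrite Xq normrN normrM (gtr0_norm p0) -intr_norm mulrC.
by case: q22 => ->.
Qed.

(** The frequency -X, with k = 1 and q = 2 or -2, would require that [N] divides
   q eta, hence 2. *)
Lemma hmode1_pure t : hmode y 1 t = expi (mu * t) * hmode y 1 0.
Proof.
have [E0 _] := mode_energies_eq0 1; rewrite /hmode_energy -{1}nS in E0.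
have str x : x ^+ 2 = kappa N a 1 -> `|x| * qperiod R N (k * eta) < pi.
  by rewrite kappa_direct; exact: subcritical.
have [z|[q [[h1 [m2 h2]] h3 h4]]] :=
  mode_energy_eq0 N0 n0 (hmode_acn 1) (hmode_rule_mu 1) (@hmode_frequency_ge 1) E0 str.
  by rewrite !z mulr0.
have [q0|q0] := eqVneq q 0; first by rewrite h4 q0 mulr0 addr0.
rewrite kappa_direct in h3; have [kk _ q2] := opposite_frequency h1 q0 h3.
exfalso; rewrite kk mul1r subrr add0r in h2; have := multiple_small h2.
by clear -heta q2 hN; case: heta q2 => -> [] ->; lia.
Qed.

(** The harmonics of this mode satisfy q k eta = -2 mod N.  This excludes q = 0,
   the frequency X; for the frequency -X it leaves q = - 2 eta, or q = 2 eta if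
   [N] divides 4. *)
Lemma hmodeN1_cases : (forall t, hmode y (-1) t = 0) \/
  [/\ k = 1, X = 2 * pi * eta%:~R \/ (N = 4%N /\ X = - (2 * pi * eta%:~R)) &
    forall t, hmode y (-1) t = expi ((mu - 2 * X) * t) * hmode y (-1) 0].
Proof.
have [E0 _] := mode_energies_eq0 (-1); rewrite /hmode_energy -{1}nS in E0.
have kN1 : kappa N a (-1) = X ^+ 2 by rewrite -kappa_direct /kappa omegaN.
have str x : x ^+ 2 = kappa N a (-1) -> `|x| * qperiod R N (k * eta) < pi.
  by rewrite kN1; exact: subcritical.
have [z|[q [[h1 [m2 h2]] h3 h4]]] :=
  mode_energy_eq0 N0 n0 (hmode_acn (-1)) (hmode_rule_mu (-1)) (@hmode_frequency_ge (-1)) E0 str.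
  by left.
right; rewrite kN1 in h3.
have q0 : q != 0.
  apply/eqP => qz; rewrite qz mul0r in h2.
  have /multiple_small : 2 = N%:Z * m2 by clear -h2; lia.
  by clear -hN; lia.
have [kk Xq q2] := opposite_frequency h1 q0 h3.
split=> // [|t]; last by rewrite h4 Xq; congr (expi (_ * _) * _); ring.
rewrite kk in h2.
have [qe|qe] : q = - 2 * eta \/ q = 2 * eta by case: heta q2 => -> [] ->; lia.
  by left; rewrite Xq qe rmorphM rmorphN /=; ring.
right; split; last by rewrite Xq qe rmorphM /=; ring.
have e2 : eta * eta = 1 by case: heta => ->.
have {}h2 : N%:Z * m2 = 4 by move: h2; rewrite qe mul1r -mulrA e2; clear; lia.
have := multiple_small (esym h2); have [N3|N3] : N = 3%N \/ (3 < N)%N by clear -hN; lia.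
  by clear -h2 N3; rewrite N3 in h2; lia.
by clear -hN N3; lia.
Qed.

(** The frequency 2 pi q has modulus |X| <= 2 pi and [q] is odd, so q = 1 or -1;
   and q k eta = 1 mod N selects q = eta. *)
Lemma vmode1_cases : (forall t, vmode y 1 t = 0) \/
  [/\ k = 1, `|X| = 2 * pi & forall t, vmode y 1 t = expi (2 * pi * eta%:~R * t) * vmode y 1 0].
Proof.
have [_ E0] := mode_energies_eq0 1; rewrite /vmode_energy -{1}nS in E0.
have str x : x ^+ 2 = kappa N a 1 -> `|x| * qperiod R N (k * eta) < pi.
  by rewrite kappa_direct; exact: subcritical.
have [z|[q [[[m1 h1] [m2 h2]] h3 h4]]] :=
  mode_energy_eq0 N0 n0 (vmode_acn 1) (vmode_rule hN1 ysym 1) (@vmode_frequency_ge 1) E0 str.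
  by left.
right; rewrite kappa_direct !add0r in h3.
have Xq : `|X| = 2 * pi * `|q|%:~R.
  apply/eqP; rewrite -(@eqrXn2 _ 2)//; last by rewrite mulr_ge0 ?mulr_ge0 ?ler0z// ltW.
  by rewrite real_normK ?num_real// -h3 intr_norm !exprMn real_normK ?num_real.
have q1 : `|q| = 1.
  have := speed_le; rewrite Xq -[leRHS]mulr1 ler_pM2l ?mulr_gt0// -[1]/(1%:~R) ler_int.
  by lia.
have X2 : `|X| = 2 * pi by rewrite Xq q1 mulr1.
have kk := speed_max X2; split=> // t; rewrite h4 add0r.
have qe : q = eta.
  have [//|qe] : q = eta \/ q = - eta by case: heta => ->; lia.
  exfalso; rewrite kk mul1r qe in h2; have e2 : eta * eta = 1 by case: heta => ->.
  have {}h2 : N%:Z * m2 = -2 by move: h2; rewrite mulNr e2; clear; lia.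
  by have := multiple_small (esym h2); clear -hN; lia.
by rewrite qe.
Qed.

Let NR : N%:R != 0 :> R. Proof. by rewrite pnatr_eq0 -lt0n. Qed.

Local Notation c0 := (direct_amplitude y).
Local Notation c1 := (retrograde_amplitude y).
Local Notation b := (vertical_amplitude y).

Lemma real_complexE (z : R[i]) : complex.Im z = 0 -> z = (complex.Re z)%:C%C.
Proof. by case: z => x z /= ->. Qed.

Lemma direct_amplitudeE : hmode y 1 0 = (N%:R * c0)%:C%C.
Proof. by rewrite (real_complexE (hmode0_real hN1 ysym 1)) /direct_amplitude mulrC divfK. Qed.

Lemma retrograde_amplitudeE : hmode y (-1) 0 = (N%:R * c1)%:C%C.
Proof. by rewrite (real_complexE (hmode0_real hN1 ysym (-1))) /retrograde_amplitude mulrC divfK. Qed.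

Lemma vertical_amplitudeE : vmode y 1 0 = (N%:R * b / 2)%:C%C.
Proof.
rewrite {1}(real_complexE (vmode0_real hN1 ysym 1)) /vertical_amplitude; congr (_%:C)%C.
by field.
Qed.

Lemma hmodeN1_pure t : hmode y (-1) t = expi ((mu - 2 * X) * t) * hmode y (-1) 0.
Proof. by have [z|[]//] := hmodeN1_cases; rewrite !z mulr0. Qed.

Lemma vmode1_pure t : vmode y 1 t = expi (2 * pi * eta%:~R * t) * vmode y 1 0.
Proof. by have [z|[]//] := vmode1_cases; rewrite !z mulr0. Qed.

Local Notation th := (@angle R N X).

Let natC : (N%:R : R[i]) = (N%:R : R)%:C%C.
Proof. by rewrite (rmorph_nat (real_complex R)). Qed.

(** Two opposite circular motions add up to a motion on an ellipse. *)
Lemma hor_ellipse t (j : 'Z_N) : expi (varpi * t) * (y t j).1 =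
  (((c0 + c1) * cos (th j t)) +i* ((c0 - c1) * sin (th j t)))%C.
Proof.
have NC : (N%:R : R[i]) != 0 by rewrite pnatr_eq0 -lt0n.
apply: (mulfI NC); rewrite mulrCA (rigid_hor hN (ctr t) (polygon_distances t)).
rewrite hmode1_pure hmodeN1_pure direct_amplitudeE retrograde_amplitudeE.
rewrite mulrDr.
have -> : expi (varpi * t) * (rt R N j%:Z * (expi (mu * t) * (N%:R * c0)%:C%C)) =
   (N%:R * c0)%:C%C * expi (th j t).
  rewrite !mulrA -[RHS]mulrC; congr (_ * _); rewrite /rt -!expiD; congr expi.
  by rewrite /angle -muX; ring.
have -> : expi (varpi * t) * (rt R N (- j%:Z) * (expi ((mu - 2 * X) * t) * (N%:R * c1)%:C%C)) =
   (N%:R * c1)%:C%C * expi (- th j t).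
  rewrite !mulrA -[RHS]mulrC; congr (_ * _); rewrite /rt -!expiD; congr expi.
  by rewrite /angle -muX rmorphN /=; ring.
by rewrite natC; apply: complex_eq; rewrite !ReImE ?cosN ?sinN; ring.
Qed.

Lemma ver_oscillation t (j : 'Z_N) : (y t j).2 = b * cos (2 * pi * (j%:R / N%:R) + 2 * pi * eta%:~R * t).
Proof.
have vN1 : vmode y (-1) t = (vmode y 1 t)^*%C.
  rewrite /vmode /dft conjc_sum; apply: eq_bigr => i _; rewrite conjcM -rtN mulNr !opprK.
  by congr (_ * _); apply: complex_eq; rewrite /ver !ReImE ?oppr0.
have := rigid_ver hN (ctr t) (polygon_distances t) j.
rewrite vN1 rtN -conjcM vmode1_pure vertical_amplitudeE => /(congr1 (@complex.Re R)).
rewrite natC /rt mulrA -expiD !ReImE => h.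
apply: (mulfI NR); move: h; rewrite !mul0r !mulr0 !subr0 => ->.
by field.
Qed.

Lemma ellipse_norm t (j : 'Z_N) : ((c0 + c1) * cos (th j t)) ^+ 2 + ((c0 - c1) * sin (th j t)) ^+ 2
  + (y t j).2 ^+ 2 = a ^+ 2.
Proof.
rewrite -(rigid_norm hN (ctr t) (polygon_distances t) j) enorm_sq; congr (_ + _).
by rewrite -[RHS]mul1r -(nsq_expi (varpi * t)) -nsqM hor_ellipse /nsq !ReImE.
Qed.

Let ZN0 : ((0%R : 'Z_N) : nat) = 0%N. Proof. by []. Qed.

Lemma angle0 t : th 0 t = X * t.
Proof. by rewrite /angle ZN0 mul0r mulr0 add0r. Qed.

Lemma speed_sign : `|X| = 2 * pi -> X = 2 * pi * eta%:~R \/ X = - (2 * pi * eta%:~R).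
Proof.
move=> hX; have /orP[/eqP h|/eqP h] : (X == 2 * pi) || (X == - (2 * pi)).
- by have := eqxx `|X|; rewrite {2}hX eqr_norml => /andP[].
- by case: heta => ->; rewrite ?rmorphN ?mulr1z ?mulrN ?mulr1 ?opprK; [left|right].
- by case: heta => ->; rewrite ?rmorphN ?mulr1z ?mulrN ?mulr1 ?opprK; [right|left].
Qed.

(** The body 0 is at distance [a] from the center at time 0, when it is on the
   first axis of its ellipse and at the top of its oscillation, and a quarter of a
   turn later, when it is on the second axis and at height 0. *)
Lemma quarter_turn : `|X| = 2 * pi ->
  (c0 + c1) ^+ 2 + b ^+ 2 = a ^+ 2 /\ (c0 - c1) ^+ 2 = a ^+ 2.
Proof.
move=> hX; split.
  have := ellipse_norm 0 0; rewrite angle0 ver_oscillation ZN0 !(mulr0, mul0r, addr0, cos0, sin0, mulr1).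
  by rewrite expr0n addr0.
have := ellipse_norm (pi / 2 / X) 0; rewrite angle0 ver_oscillation ZN0 mul0r mulr0 add0r.
have -> : X * (pi / 2 / X) = pi / 2 by rewrite mulrC divfK.
have -> : cos (2 * pi * eta%:~R * (pi / 2 / X)) = 0.
  have [h|h] := speed_sign hX.
    by rewrite -h mulrC divfK// cos_pihalf.
  have -> : 2 * pi * eta%:~R = - X by rewrite h opprK.
  by rewrite mulNr cosN mulrC divfK// cos_pihalf.
by rewrite cos_pihalf sin_pihalf !mulr0 mulr1 expr0n /= add0r addr0.
Qed.

(** The remaining amplitude is real, and of modulus [a]. *)
Lemma flat_rotation : c1 = 0 -> b = 0 -> y = ybar \/ y = (fun t j => rotJ pi (ybar t j)).
Proof.
move=> hc1 hb; have c0a : c0 ^+ 2 = a ^+ 2.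
  have := ellipse_norm 0 0; rewrite angle0 ver_oscillation hb hc1.
  rewrite !(mulr0, mul0r, addr0, subr0, cos0, sin0, mulr1).
  by rewrite expr0n /= !addr0.
have yh t j : (y t j).1 = c0%:C%C * (rt R N j%:Z * expi (mu * t)).
  apply: (mulfI (expi_neq0 (varpi * t))); rewrite hor_ellipse hc1 addr0 subr0.
  rewrite mulrCA [expi _ * (_ * _)]mulrCA -expiD /rt -expiD.
  rewrite (_ : _ + (_ + _) = th j t); last by rewrite /angle -muX; ring.
  by apply: complex_eq; rewrite !ReImE; ring.
have yv t j : (y t j).2 = 0 by rewrite ver_oscillation hb mul0r.
have yb t j : (ybar t j).1 = a%:C%C * (rt R N j%:Z * expi (mu * t)) by exact: ybar_hor.
have ybv t j : (ybar t j).2 = 0 by exact: ybar_ver.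
move/eqP: c0a; rewrite eqf_sqr => /orP[/eqP c0a|/eqP c0a]; [left|right].
  apply/funext => t; apply/funext => j; apply: body_eq; first by rewrite yh c0a yb.
  by rewrite yv ybv.
apply/funext => t; apply/funext => j; apply: body_eq; last by rewrite yv -(ybv t j).
rewrite yh c0a [RHS]/(expi pi * (ybar t j).1) yb expi_pi.
by apply: complex_eq; rewrite !ReImE; ring.
Qed.

Lemma minimizer_cases : [\/ y = ybar, y = (fun t j => rotJ pi (ybar t j)) |
  [/\ k = 1, X = 2 * pi * eta%:~R \/ (N = 4%N /\ X = - (2 * pi * eta%:~R)) &
    congruent_motions (inertial varpi y) (@rel_eq R N X)]].
Proof.
have flat : c1 = 0 -> b = 0 -> [\/ y = ybar, y = (fun t j => rotJ pi (ybar t j)) |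
  [/\ k = 1, X = 2 * pi * eta%:~R \/ (N = 4%N /\ X = - (2 * pi * eta%:~R)) &
    congruent_motions (inertial varpi y) (@rel_eq R N X)]].
  by move=> h1 h2; have [h|h] := flat_rotation h1 h2; [constructor 1|constructor 2].
have c1_cases : c1 = 0 \/ (k = 1 /\
    (X = 2 * pi * eta%:~R \/ (N = 4%N /\ X = - (2 * pi * eta%:~R)))).
  have [z|[h1 h2 _]] := hmodeN1_cases; last by right.
  by left; rewrite /retrograde_amplitude z Re_zero mul0r.
have b_cases : b = 0 \/ (k = 1 /\ `|X| = 2 * pi).
  have [z|[h1 h2 _]] := vmode1_cases; last by right.
  by left; rewrite /vertical_amplitude z Re_zero mulr0 mul0r.
have normE : X = 2 * pi * eta%:~R \/ X = - (2 * pi * eta%:~R) -> `|X| = 2 * pi.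
  have e1 : `|eta%:~R| = 1 :> R by case: heta => ->; rewrite ?rmorphN ?normrN /= normr1.
  by case=> ->; rewrite ?normrN normrM e1 mulr1 ger0_norm// mulr_ge0// ltW.
(* for this sign of X the vertical oscillation is in phase with the rotation *)
have tilted : k = 1 -> X = 2 * pi * eta%:~R ->
    congruent_motions (inertial varpi y) (@rel_eq R N X).
  move=> kk hX; have [e1 e2] := quarter_turn (normE (or_introl hX)).
  by apply: (tilted_congruent a0 erefl e1 e2 hor_ellipse) => t j; rewrite ver_oscillation /angle hX.
have [kk|kk] := eqVneq k 1; last first.
  by apply: flat; [case: c1_cases|case: b_cases] => // -[h]; rewrite h eqxx in kk.
have [hX|hX] := eqVneq `|X| (2 * pi); last first.
  apply: flat; last by case: b_cases => // -[_ h]; rewrite h eqxx in hX.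
  by case: c1_cases => // -[_ h]; case/eqP: hX; apply: normE; case: h => [|[]]; tauto.
have [h|h] := speed_sign hX; first by constructor 3; split=> //; [left|exact: tilted].
have [e1 e2] := quarter_turn hX.
case: c1_cases => [z|[_ [h'|[N4 _]]]].
- apply: flat => //; move: e1 e2; rewrite z addr0 subr0 => e1 e2.
  by apply/eqP; rewrite -sqrf_eq0; apply/eqP; lra.
- by constructor 3; split=> //; [left|exact: tilted].
(* for the other sign and four bodies, the distance between two consecutive
   bodies at the time when X t = - pi / 4 excludes the vertical oscillation *)
have b0 : b = 0.
  pose t : R := - (pi / 4) / X.
  have Xt : X * t = - (pi / 4) by rewrite /t mulrC divfK.
  have Et : 2 * pi * eta%:~R * t = pi / 4.
    by rewrite (_ : 2 * pi * eta%:~R = - X) ?mulNr ?Xt ?opprK// h opprK.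
  have ZN1 : ((1%R : 'Z_N) : nat) = 1%N by rewrite /= modn_small// Zp_cast.
  have N4R : N%:R = 4 :> R by rewrite N4.
  have th1 : th 1 t = pi / 4 by rewrite /angle ZN1 N4R Xt; field.
  have ph1 : 2 * pi * (((1%R : 'Z_N) : nat)%:R / N%:R) + 2 * pi * eta%:~R * t = pi - pi / 4.
    by rewrite ZN1 N4R Et; field.
  have cc : cos (pi / 4) ^+ 2 = 2^-1 :> R.
    have := cos_mulr2n (pi / 4 : R); rewrite (_ : (pi / 4) *+ 2 = pi / 2); last by rewrite mulr2n; field.
    by rewrite cos_pihalf mulr2n; lra.
  have ss : sin (pi / 4) ^+ 2 = 2^-1 :> R by rewrite sin2cos2 cc; field.
  have := polygon_distances t 1 0; rewrite sub0r rhoN// => /(congr1 (fun x => x ^+ 2)).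
  rewrite enorm_sq exprMn rho_sq// nsq_rtB1 ZN1 N4R.
  rewrite (_ : 2 * pi * _ = pi / 2); last by field.
  rewrite cos_pihalf subr0 mulr1 (_ : nsq (y t 1 - y t 0).1 =
    nsq (expi (varpi * t) * (y t 1 - y t 0).1)); last by rewrite nsqM nsq_expi mul1r.
  have -> : (y t 1 - y t 0).1 = (y t 1).1 - (y t 0).1 by [].
  have -> : (y t 1 - y t 0).2 = (y t 1).2 - (y t 0).2 by [].
  rewrite mulrBr !hor_ellipse angle0 Xt th1 !ver_oscillation ph1 ZN0 mul0r mulr0 add0r Et.
  rewrite cosN sinN cosB cospi sinpi /nsq !ReImE => E.
  apply/eqP; rewrite -sqrf_eq0; apply/eqP.
  have : 4 * (c0 - c1) ^+ 2 * sin (pi / 4) ^+ 2 + 4 * b ^+ 2 * cos (pi / 4) ^+ 2 = a ^+ 2 * 2.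
    by rewrite -E; ring.
  by rewrite cc ss e2; lra.
constructor 3; split=> //; first by right.
by apply: (tilted_congruent a0 erefl e1 e2 hor_ellipse) => t j; rewrite ver_oscillation b0 !mul0r.
Qed.

End Minimizers.

Theorem theorem23 (R : realType) (N : nat) (k eta r s : int) (varpi : R)
    (hN : (3 <= N)%N)
    (hk1 : 1 <= k) (hk2 : 2 * k <= N%:Z)
    (heta : eta = 1 \/ eta = -1)
    (hs : 1 <= s) (hrs : coprimez r s) :
  let X : R := varpi + 2 * pi * (r%:~R / s%:~R) in
  let ybar : R -> conf R N := @rel_eq_rotating R N varpi X in
  let A : (R -> conf R N) -> \bar R := action s%:~R varpi in
  X != 0 ->
  (- Order.min (Vbound R N k eta) (Hminus R N k eta) <= X%:E)%E ->
  (X%:E <= Order.min (Vbound R N k eta) (Hplus R N k eta))%E ->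
  [/\ LambdaG r s k eta ybar,
      forall y : R -> conf R N, LambdaG r s k eta y -> (A ybar <= A y)%E &
      forall y : R -> conf R N, LambdaG r s k eta y -> A y = A ybar ->
        [\/ y = ybar,
            y = (fun t j => rotJ pi (ybar t j)) |
            [/\ k = 1,
                X = 2 * pi * eta%:~R \/ (N = 4%N /\ X = - (2 * pi * eta%:~R)) &
                congruent_motions (inertial varpi y) (@rel_eq R N X)]]].
Proof.
move=> X ybar A X0 Xge Xle; split.
- by split; [exact: ybar_Lambda|exact: ybar_symmetric].
- by move=> y hy; exact: (polygon_minimizes hN hk1 hk2 heta hs (erefl _) (erefl _) X0 (conj Xge Xle) hy).
- move=> y hy /(minimizer_equalities hN hk1 hk2 heta hs (erefl _) (erefl _) X0 (conj Xge Xle) hy).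
  by exact: (minimizer_cases hN hk1 hk2 heta hs (erefl _) (erefl _) X0 (conj Xge Xle) hy).
Qed.
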